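(* Let $\mathbf{k}$ be an algebraically closed field of characteristic $0$. Let $T$ be the variety of triangles in $\mathbb{P}^2$, $\tau:\widehat T\to T$ the Cartanized variety of triangles (for $\mathfrak{sl}_3$) and $\tau_{\mathrm{Sch}}:T^{\mathrm{Sch}}\to T$ Schubert's variety of complete triangles. Then $\widehat T$ is isomorphic to $T^{\mathrm{Sch}}$ as a variety over $T$ (so that $\tau$ corresponds to $\tau_{\mathrm{Sch}}$). In particular, $\widehat T$ is smooth, while $T^{\mathrm{Sch}}$ carries a rank $2$ vector bundle whose fibers are abelian Lie subalgebras in $\mathfrak{sl}_3$.
   Context: $\mathbb{P}^2$ is the projective plane of lines in $\mathbf{k}^3$ and $\check{\mathbb{P}}^2=\operatorname{Gr}(2,\mathbf{k}^3)$ the dual plane of lines in $\mathbb{P}^2$. $(\mathbb{P}^2)^3_{\mathrm{gen}}\subset(\mathbb{P}^2)^3$ is the open set of triples of non-collinear points. For $x=(x_1,x_2,x_3)\in(\mathbb{P}^2)^3_{\mathrm{gen}}$ put $l_{ij}(x)=\operatorname{Span}(x_i,x_j)\in\check{\mathbb{P}}^2$; let $\mathfrak{h}_x\subset\mathfrak{sl}_3$ be the Cartan subalgebra of traceless operators diagonal in a basis representing $x_1,x_2,x_3$; and let $N_x=\{q\in S^2(\mathbf{k}^{3*}) : q(x_1)=q(x_2)=q(x_3)=0\}$, a $3$-dimensional space of quadratic forms. * $T$ is the closure in $(\mathbb{P}^2)^3\times(\check{\mathbb{P}}^2)^3$ of the set of points $(x_1,x_2,x_3,l_{12}(x),l_{13}(x),l_{23}(x))$,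 $x\in(\mathbb{P}^2)^3_{\mathrm{gen}}$. * $R\subset\operatorname{Gr}(2,\mathfrak{sl}_3)$ (the variety of reductions) is the closure of the set of all Cartan subalgebras of $\mathfrak{sl}_3$. It carries the tautological rank $2$ bundle, whose fibers are abelian Lie subalgebras. * $\widehat T$ is the closure in $T\times R$ of the set of points $(x_1,x_2,x_3,l_{12}(x),l_{13}(x),l_{23}(x),\mathfrak{h}_x)$, $x\in(\mathbb{P}^2)^3_{\mathrm{gen}}$, and $\tau$ is the projection to $T$. * $T^{\mathrm{Sch}}$ is the closure in $(\mathbb{P}^2)^3\times(\check{\mathbb{P}}^2)^3\times\operatorname{Gr}(3,S^2(\mathbf{k}^{3*}))$ of the set of points $(x_1,x_2,x_3,l_{12}(x),l_{13}(x),l_{23}(x),N_x)$, $x\in(\mathbb{P}^2)^3_{\mathrm{gen}}$, and $\tau_{\mathrm{Sch}}$ is the projection to $T$. *)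

(* Defs.v *)
From HB Require Import structures.
From mathcomp Require Import all_boot all_algebra.
From mathcomp Require Import mpoly.

Set Implicit Arguments.
Unset Strict Implicit.
Unset Printing Implicit Defensive.

Import GRing.Theory.
Local Open Scope ring_scope.

(* Classical varieties over [k] are subsets of projective spaces: a type of
   points together with a choice of homogeneous coordinates for each point.
   Every notion below depends on these coordinates only up to rescaling at
   each point (and up to linear changes of coordinates). *)
Record pspace (k : closedFieldType) := PSpace {
  pt :> Type;
  idx : finType;
  crd : pt -> idx -> k;
  crd_neq0 : forall x, exists i, crd x i != 0
}.
Arguments crd {k} p x i.

Section Geometry.
Variable k : closedFieldType.
Implicit Types X Y : pspace k.

Definition forms X := {mpoly k[#|idx X|]}.

Definition ev X (f : forms X) (x : X) : k :=
  f.@[fun i => crd X x (enum_val i)].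

Definition zclosed X (Z : X -> Prop) : Prop :=
  exists S : forms X -> Prop,
    (forall f, S f -> exists d, f \is d.-homog) /\
    (forall x, Z x <-> forall f, S f -> ev f x = 0).

Definition zopen X (U : X -> Prop) : Prop := zclosed (fun x => ~ U x).

Definition zclosure X (Z : X -> Prop) (x : X) : Prop :=
  forall C : X -> Prop, zclosed C -> (forall y, Z y -> C y) -> C x.

Definition sub X (A : X -> Prop) : pspace k :=
  @PSpace k {x : X | A x} (idx X) (fun x => crd X (sval x))
          (fun x => crd_neq0 (sval x)).

(* Regular k-valued functions on an open set: locally quotients of forms of
   the same degree. *)
Definition regular_on X (U : X -> Prop) (s : X -> k) : Prop :=
  forall x, U x -> exists d (g h : forms X),
    [/\ g \is d.-homog, h \is d.-homog, ev h x != 0 &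
        forall y, U y -> ev h y != 0 -> s y = ev g y / ev h y].

(* Regular maps: near every point the homogeneous coordinates of the image are
   given by forms of the same degree without common zero. *)
Definition morphism X Y (phi : X -> Y) : Prop :=
  forall x, exists d (F : idx Y -> forms X),
    [/\ forall j, F j \is d.-homog,
        exists j, ev (F j) x != 0 &
        forall y, (exists j, ev (F j) y != 0) ->
          exists2 c : k, c != 0 & forall j, crd Y (phi y) j = c * ev (F j) y].

Definition isomorphism X Y (phi : X -> Y) : Prop :=
  morphism phi /\
  exists psi : Y -> X, [/\ morphism psi, cancel phi psi & cancel psi phi].

Lemma segre_neq0 X Y (p : X * Y) :
  exists ij : idx X * idx Y, crd X p.1 ij.1 * crd Y p.2 ij.2 != 0.
Proof.
have [i xi] := crd_neq0 p.1; have [j yj] := crd_neq0 p.2.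
by exists (i, j); rewrite mulf_neq0.
Qed.

(* Segre embedding. *)
Definition prodp X Y : pspace k :=
  @PSpace k (X * Y)%type (idx X * idx Y)%type
          (fun p ij => crd X p.1 ij.1 * crd Y p.2 ij.2) (@segre_neq0 X Y).

Lemma aff_neq0 n (v : 'rV[k]_n) :
  exists o : option 'I_n, oapp (v 0) 1 o != 0.
Proof. by exists None; rewrite oner_neq0. Qed.

Definition aff (n : nat) : pspace k :=
  @PSpace k 'rV[k]_n (option 'I_n) (fun v => oapp (v 0) 1) (@aff_neq0 n).

Definition zeros n c (f : 'I_c -> {mpoly k[n]}) : pspace k :=
  sub (fun v : aff n => forall i, (f i).@[(v : 'rV[k]_n) 0] = 0).

Definition jacobian n c (f : 'I_c -> {mpoly k[n]}) (v : 'rV[k]_n) : 'M_(c, n) :=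
  \matrix_(i, j) ((f i)^`M(j)).@[v 0].

(* Smoothness over k: X is locally isomorphic to an open subset of a zero locus
   of c equations whose Jacobian matrix has rank c there (Mumford, Red Book,
   III.5).  At such points k[x]/(f) is regular, hence reduced, so nothing is
   lost by considering only the set of zeros of f. *)
Definition smooth X : Prop :=
  forall x : X, exists n c (f : 'I_c -> {mpoly k[n]})
    (U : X -> Prop) (W : zeros f -> Prop),
    [/\ zopen U, U x, zopen W,
        forall w, W w -> \rank (jacobian f (sval w)) = c &
        exists phi : sub U -> sub W, isomorphism phi].

(* Rank r vector subbundles of the trivial bundle with fiber V on X: families
   of subspaces with a regular frame locally on X. *)
Definition subbundle X (V : vectType k) (r : nat) (E : X -> {vspace V}) : Prop :=
  forall x, exists U : X -> Prop, [/\ zopen U, U x &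
    exists s : 'I_r -> X -> V,
      (forall i j, regular_on U (fun y => coord (vbasis {:V}) j (s i y))) /\
      (forall y, U y -> basis_of (E y) [seq s i y | i : 'I_r])].

Section Grassmannian.
Variables (d : nat) (V : vectType k).

Definition subspaces := {U : {vspace V} | \dim U == d}.

(* Pluecker coordinates with respect to the basis [vbasis fullv] of V, indexed
   by all maps f : 'I_d -> 'I_(\dim {:V}), not only the increasing ones: the
   additional coordinates are 0 or differ by a sign from the others. *)
Definition pluecker (U : subspaces) (f : {ffun 'I_d -> 'I_(\dim {:V})}) : k :=
  \det (\matrix_(a < d, b < d) coord (vbasis {:V}) (f b) (vbasis (val U))`_a).

Lemma pluecker_neq0 (U : subspaces) : exists f, pluecker U f != 0.
Proof.
rewrite /pluecker; case: U => W /= /eqP dimW; rewrite -{}dimW.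
set A : 'M_(\dim W, \dim {:V}) :=
  \matrix_(a, j) coord (vbasis {:V}) j (vbasis W)`_a.
have freeA : row_free A.
  apply/row_freeP; apply/row_freeP/inj_row_free => u uA0.
  have freeW := basis_free (vbasisP W).
  have sum0 : \sum_a u 0 a *: (vbasis W)`_a = 0.
    rewrite (coord_vbasis (memvf (\sum_a u 0 a *: (vbasis W)`_a))).
    apply: big1 => j _; rewrite -[X in X *: _](_ : 0 = _) ?scale0r //.
    rewrite linear_sum /=; have /matrixP/(_ 0 j) := uA0; rewrite !mxE => {1}<-.
    by apply: eq_bigr => a _; rewrite linearZ /= mxE.
  by apply/rowP => a; rewrite mxE; apply: (freeP freeW) sum0 a.
have fullAT : row_full A^T by rewrite /row_full mxrank_tr.
have := fullrowsub_unit fullAT; rewrite unitmxE unitfE -det_tr => detf.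
exists (fullrankfun fullAT); congr (\det _ != 0): detf.
by apply/matrixP => a b; rewrite !mxE.
Qed.

Definition Gr : pspace k :=
  @PSpace k subspaces {ffun 'I_d -> 'I_(\dim {:V})} pluecker pluecker_neq0.

End Grassmannian.

Lemma meval_homogZ n (f : {mpoly k[n]}) d (c : k) (v : 'I_n -> k) :
  f \is d.-homog -> f.@[fun i => c * v i] = c ^+ d * f.@[v].
Proof.
move=> /dhomogP homf; rewrite !mevalE mulr_sumr big_seq [RHS]big_seq.
apply: eq_bigr => m /homf <-; rewrite mulrCA; congr (_ * _).
under eq_bigr do rewrite exprMn.
by rewrite big_split /= prodrXr -mdegE.
Qed.

Lemma homog_rename n m (f : {mpoly k[n]}) d (g : 'I_n -> 'I_m) :
  f \is d.-homog -> f \mPo [tuple 'X_(g i) | i < n] \is d.-homog.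
Proof.
move=> /dhomogP homf; rewrite comp_mpolyEX big_seq rpred_sum // => e /homf /= <-.
apply: rpredZ; rewrite comp_mpolyX mdegE.
apply: (big_ind2 (fun (p : {mpoly k[m]}) r => p \is r.-homog)).
- exact: dhomog1.
- by move=> p1 r1 p2 r2; apply: dhomogM.
- move=> i _; rewrite tnth_mktuple -[X in X.-homog]mul1n.
  by apply: dhomogMn; rewrite dhomogX /= mdeg1.
Qed.

Lemma zclosure_fst X Y (A : X -> Prop) (B : X * Y -> Prop) (p : prodp X Y) :
  (forall q, B q -> A q.1) -> @zclosure (prodp X Y) B p -> zclosure A p.1.
Proof.
move=> BA clp C [S [homS CS]] AC.
pose ren (j : idx Y) (f : forms X) : forms (prodp X Y) :=
  f \mPo [tuple 'X_(enum_rank (enum_val i, j)) | i < #|idx X|].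
have evren j f d (q : prodp X Y) : f \is d.-homog ->
    ev (ren j f) q = crd Y q.2 j ^+ d * ev f q.1.
  move=> homf; rewrite /ev comp_mpoly_meval -(meval_homogZ _ _ homf).
  by apply: meval_eq => i; rewrite tnth_mktuple mevalXU enum_rankK mulrC.
apply: (clp (fun q : prodp X Y => C q.1)); last by move=> q /BA/AC.
exists (fun F => exists j f, S f /\ F = ren j f); split.
  by move=> _ [j [f [/homS [d homf] ->]]]; exists d; apply: homog_rename.
move=> q; rewrite CS; split=> [C0 _ [j [f [Sf ->]]]|C0 f Sf].
  by have [d /(evren j) ->] := homS f Sf; rewrite C0 // mulr0.
have [d homf] := homS f Sf; have [j qj] := crd_neq0 q.2.
have := C0 _ (ex_intro _ j (ex_intro _ f (conj Sf erefl))).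
by rewrite (evren _ _ _ _ homf) => /eqP; rewrite mulf_eq0 expf_eq0 (negPf qj) andbF => /eqP.
Qed.

End Geometry.

Declare Scope pspace_scope.
Delimit Scope pspace_scope with PS.
Bind Scope pspace_scope with pspace.
Notation "X ** Y" := (prodp X Y) (at level 40, left associativity) : pspace_scope.

Section Triangles.
Variable k : closedFieldType.

Notation P2 := (Gr 1 'cV[k]_3).
Notation P2dual := (Gr 2 'cV[k]_3).

Definition flags : pspace k :=
  ((P2 ** P2 ** P2) ** (P2dual ** P2dual ** P2dual))%PS.

(* The points (x, l_12(x), l_13(x), l_23(x)) with x a non-collinear triple. *)
Definition general_triangle (t : flags) : Prop :=
  let: ((x1, x2, x3), (l12, l13, l23)) := t in
  [/\ (val x1 + val x2 + val x3 = fullv)%VS,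
      (val l12 = val x1 + val x2)%VS,
      (val l13 = val x1 + val x3)%VS &
      (val l23 = val x2 + val x3)%VS].

Definition T : pspace k := sub (zclosure general_triangle).

Definition sl3 : vectType k :=
  subvs_of (lker (linfun (mxtrace : 'M[k]_3 -> k^o))).

(* The projection [vsproj] acts as the identity here: commutators have trace 0. *)
Definition lie (A B : sl3) : sl3 :=
  vsproj _ (vsval A *m vsval B - vsval B *m vsval A).

(* [g, h], the span of all brackets. *)
Definition lieS (g h : {vspace sl3}) : {vspace sl3} :=
  <<[seq lie A B | A <- vbasis g, B <- vbasis h]>>%VS.

Definition lie_subalgebra (h : {vspace sl3}) : Prop :=
  forall A B, A \in h -> B \in h -> lie A B \in h.

(* The lower central series reaches 0. *)
Definition nilpotent_subalgebra (h : {vspace sl3}) : Prop :=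
  lie_subalgebra h /\ exists n, iter n (lieS h) h = 0%VS.

Definition abelian_subalgebra (h : {vspace sl3}) : Prop :=
  lie_subalgebra h /\ forall A B, A \in h -> B \in h -> lie A B = 0.

Definition cartan_subalgebra (h : {vspace sl3}) : Prop :=
  nilpotent_subalgebra h /\
  forall A, (forall B, B \in h -> lie A B \in h) -> A \in h.

Definition reductions : pspace k :=
  sub (zclosure (fun h : Gr 2 sl3 => cartan_subalgebra (val h))).

(* h is the space h_x of traceless operators diagonal in a basis representing
   the triple x of vertices of t. *)
Definition diagonal_algebra (t : flags) (h : {vspace sl3}) : Prop :=
  let: ((x1, x2, x3), _) := t in
  exists e1 e2 e3 : 'cV[k]_3,
    [/\ val x1 = <[e1]>%VS, val x2 = <[e2]>%VS, val x3 = <[e3]>%VS &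
        forall A : sl3, A \in h <->
          exists a1 a2 a3 : k, [/\ vsval A *m e1 = a1 *: e1,
            vsval A *m e2 = a2 *: e2 & vsval A *m e3 = a3 *: e3]].

Definition That : pspace k :=
  sub (zclosure (fun p : (T ** reductions)%PS =>
    general_triangle (sval p.1) /\ diagonal_algebra (sval p.1) (val (sval p.2)))).

Definition tau (p : That) : T := (sval p).1.

(* The fiber at p of the tautological bundle of [reductions]. *)
Definition tautological (p : That) : {vspace sl3} := val (sval (sval p).2).

(* Quadratic forms on k^3. *)
Definition quad : vectType k := dhomog 3 k 2.

(* N is the space N_x of quadratic forms vanishing on the lines x_1, x_2, x_3,
   for the triple x of vertices of t. *)
Definition vanishing_quadrics (t : flags) (N : {vspace quad}) : Prop :=
  let: ((x1, x2, x3), _) := t in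
  forall q : quad, q \in N <->
    forall v : 'cV[k]_3, [|| v \in val x1, v \in val x2 | v \in val x3] ->
      (mpoly_of_dhomog q).@[v^~ 0] = 0.

Definition TSch_general (p : (flags ** Gr 3 quad)%PS) : Prop :=
  general_triangle p.1 /\ vanishing_quadrics p.1 (val p.2).

Definition TSch : pspace k := sub (zclosure TSch_general).

Lemma TSch_general_fst q : TSch_general q -> general_triangle q.1.
Proof. by case. Qed.

Definition tauSch (p : TSch) : T :=
  exist _ (sval p).1 (zclosure_fst TSch_general_fst (svalP p)).

End Triangles.

(* Main.v *)
(** In suitable affine coordinates the vertices of a triangle are (a_i, b_i) and its sides
    have slopes m_i, and the variety of triangles is given by the single equation
    (m1 - m3) (a3 - a2) = (m2 - m3) (a3 - a1), a family of three-dimensional nodes.  Both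
    varieties over it are the small resolution that records the ratio (p : q) of the vectors
    (m1 - m3, m2 - m3) and (a3 - a1, a3 - a2): on the charts q = 1 and p = 1 they are affine
    spaces of dimension 6.  For the Cartan algebras and the nets of conics this is seen by
    writing explicit bases, polynomial in these coordinates, of the general fibers.  Linear
    conditions that hold for general triangles pass to the closure and leave, over the
    degenerate triangles, only the pencil (p : q); for the algebras commutativity is needed
    too.  Conversely every point of the charts is the limit of general points along a curve.
    The net of an algebra h is spanned by the quadratic forms det(u, w, A w) in w, with A in h
    and u in k^3, which vanish at the common eigenvectors of h; this defines the isomorphism
    independently of coordinates.  The ratio (p : q) is a ratio of two Pluecker coordinates of
    the algebra, and of the net, and hence a regular function on each chart. *)

(* The obstacle is that the eigenvector and vanishing conditions at the vertices lose their content
   when vertices or sides coincide. At nondegenerate triangles they are therefore first divided by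
   the factors u, v, v m2 and v - u that may tend to 0, and only the divided conditions are carried
   to the limit, as vanishing of functions regular at the limit point. Coordinates are taken in a
   frame that moves with the triangle: the first vertex is the origin and the first side an axis.
   The equation of the variety of triangles becomes m1 (v - u) = m2 v: the matrix with rows (m1, m2)
   and (v, v - u) has rank at most one, and (p : q) is the ratio of its rows. The frame is unipotent
   with respect to fixed coordinates, and the Pluecker coordinates that read off p and q do not see
   it. Regularity is treated as a property of germs, and a map is described by the relation that its
   value satisfies in a chart; this replaces composition of morphisms. Characteristic 0 is used to
   invert 2 and 3. *)
Require Import Defs.
From HB Require Import structures.
From mathcomp Require Import all_boot all_algebra.
From mathcomp Require Import perm mpoly ring.
From Stdlib Require Import ProofIrrelevance IndefiniteDescription.

Set Implicit Arguments.
Unset Strict Implicit.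
Unset Printing Implicit Defensive.

Import GRing.Theory.
Local Open Scope ring_scope.

(** * Regular functions and Zariski closures *)

Section Regular.
Variable k : closedFieldType.
Implicit Types X Y : pspace k.

(** Basic open sets suffice as neighbourhoods, and intersecting two of them is multiplying their
    forms. *)
Definition near X (x : X) (P : X -> Prop) : Prop :=
  exists d (h : forms X),
    [/\ h \is d.-homog, ev h x != 0 & forall y, ev h y != 0 -> P y].

(** A germ at x: the values of [s] where [h] vanishes are unconstrained. A quotient is thus regular
    wherever its denominator is nonzero, whatever [/] returns elsewhere. *)
Definition reg X (x : X) (s : X -> k) : Prop :=
  exists d (g h : forms X), [/\ g \is d.-homog, h \is d.-homog, ev h x != 0 &
    forall y, ev h y != 0 -> s y = ev g y / ev h y].

Lemma evM X (f g : forms X) x : ev (f * g) x = ev f x * ev g x.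
Proof. by rewrite /ev mevalM. Qed.

Lemma evD X (f g : forms X) x : ev (f + g) x = ev f x + ev g x.
Proof. by rewrite /ev mevalD. Qed.

Lemma nearW X (x : X) (P : X -> Prop) : (forall y, P y) -> near x P.
Proof.
by move=> PT; exists 0%N, 1; split=> // [|]; [exact: dhomog1|rewrite /ev meval1 oner_neq0].
Qed.

Lemma near_self X (x : X) (P : X -> Prop) : near x P -> P x.
Proof. by case=> d [h [_ hx]]; apply. Qed.

Lemma near_and X (x : X) (P Q : X -> Prop) :
  near x P -> near x Q -> near x (fun y => P y /\ Q y).
Proof.
move=> [d [h [hh hx hP]]] [e [g [hg gx gQ]]].
exists (d + e)%N, (h * g); split; first exact: dhomogM.
  by rewrite evM mulf_neq0.
by move=> y; rewrite evM mulf_eq0 negb_or => /andP[/hP Py /gQ Qy].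
Qed.

Lemma near_imp X (x : X) (P Q : X -> Prop) :
  (forall y, P y -> Q y) -> near x P -> near x Q.
Proof.
by move=> PQ [d [h [hh hx hP]]]; exists d, h; split=> // y /hP /PQ.
Qed.

Lemma reg_near X (x : X) (s s' : X -> k) :
  near x (fun y => s y = s' y) -> reg x s' -> reg x s.
Proof.
move=> [d [h [hh hx hE]]] [e [g [f [hg hf fx fE]]]].
exists (d + e)%N, (h * g), (h * f); split; try exact: dhomogM.
  by rewrite evM mulf_neq0.
move=> y; rewrite !evM mulf_eq0 negb_or => /andP[hy fy].
by rewrite hE // fE // -mulf_div divff // mul1r.
Qed.

Lemma eq_reg X (x : X) (s s' : X -> k) : s =1 s' -> reg x s' -> reg x s.
Proof. by move=> ss'; apply: reg_near; apply: nearW. Qed.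

Lemma reg_const X (x : X) c : reg x (fun _ => c).
Proof.
exists 0%N, c%:MP, 1; split; last by move=> y _; rewrite /ev mevalC meval1 divr1.
- by rewrite -[c%:MP]mulr1 mul_mpolyC dhomogZ ?dhomog1.
- exact: dhomog1.
- by rewrite /ev meval1 oner_neq0.
Qed.

Lemma regD X (x : X) (s t : X -> k) :
  reg x s -> reg x t -> reg x (fun y => s y + t y).
Proof.
move=> [d [g [h [hg hh hx hE]]]] [e [g' [h' [hg' hh' hx' hE']]]].
exists (d + e)%N, (g * h' + h * g'), (h * h'); split.
- by rewrite rpredD // dhomogM.
- exact: dhomogM.
- by rewrite evM mulf_neq0.
move=> y; rewrite evD !evM mulf_eq0 negb_or => /andP[hy hy'].
by rewrite hE // hE' // addf_div // [ev h y * _]mulrC.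
Qed.

Lemma regM X (x : X) (s t : X -> k) :
  reg x s -> reg x t -> reg x (fun y => s y * t y).
Proof.
move=> [d [g [h [hg hh hx hE]]]] [e [g' [h' [hg' hh' hx' hE']]]].
exists (d + e)%N, (g * g'), (h * h'); split; try exact: dhomogM.
  by rewrite evM mulf_neq0.
move=> y; rewrite !evM mulf_eq0 negb_or => /andP[hy hy'].
by rewrite hE // hE' // mulf_div.
Qed.

Lemma regN X (x : X) (s : X -> k) : reg x s -> reg x (fun y => - s y).
Proof.
move=> /(regM (reg_const x (-1))); apply: eq_reg => y; by rewrite mulN1r.
Qed.

Lemma regB X (x : X) (s t : X -> k) :
  reg x s -> reg x t -> reg x (fun y => s y - t y).
Proof. by move=> rs /regN; apply: regD. Qed.

Lemma near_neq0 X (x : X) (s : X -> k) :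
  reg x s -> s x != 0 -> near x (fun y => s y != 0).
Proof.
move=> [d [g [h [hg hh hx hE]]]]; rewrite hE // mulf_eq0 invr_eq0 negb_or.
move=> /andP[gx _]; exists (d + d)%N, (g * h); split; first exact: dhomogM.
  by rewrite evM mulf_neq0.
move=> y; rewrite evM mulf_eq0 negb_or => /andP[gy hy].
by rewrite hE // mulf_neq0 // invr_eq0.
Qed.

Lemma reg_sum X (x : X) (I : Type) (r : seq I) (P : pred I) (s : I -> X -> k) :
  (forall i, P i -> reg x (s i)) -> reg x (fun y => \sum_(i <- r | P i) s i y).
Proof.
move=> rs; elim: r => [|i r IHr].
  by apply: eq_reg (reg_const x 0) => y; rewrite big_nil.
case Pi: (P i); last by apply: eq_reg IHr => y; rewrite big_cons Pi.
by apply: eq_reg (regD (rs i Pi) IHr) => y; rewrite big_cons Pi.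
Qed.

Lemma reg_prod X (x : X) (I : Type) (r : seq I) (P : pred I) (s : I -> X -> k) :
  (forall i, P i -> reg x (s i)) -> reg x (fun y => \prod_(i <- r | P i) s i y).
Proof.
move=> rs; elim: r => [|i r IHr].
  by apply: eq_reg (reg_const x 1) => y; rewrite big_nil.
case Pi: (P i); last by apply: eq_reg IHr => y; rewrite big_cons Pi.
by apply: eq_reg (regM (rs i Pi) IHr) => y; rewrite big_cons Pi.
Qed.

Lemma reg_det X (x : X) n (M : X -> 'M[k]_n) :
  (forall i j, reg x (fun y => M y i j)) -> reg x (fun y => \det (M y)).
Proof.
move=> rM; apply: reg_sum => s _; apply: regM; first exact: reg_const.
exact: reg_prod.
Qed.

Lemma reg_mulmx X (x : X) m n p (M : X -> 'M[k]_(m, n)) (N : X -> 'M[k]_(n, p)) :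
  (forall i j, reg x (fun y => M y i j)) -> (forall i j, reg x (fun y => N y i j)) ->
  forall i j, reg x (fun y => (M y *m N y) i j).
Proof.
move=> rM rN i j.
apply: eq_reg (reg_sum (s := fun l y => M y i l * N y l j) _ _) => [y|l _].
  by rewrite mxE.
exact: regM.
Qed.

(** The coordinates of a morphism must be forms of one degree, hence a common denominator, built as
    a product along the enumeration of [I]. *)
Lemma reg_common X (x : X) (I : finType) (s : I -> X -> k) :
  (forall i, reg x (s i)) -> exists d (g : I -> forms X) (h : forms X),
    [/\ forall i, g i \is d.-homog, h \is d.-homog, ev h x != 0 &
      forall i y, ev h y != 0 -> s i y = ev (g i) y / ev h y].
Proof.
move=> rs.
suff [d [g [h [hg hh hx hE]]]] : exists d (g : I -> forms X) (h : forms X),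
    [/\ forall i, g i \is d.-homog, h \is d.-homog, ev h x != 0 &
      forall i, i \in enum I -> forall y, ev h y != 0 -> s i y = ev (g i) y / ev h y].
  by exists d, g, h; split=> // i; apply: hE; rewrite mem_enum.
elim: (enum I) => [|i r [d [g [h [hg hh hx hE]]]]].
  exists 0%N, (fun=> 1), 1; split=> // *; rewrite ?dhomog1 //.
  by rewrite /ev meval1 oner_neq0.
have [e [f [l [hf hl lx lE]]]] := rs i.
exists (e + d)%N, (fun j => if j == i then f * h else l * g j), (l * h); split.
- by move=> j; case: eqP => _; apply: dhomogM.
- exact: dhomogM.
- by rewrite evM mulf_neq0.
move=> j; rewrite inE; case: eqP => [-> _ y|_ /= jr y];
  rewrite !evM mulf_eq0 negb_or => /andP[ly hy].
  by rewrite lE // -mulf_div divff // mulr1.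
by rewrite (hE j) // -mulf_div divff // mul1r.
Qed.

Definition lin X (s : X -> k) : Prop :=
  exists c : idx X -> k, forall y, s y = \sum_i c i * crd X y i.

Lemma lin_form X (s : X -> k) : lin s ->
  exists f : forms X, f \is 1.-homog /\ forall y, s y = ev f y.
Proof.
move=> [c sE]; exists (\sum_i c i *: 'X_(enum_rank i)); split.
  by apply: rpred_sum => j _; apply: dhomogZ; rewrite dhomogX /= mdeg1.
move=> y; rewrite sE /ev raddf_sum /=; apply: eq_bigr => i _.
by rewrite mevalZ mevalXU enum_rankK.
Qed.

Lemma lin_crd X i : lin (fun x : X => crd X x i).
Proof.
exists (fun j => (j == i)%:R) => y; rewrite (bigD1 i) //= eqxx mul1r.
by rewrite big1 ?addr0 // => j /negPf->; rewrite mul0r.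
Qed.

Lemma lin_sub X (A : X -> Prop) (s : X -> k) :
  lin s -> lin (fun x : sub A => s (sval x)).
Proof. by move=> [c sE]; exists c => y; apply: sE. Qed.

Lemma lin_prodp X Y (s : X -> k) (t : Y -> k) :
  lin s -> lin t -> lin (fun p : prodp X Y => s p.1 * t p.2).
Proof.
move=> [c sE] [e tE]; exists (fun ij => c ij.1 * e ij.2) => -[x y] /=.
rewrite sE tE mulr_suml; under [LHS]eq_bigr do rewrite mulr_sumr.
by rewrite pair_bigA /=; apply: eq_bigr => -[i j] _ /=; ring.
Qed.

(* Unlike those of general forms, ratios of linear forms extend to products
   without any substitution in polynomials. *)
Definition lrat X (x : X) (s : X -> k) : Prop :=
  exists n d : X -> k, [/\ lin n, lin d, d x != 0 &
    forall y, d y != 0 -> s y = n y / d y].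

Lemma lrat_reg X (x : X) (s : X -> k) : lrat x s -> reg x s.
Proof.
move=> [n [d [/lin_form[f [hf fE]] /lin_form[h [hh hE]] dx sE]]].
exists 1%N, f, h; split=> //; first by rewrite -hE.
by move=> y; rewrite -hE -fE => /sE.
Qed.

Lemma lrat_lin X (x : X) (s t : X -> k) :
  lin s -> lin t -> t x != 0 -> lrat x (fun y => s y / t y).
Proof. by move=> ls lt tx; exists s, t. Qed.

Lemma lrat_sub X (A : X -> Prop) (x : sub A) (s : X -> k) :
  lrat (sval x) s -> lrat x (fun x : sub A => s (sval x)).
Proof.
move=> [n [d [ln ld dx sE]]]; exists (n \o sval), (d \o sval).
by split=> //; [exact: lin_sub|exact: lin_sub|move=> y /sE].
Qed.

Lemma reg_if X (x : X) (b : bool) (s t : X -> k) :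
  (b -> reg x s) -> (~~ b -> reg x t) -> reg x (fun y => if b then s y else t y).
Proof. by case: b => rs rt; [apply: rs|apply: rt]. Qed.

Lemma reg_sub X (A : X -> Prop) (x : sub A) (s : X -> k) :
  reg (sval x) s -> reg x (fun x : sub A => s (sval x)).
Proof.
by move=> [d [g [h [hg hh hx hE]]]]; exists d, g, h; split=> // y; apply: hE.
Qed.

Lemma lrat_fst X Y (p : prodp X Y) (s : X -> k) :
  lrat p.1 s -> lrat p (fun q : prodp X Y => s q.1).
Proof.
move=> [n [d [ln ld dx sE]]]; have [j yj] := crd_neq0 p.2.
exists (fun q => n q.1 * crd Y q.2 j), (fun q => d q.1 * crd Y q.2 j).
split; try by apply: (lin_prodp _ (lin_crd j)).
  by rewrite mulf_neq0.
move=> q; rewrite mulf_eq0 negb_or => /andP[dq qj].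
by rewrite sE // -mulf_div divff // mulr1.
Qed.

Lemma lrat_snd X Y (p : prodp X Y) (s : Y -> k) :
  lrat p.2 s -> lrat p (fun q : prodp X Y => s q.2).
Proof.
move=> [n [d [ln ld dx sE]]]; have [j yj] := crd_neq0 p.1.
exists (fun q => crd X q.1 j * n q.2), (fun q => crd X q.1 j * d q.2).
split; try by apply: (lin_prodp (lin_crd j)).
  by rewrite mulf_neq0.
move=> q; rewrite mulf_eq0 negb_or => /andP[dq qj].
by rewrite sE // -mulf_div divff // mul1r.
Qed.

Lemma zopen_lin X (s : X -> k) : lin s -> zopen (fun x => s x != 0).
Proof.
move=> /lin_form[f [hf sE]]; exists (fun g => g = f); split.
  by move=> _ ->; exists 1%N.
move=> x; split=> [/negP/negPn/eqP s0 _ ->|/(_ f erefl)]; first by rewrite -sE.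
by rewrite -sE => ->; rewrite eqxx.
Qed.

Lemma zclosure_self X (A : X -> Prop) x : A x -> zclosure A x.
Proof. by move=> Ax C _; apply. Qed.

(** With s = g / h near x and f cutting out the neighbourhood of the hypothesis, the form g h f
    vanishes on all of [B]: where h and f are nonzero, s = 0 forces g = 0. So it vanishes at x,
    where h and f do not. *)
Lemma zclosure_lim X (B : X -> Prop) (x : X) (s : X -> k) :
  zclosure B x -> reg x s -> near x (fun y => B y -> s y = 0) -> s x = 0.
Proof.
move=> clx [d [g [h [hg hh hx sE]]]] [e [f [hf fx fP]]].
pose F := g * (h * f).
have: ev F x = 0.
  apply: (clx (fun y => ev F y = 0)) => [|y By].
    exists (fun g => g = F); split=> [_ ->|y].
      by exists (d + (d + e))%N; rewrite !dhomogM.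
    by split=> [F0 _ ->//|]; apply.
  rewrite !evM; have [->|fy] := eqVneq (ev f y) 0; first by rewrite !mulr0.
  have [->|hy] := eqVneq (ev h y) 0; first by rewrite mul0r mulr0.
  have := fP y fy By; rewrite sE // => /eqP.
  by rewrite mulf_eq0 invr_eq0 (negPf hy) orbF => /eqP->; rewrite mul0r.
rewrite !evM => /eqP; rewrite !mulf_eq0 (negPf hx) (negPf fx) !orbF => /eqP gx.
by rewrite sE // gx mul0r.
Qed.

(* A relation between X and Y whose second component is determined, up to the
   scaling of coordinates, by regular functions of the first one near x. *)
Definition regrel X Y (x : X) (R : X -> Y -> Prop) : Prop :=
  exists G : idx Y -> X -> k, (forall j, reg x (G j)) /\ near x (fun y => forall z, R y z ->
      exists2 c : k, c != 0 & forall j, crd Y z j = c * G j y).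

Lemma regrel_prodp X Y1 Y2 (x : X) (R1 : X -> Y1 -> Prop) (R2 : X -> Y2 -> Prop) :
  regrel x R1 -> regrel x R2 ->
  regrel x (fun y (z : prodp Y1 Y2) => R1 y z.1 /\ R2 y z.2).
Proof.
move=> [G1 [rG1 n1]] [G2 [rG2 n2]].
exists (fun ij y => G1 ij.1 y * G2 ij.2 y); split.
  by move=> ij; apply: regM.
apply: near_imp (near_and n1 n2) => y [G1y G2y] z [/G1y[c c0 cE] /G2y[e e0 eE]].
by exists (c * e) => [|ij] /=; rewrite ?mulf_neq0 // cE eE; ring.
Qed.

Lemma regrel_sub X Y (A : Y -> Prop) (x : X) (R : X -> Y -> Prop) :
  regrel x R -> regrel x (fun y (z : sub A) => R y (sval z)).
Proof.
move=> [G [rG nG]]; exists G; split=> //.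
by apply: near_imp nG => y Gy z /Gy.
Qed.

Lemma regrel_aff X n (x : X) (s : X -> 'rV[k]_n) :
  (forall i, reg x (fun y => s y 0 i)) ->
  regrel x (fun y (z : aff k n) => z = s y :> 'rV_n).
Proof.
move=> rs; exists (fun o y => oapp (s y 0) 1 o); split.
  by case=> [i|] /=; [exact: rs|exact: reg_const].
by apply: nearW => y _ ->; exists 1 => [|j]; rewrite ?oner_neq0 ?mul1r.
Qed.

Lemma regrel_imp X Y (x : X) (R R' : X -> Y -> Prop) :
  near x (fun y => forall z, R' y z -> R y z) -> regrel x R -> regrel x R'.
Proof.
move=> RR' [G [rG nG]]; exists G; split=> //.
by apply: near_imp (near_and RR' nG) => y [RRy Gy] z /RRy/Gy.
Qed.

Lemma regrel_morphism X Y (phi : X -> Y) :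
  (forall x, exists2 R, regrel x R & near x (fun y => R y (phi y))) ->
  morphism phi.
Proof.
move=> rphi x; have [R [G [rG nG]] nR] := rphi x.
have [d [h [hh hx hP]]] := near_and nG nR.
have [e [g [f [hg hf fx gE]]]] := reg_common rG.
(* The formula for the image has to hold at every point where some form is nonzero. The factors h
   and f make all forms vanish outside the neighbourhood where the relation and the quotients are
   known. *)
exists (d + (e + e))%N, (fun j => h * (f * g j)); split=> [j||y [j]].
- by rewrite !dhomogM.
- have [Gx Rx] := hP x hx; have [c c0 cE] := Gx _ Rx.
  have [j yj] := crd_neq0 (phi x); exists j; rewrite !evM !mulf_neq0 //.
  by apply: contraNneq yj => g0; rewrite cE gE // g0 mul0r mulr0.
rewrite !evM !mulf_eq0 !negb_or => /and3P[hy fy _].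
have [Gy /Gy[c c0 cE]] := hP y hy.
exists (c / (ev h y * ev f y ^+ 2)) => [|i].
  by rewrite mulf_neq0 // invr_eq0 mulf_neq0 // expf_neq0.
by rewrite cE gE // !evM; field; rewrite hy fy.
Qed.

(** The last hypothesis is a density principle at x. It is applied to one equation f of [C] at a
    time, evaluated at the regular coordinates [G]; rescaling these by c multiplies the value by a
    power of c. *)
Lemma zclosed_comp X Y (C : Y -> Prop) (x : X) (R : X -> Y -> Prop) (z : Y) :
  zclosed C -> regrel x R -> R x z ->
  (forall s : X -> k, reg x s ->
     near x (fun y => (exists2 z', R y z' & C z') -> s y = 0) -> s x = 0) ->
  C z.
Proof.
move=> [S [homS CS]] [G [rG nG]] Rxz lim; apply/CS => f Sf.
have [d homf] := homS f Sf.
pose s y := f.@[fun i => G (enum_val i) y].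
have evs y z' c : (forall j, crd Y z' j = c * G j y) -> ev f z' = c ^+ d * s y.
  by move=> cE; rewrite -(meval_homogZ _ _ homf); apply: meval_eq.
have [c c0 /evs->] := near_self nG _ Rxz.
suff ->: s x = 0 by rewrite mulr0.
apply: lim.
  apply: eq_reg (reg_sum (s := fun m y => f@_m * \prod_i G (enum_val i) y ^+ m i) _ _).
    by move=> y; rewrite /s mevalE.
  move=> m _; apply: regM; first exact: reg_const.
  apply: reg_prod => i _; elim: (m i) => [|n IHn].
    by apply: eq_reg (reg_const x 1).
  by apply: eq_reg (regM (rG (enum_val i)) IHn) => y; rewrite exprS.
apply: near_imp nG => y Gy [z' /Gy[e e0 /evs fz'] /CS/(_ f Sf)].
rewrite fz' => /eqP; rewrite mulf_eq0 expf_eq0 (negPf e0) andbF => /eqP//.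
Qed.

Lemma reg_affX n (v : aff k n) i : reg v (fun w : aff k n => (w : 'rV_n) 0 i).
Proof.
apply: lrat_reg; exists (fun w => crd (aff k n) w (Some i)), (fun w => crd (aff k n) w None).
split; try exact: lin_crd; first by rewrite /= oner_neq0.
by move=> y _ /=; rewrite divr1.
Qed.

Definition pt1 (a : k) : aff k 1 := (\row_i a : 'rV_1).

Lemma ev_aff1 (f : forms (aff k 1)) : exists P : {poly k}, forall a, ev f (pt1 a) = P.[a].
Proof.
(* The coordinate [None] of the affine line is constantly 1, the others are the parameter. *)
exists (\sum_(m <- msupp f) f@_m *: \prod_i (if enum_val i is Some _ then 'X else 1) ^+ m i).
move=> a; rewrite /ev mevalE horner_sum; apply: eq_bigr => m _.
rewrite hornerZ horner_prod; congr (_ * _); apply: eq_bigr => i _.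
rewrite horner_exp; congr (_ ^+ _) => /=.
by case: (enum_val i) => [j|] /=; rewrite ?mxE ?hornerX ?hornerC.
Qed.

(* A nonzero polynomial in one variable has a nonroot, so that a form vanishing
   at the general points of the curve vanishes at z as well. *)
Lemma zclosed_curve Y (C : Y -> Prop) (R : aff k 1 -> Y -> Prop) (z : Y) (D : {poly k}) :
  zclosed C -> regrel (pt1 0) R -> R (pt1 0) z -> D != 0 ->
  (forall a, D.[a] != 0 -> exists2 z', R (pt1 a) z' & C z') -> C z.
Proof.
move=> clC rR R0 D0 DC; apply: (zclosed_comp clC rR R0) => s.
move=> [d [g [h [_ _ hx sE]]]] [e [f [_ fx fP]]].
have [[[G gE] [H hE]] [F fE]] := (ev_aff1 g, ev_aff1 h, ev_aff1 f).
have H0 : H != 0 by apply: contraNneq hx => H0; rewrite hE H0 horner0.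
have F0 : F != 0 by apply: contraNneq fx => F0; rewrite fE F0 horner0.
have: G * (H * (F * D)) = 0.
  apply/eqP; apply: contraT => /closed_nonrootP[a].
  rewrite /root !hornerM !mulf_eq0 !negb_or => /and4P[Ga Ha Fa Da].
  have := fP (pt1 a); rewrite fE => /(_ Fa (DC a Da)).
  by move/eqP; rewrite sE ?hE // gE mulf_eq0 invr_eq0 (negPf Ha) (negPf Ga).
move/eqP; rewrite !mulf_eq0 (negPf H0) (negPf F0) (negPf D0) !orbF => /eqP G0.
by rewrite sE // gE G0 horner0 mul0r.
Qed.

End Regular.

(** * Grassmannians *)

Section Vectors.
Variable k : closedFieldType.

Lemma scalarf0 (V : lmodType k) (f : V -> k) : scalar f -> f 0 = 0.
Proof. by move=> lf; have := lf (-1) 0 0; rewrite scaler0 addr0 mulN1r addNr. Qed.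

Lemma scalarfD (V : lmodType k) (f : V -> k) : scalar f -> {morph f : u v / u + v}.
Proof. by move=> lf u v; rewrite -[u]scale1r lf mul1r scale1r. Qed.

Lemma scalarfZ (V : lmodType k) (f : V -> k) : scalar f -> forall a u, f (a *: u) = a * f u.
Proof. by move=> lf a u; rewrite -[a *: u]addr0 lf scalarf0 // addr0. Qed.

Lemma scalarf_sum (V : lmodType k) (f : V -> k) : scalar f ->
  forall (I : Type) (r : seq I) (P : pred I) (c : I -> k) (v : I -> V),
  f (\sum_(i <- r | P i) c i *: v i) = \sum_(i <- r | P i) c i * f (v i).
Proof.
move=> lf I r P c v; elim/big_rec2: _ => [|i x u _ <-]; first exact: scalarf0.
by rewrite lf.
Qed.

Lemma scalar_linear (V W : lmodType k) (L : {linear V -> W}) (f : W -> k) :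
  scalar f -> scalar (f \o L).
Proof. by move=> lf a u v /=; rewrite linearP lf. Qed.

Lemma scalar_coord (V : vectType k) n (X : n.-tuple V) i : scalar (coord X i).
Proof. by move=> a u v; rewrite linearP. Qed.

Variable X : pspace k.

(** Testing by all linear functionals, without a basis, makes the stability under linear maps
    immediate. *)
Definition regv (V : lmodType k) (x : X) (s : X -> V) : Prop :=
  forall f : V -> k, scalar f -> reg x (fun y => f (s y)).

Lemma regv_linear (V W : lmodType k) (L : {linear V -> W}) (x : X) (s : X -> V) :
  regv x s -> regv x (fun y => L (s y)).
Proof. by move=> rs f /(scalar_linear L)/rs. Qed.

Lemma regv_const (V : lmodType k) (x : X) (v : V) : regv x (fun=> v).
Proof. by move=> f _; apply: reg_const. Qed.

Lemma regv_sum (V : lmodType k) (x : X) (I : finType) (c : I -> X -> k) (v : I -> X -> V) :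
  (forall i, reg x (c i)) -> (forall i, regv x (v i)) ->
  regv x (fun y => \sum_i c i y *: v i y).
Proof.
move=> rc rv f lf; apply: eq_reg (reg_sum (s := fun i y => c i y * f (v i y)) _ _).
  by move=> y; rewrite scalarf_sum.
by move=> i _; apply: regM => //; apply: rv.
Qed.

Lemma regvB (V : lmodType k) (x : X) (s t : X -> V) :
  regv x s -> regv x t -> regv x (fun y => s y - t y).
Proof.
move=> rs rt f lf; apply: eq_reg (regB (rs f lf) (rt f lf)) => y.
by rewrite scalarfD // -scaleN1r scalarfZ // mulN1r.
Qed.

Lemma regv_mx (x : X) m n (M : X -> 'M[k]_(m, n)) :
  (forall i j, reg x (fun y => M y i j)) -> regv x M.
Proof.
move=> rM f lf.
apply: eq_reg (regv_sum (c := fun ij y => M y ij.1 ij.2)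
  (v := fun ij _ => delta_mx ij.1 ij.2 : 'M[k]_(m, n)) _ _ lf).
- by move=> y; rewrite {1}[M y]matrix_sum_delta pair_bigA.
- by move=> ij.
- by move=> ij; apply: regv_const.
Qed.

Lemma mx_reg (x : X) m n (M : X -> 'M[k]_(m, n)) i j :
  regv x M -> reg x (fun y => M y i j).
Proof. by move=> /(_ (fun A => A i j)); apply => a A B; rewrite !mxE. Qed.

End Vectors.

Section Grassmannian.
Variables (k : closedFieldType) (d : nat) (V : vectType k).
Notation Gr := (Gr d V).

(** A Pluecker coordinate for arbitrary functionals in place of those of [vbasis]; this allows
    coordinates adapted to a triangle. *)
Definition minor (f : 'I_d -> V -> k) (U : Gr) : k :=
  \det (\matrix_(a < d, b < d) f b (vbasis (val U))`_a).

Lemma Gr_dim (U : Gr) : \dim (val U) = d.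
Proof. exact/eqP/(svalP U). Qed.

Lemma basis_size (U : Gr) S : basis_of (val U) S -> size S = d.
Proof. by case/andP=> /eqP sS /eqP <-; rewrite sS Gr_dim. Qed.

Lemma minor_basis (U : Gr) S : basis_of (val U) S ->
  exists2 c : k, c != 0 & forall f, (forall b, scalar (f b)) ->
    minor f U = c * \det (\matrix_(a < d, b < d) f b S`_a).
Proof.
move=> bS; have sS := basis_size bS; move: (bS).
have /eqP sS' := sS; pose T := Tuple sS'; rewrite -[S]/(tval T) => bT.
pose B := \matrix_(a < d, e < d) coord T e (vbasis (val U))`_a.
have mE f : (forall b, scalar (f b)) ->
    minor f U = \det B * \det (\matrix_(a < d, b < d) f b S`_a).
  move=> lf; rewrite -det_mulmx; congr (\det _); apply/matrixP => a b.
  rewrite !mxE {1}(coord_basis bT (v := (vbasis (val U))`_a)); last first.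
    by apply: vbasis_mem; rewrite mem_nth // size_tuple Gr_dim.
  by rewrite scalarf_sum //; apply: eq_bigr => e _; rewrite !mxE.
(* If the change of basis were singular, all Pluecker coordinates of [U] would vanish. *)
exists (\det B) => //; have [f fU] := pluecker_neq0 U.
apply: contraNneq fU => B0; apply/eqP.
have := mE (fun b => coord (vbasis {:V}) (f b)); rewrite B0 mul0r; apply.
by move=> b; apply: scalar_coord.
Qed.

(** Each column is expanded in the coordinate functionals and the determinant is multilinear in its
    columns. The expansion runs over all maps g, which is exactly the index set of [pluecker]. *)
Lemma minor_lin (f : 'I_d -> V -> k) : (forall b, scalar (f b)) -> lin (minor f).
Proof.
move=> lf; exists (fun g : {ffun 'I_d -> 'I_(\dim {:V})} => \prod_b f b (vbasis {:V})`_(g b)) => U.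
have fE b v : f b v = \sum_j coord (vbasis {:V}) j v * f b (vbasis {:V})`_j.
  by rewrite {1}(coord_vbasis (memvf v)) scalarf_sum.
rewrite /minor -det_tr /determinant.
pose C a j := coord (vbasis {:V}) j (vbasis (val U))`_a.
transitivity (\sum_(s : 'S_d) \sum_(g : {ffun 'I_d -> 'I_(\dim {:V})})
    (-1) ^+ s * \prod_b (C (s b) (g b) * f b (vbasis {:V})`_(g b))).
  apply: eq_bigr => s _; rewrite -mulr_sumr; congr (_ * _).
  rewrite -(bigA_distr_bigA (fun b j => C (s b) j * f b (vbasis {:V})`_j)).
  by apply: eq_bigr => b _; rewrite !mxE fE.
rewrite exchange_big; apply: eq_bigr => g _ /=.
rewrite /pluecker -det_tr /determinant mulr_sumr; apply: eq_bigr => s _.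
rewrite big_split /= mulrA mulrC; congr (_ * (_ * _)).
by apply: eq_bigr => b _; rewrite !mxE.
Qed.

Lemma minor_coord (g : {ffun 'I_d -> 'I_(\dim {:V})}) (U : Gr) :
  crd Gr U g = minor (fun b => coord (vbasis {:V}) (g b)) U.
Proof. by []. Qed.

Lemma regrel_Gr (X : pspace k) (x : X) (S : X -> seq V) :
  (forall i : 'I_d, regv x (fun y => (S y)`_i)) ->
  regrel x (fun y (U : Gr) => basis_of (val U) (S y)).
Proof.
move=> rS; exists (fun (g : {ffun 'I_d -> 'I_(\dim {:V})}) y => \det (\matrix_(a < d,
  b < d) coord (vbasis {:V}) (g b) (S y)`_a)).
split=> [g|].
  apply: reg_det => a b; apply: eq_reg (rS a _ (scalar_coord (vbasis {:V}) (g b))) => y.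
  by rewrite mxE.
apply: nearW => y U /minor_basis[c c0 cE]; exists c => // g.
by rewrite minor_coord cE // => b; apply: scalar_coord.
Qed.

Lemma free_minor (f : 'I_d -> V -> k) S : (forall b, scalar (f b)) -> size S = d ->
  \det (\matrix_(a < d, b < d) f b S`_a) != 0 -> free S.
Proof.
move=> lf /eqP sS; rewrite -[S]/(tval (Tuple sS)); set T := Tuple sS => fS.
apply/freeP => c sc0.
pose u : 'rV_d := \row_i c i.
have uM : u *m \matrix_(a < d, b < d) f b T`_a = 0.
  apply/rowP => b; rewrite !mxE.
  transitivity (f b (\sum_a c a *: T`_a)); last by rewrite sc0 scalarf0.
  by rewrite scalarf_sum //; apply: eq_bigr => a _; rewrite !mxE.
have := fS; rewrite -unitfE -unitmxE => uS i.
have: u = 0 by rewrite -(mulmxK uS u) uM mul0mx.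
by move/rowP/(_ i); rewrite !mxE.
Qed.

Lemma Gr_exists S : free S -> size S = d -> exists U : Gr, basis_of (val U) S.
Proof.
move=> fS sS; have dS : \dim <<S>> == d by rewrite -sS.
by exists (exist (fun W : {vspace V} => \dim W == d) _ dS); rewrite /basis_of /= eqxx.
Qed.

Lemma Gr_inj (U U' : Gr) S : basis_of (val U) S -> basis_of (val U') S -> U = U'.
Proof.
by move=> /andP[/eqP sU _] /andP[/eqP sU' _]; apply: val_inj; rewrite /= -sU -sU'.
Qed.

Lemma basis_of_Gr (U : Gr) S : free S -> size S = d -> {subset S <= val U} -> basis_of (val U) S.
Proof.
move=> fS sS SU; rewrite basisEfree fS Gr_dim sS leqnn andbT /=.
exact/span_subvP.
Qed.

Definition upd (f : 'I_d -> V -> k) b (g : V -> k) : 'I_d -> V -> k :=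
  fun c => if c == b then g else f c.

(** By Cramer's rule, the value of [g] on the b-th vector of the basis of [U] dual to [f]. In this
    form it is visibly a ratio of linear forms on the Grassmannian. *)
Definition gcoord f g b (U : Gr) := minor (upd f b g) U / minor f U.

Lemma upd_scalar f b g : (forall b, scalar (f b)) -> scalar g -> forall c, scalar (upd f b g c).
Proof. by move=> lf lg c; rewrite /upd; case: ifP. Qed.

Lemma gcoord_lrat f g b U : (forall b, scalar (f b)) -> scalar g -> minor f U != 0 ->
  lrat U (gcoord f g b).
Proof.
by move=> lf lg fU; apply: lrat_lin => //; apply: minor_lin => //; apply: upd_scalar.
Qed.

(** The basis of [U] dual to [f], through the adjugate; meaningful when [minor f U] is nonzero. *)
Definition frame (f : 'I_d -> V -> k) (U : Gr) (b : 'I_d) : V :=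
  \sum_a ((\adj (\matrix_(a < d, b < d) f b (vbasis (val U))`_a) b a) / minor f U)
    *: (vbasis (val U))`_a.

Section Frame.
Variables (f : 'I_d -> V -> k) (U : Gr).
Hypotheses (lf : forall b, scalar (f b)) (fU : minor f U != 0).

Lemma frame_mem b : frame f U b \in val U.
Proof.
apply: memv_suml => a _; apply/memvZ/vbasis_mem.
by rewrite mem_nth // size_tuple Gr_dim.
Qed.

(* Cramer's rule. *)
Lemma frame_gcoord g b : scalar g -> g (frame f U b) = gcoord f g b U.
Proof.
move=> lg; rewrite /frame scalarf_sum // /gcoord [in RHS]/minor (expand_det_col _ b) mulr_suml.
apply: eq_bigr => a _; rewrite !mxE /upd eqxx mulrAC; congr (_ / _).
rewrite mulrC; congr (_ * _); rewrite /cofactor; congr (_ * \det _).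
by apply/matrixP => i j; rewrite !mxE eq_sym (negPf (neq_lift _ _)).
Qed.

Lemma frame_dual b c : f c (frame f U b) = (c == b)%:R.
Proof.
rewrite /frame scalarf_sum //; set F := \matrix_(_, _) _.
have := mul_adj_mx F => /matrixP/(_ b c); rewrite !mxE => adjE.
transitivity ((minor f U)^-1 * \sum_j \adj F b j * F j c).
  rewrite mulr_sumr; apply: eq_bigr => a _; rewrite [F a c]mxE; ring.
by rewrite adjE eq_sym mulrnAr mulVf.
Qed.

Lemma frame_basis : basis_of (val U) [seq frame f U b | b : 'I_d].
Proof.
set S := [seq _ | _ : _].
have SE (a : 'I_d) : S`_a = frame f U a.
  by rewrite (nth_map a) ?size_enum_ord // nth_ord_enum.
apply: basis_of_Gr; last by move=> _ /mapP[b _ ->]; apply: frame_mem.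
  apply: (@free_minor f) => //; first by rewrite size_map size_enum_ord.
  rewrite [X in \det X](_ : _ = 1%:M) ?det1 ?oner_neq0 //.
  by apply/matrixP => a b; rewrite !mxE SE frame_dual eq_sym.
by rewrite size_map size_enum_ord.
Qed.

Lemma frame_decomp v : v \in val U -> v = \sum_b f b v *: frame f U b.
Proof.
move=> vU; pose T := [tuple frame f U b | b < d].
have bT : basis_of (val U) T by apply: frame_basis.
have TE (b : 'I_d) : T`_b = frame f U b by rewrite -tnth_nth tnth_mktuple.
rewrite {1}(coord_basis bT vU); apply: eq_bigr => b _; rewrite TE; congr (_ *: _).
rewrite {2}(coord_basis bT vU) scalarf_sum // (bigD1 b) //= TE frame_dual eqxx mulr1.
by rewrite big1 ?addr0 // => c /negPf cb; rewrite TE frame_dual eq_sym cb mulr0.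
Qed.

Lemma Gr_mem v g : scalar g -> v \in val U -> g v = \sum_b f b v * gcoord f g b U.
Proof.
move=> lg vU; rewrite {1}(frame_decomp vU) scalarf_sum //.
by apply: eq_bigr => b _; rewrite frame_gcoord.
Qed.

End Frame.

Lemma minor_neq0 (U : Gr) : exists f, (forall b, scalar (f b)) /\ minor f U != 0.
Proof.
have [g gU] := pluecker_neq0 U; exists (fun b => coord (vbasis {:V}) (g b)).
by split=> // b; apply: scalar_coord.
Qed.

(** Ratios of linear forms are the functions through which a subspace is seen here: [gcoord] and the
    ratios of minors are of this kind. *)
Definition pull (X : pspace k) (x : X) (pi : X -> Gr) :=
  forall s, lrat (pi x) s -> reg x (fun y => s (pi y)).

Section Pull.
Variables (X : pspace k) (x : X) (pi : X -> Gr).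
Hypothesis pull_pi : pull x pi.

Lemma near_minor f : (forall b, scalar (f b)) -> minor f (pi x) != 0 ->
  near x (fun y => minor f (pi y) != 0).
Proof.
move=> lf fx; have [i xi] := crd_neq0 (pi x).
(* A minor is a form and not a function, so it is divided by a coordinate that is nonzero at
   [pi x]. *)
have lm := minor_lin lf; have := pull_pi (lrat_lin lm (lin_crd i) xi).
move=> /near_neq0; rewrite mulf_neq0 ?invr_eq0 // => /(_ isT).
by apply: near_imp => y; rewrite mulf_eq0 negb_or => /andP[].
Qed.

Lemma reg_gcoord f g b : (forall b, scalar (f b)) -> scalar g -> minor f (pi x) != 0 ->
  reg x (fun y => gcoord f g b (pi y)).
Proof. by move=> lf lg fx; have := pull_pi (gcoord_lrat b lf lg fx). Qed.

Lemma reg_minor_ratio f g : (forall b, scalar (f b)) -> (forall b, scalar (g b)) ->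
  minor g (pi x) != 0 -> reg x (fun y => minor f (pi y) / minor g (pi y)).
Proof. by move=> lf lg fx; have := pull_pi (lrat_lin (minor_lin lf) (minor_lin lg) fx). Qed.

Lemma regv_frame f b : (forall b, scalar (f b)) -> minor f (pi x) != 0 ->
  regv x (fun y => frame f (pi y) b).
Proof.
move=> lf fx g lg; apply: reg_near (reg_gcoord b lf lg fx).
by apply: near_imp (near_minor lf fx) => y fy; rewrite frame_gcoord.
Qed.

(** The coefficients of [v] in the dual frame are kept constant while the frame moves with y. So
    every vector of the limit space extends to a local section of the tautological bundle. *)
Lemma Gr_section v : v \in val (pi x) ->
  exists s : X -> V, [/\ s x = v, regv x s & near x (fun y => s y \in val (pi y))].
Proof.
move=> vx; have [f [lf fx]] := minor_neq0 (pi x).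
exists (fun y => \sum_b f b v *: frame f (pi y) b); split.
- by rewrite -frame_decomp.
- apply: regv_sum => b; [exact: reg_const|exact: regv_frame].
- apply: nearW => y; apply: memv_suml => b _; apply/memvZ/frame_mem.
Qed.

(** The difference between [s] and its expansion in the moving frame is regular and vanishes at the
    points of [B] near x, hence at x. *)
Lemma Gr_lim (B : X -> Prop) (s : X -> V) : zclosure B x -> regv x s ->
  near x (fun y => B y -> s y \in val (pi y)) -> s x \in val (pi x).
Proof.
move=> clx rs ns; have [f [lf fx]] := minor_neq0 (pi x).
suff ->: s x = \sum_b f b (s x) *: frame f (pi x) b.
  by apply: memv_suml => b _; apply/memvZ/frame_mem.
apply/eqP; rewrite -subr_eq0; apply/eqP.
set t := (X in X = 0); rewrite -[t](_ : \sum_i coord (vbasis {:V}) i t *: (vbasis {:V})`_i = t).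
  apply: big1 => i _; pose e y := s y - \sum_b f b (s y) *: frame f (pi y) b.
  rewrite (_ : coord _ _ _ = 0) ?scale0r //.
  apply: (zclosure_lim (s := fun y => coord (vbasis {:V}) i (e y)) clx).
    apply: (regvB rs); last exact: scalar_coord.
    by apply: regv_sum => b; [apply: rs|apply: regv_frame].
  apply: near_imp (near_and ns (near_minor lf fx)) => y [sy fy] /sy sU.
  by rewrite /e -frame_decomp // subrr linear0.
by rewrite -coord_vbasis // memvf.
Qed.

End Pull.

End Grassmannian.

(** * Coordinates on k^3, quadratic forms and traceless matrices *)

Section Coordinates.
Variable k : closedFieldType.

Definition o0 : 'I_3 := @Ordinal 3 0 isT.
Definition o1 : 'I_3 := @Ordinal 3 1 isT.
Definition o2 : 'I_3 := @Ordinal 3 2 isT.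

Lemma ord3P (i : 'I_3) : [\/ i = o0, i = o1 | i = o2].
Proof.
case: i => -[|[|[|//]]] lti.
- by constructor 1; apply: val_inj.
- by constructor 2; apply: val_inj.
- by constructor 3; apply: val_inj.
Qed.

Lemma sum3 (V : nmodType) (F : 'I_3 -> V) : \sum_i F i = F o0 + F o1 + F o2.
Proof.
rewrite !big_ord_recl big_ord0 addr0 addrA.
by congr (F _ + F _ + F _); apply: val_inj.
Qed.

Definition cv (a b c : k) : 'cV[k]_3 := \col_i [:: a; b; c]`_i.

Definition mx3 (a b c d e f g h l : k) : 'M[k]_3 :=
  \matrix_(i, j) (nth [::] [:: [:: a; b; c]; [:: d; e; f]; [:: g; h; l]] i)`_j.

Lemma cvE (v : 'cV[k]_3) : v = cv (v o0 0) (v o1 0) (v o2 0).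
Proof. by apply/colP => i; rewrite mxE; case: (ord3P i) => ->. Qed.

Lemma mx3E (M : 'M[k]_3) : M = mx3 (M o0 o0) (M o0 o1) (M o0 o2)
  (M o1 o0) (M o1 o1) (M o1 o2) (M o2 o0) (M o2 o1) (M o2 o2).
Proof. by apply/matrixP => i j; rewrite mxE; case: (ord3P i) => ->; case: (ord3P j) => ->. Qed.

Lemma cv_inj a b c a' b' c' : cv a b c = cv a' b' c' -> [/\ a = a', b = b' & c = c'].
Proof.
by move/colP=> E; split; [have := E o0|have := E o1|have := E o2]; rewrite !mxE.
Qed.

Lemma scale_cv x a b c : x *: cv a b c = cv (x * a) (x * b) (x * c).
Proof. by apply/colP => i; rewrite !mxE; case: (ord3P i) => ->. Qed.

Lemma add_cv a b c a' b' c' : cv a b c + cv a' b' c' = cv (a + a') (b + b') (c + c').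
Proof. by apply/colP => i; rewrite !mxE; case: (ord3P i) => ->. Qed.

Lemma mul_mx3_cv a b c d e f g h l x y z : mx3 a b c d e f g h l *m cv x y z =
  cv (a * x + b * y + c * z) (d * x + e * y + f * z) (g * x + h * y + l * z).
Proof.
by apply/colP => i; rewrite !mxE sum3 !mxE; case: (ord3P i) => ->.
Qed.

Lemma mul_mx3 a b c d e f g h l a' b' c' d' e' f' g' h' l' :
  mx3 a b c d e f g h l *m mx3 a' b' c' d' e' f' g' h' l' =
  mx3 (a * a' + b * d' + c * g') (a * b' + b * e' + c * h') (a * c' + b * f' + c * l')
      (d * a' + e * d' + f * g') (d * b' + e * e' + f * h') (d * c' + e * f' + f * l')
      (g * a' + h * d' + l * g') (g * b' + h * e' + l * h') (g * c' + h * f' + l * l').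
Proof.
apply/matrixP => i j; rewrite !mxE sum3 !mxE.
by case: (ord3P i) => ->; case: (ord3P j) => ->.
Qed.

Lemma scale_mx3 x a b c d e f g h l : x *: mx3 a b c d e f g h l =
  mx3 (x * a) (x * b) (x * c) (x * d) (x * e) (x * f) (x * g) (x * h) (x * l).
Proof.
by apply/matrixP => i j; rewrite !mxE; case: (ord3P i) => ->; case: (ord3P j) => ->.
Qed.

Lemma add_mx3 a b c d e f g h l a' b' c' d' e' f' g' h' l' :
  mx3 a b c d e f g h l + mx3 a' b' c' d' e' f' g' h' l' =
  mx3 (a + a') (b + b') (c + c') (d + d') (e + e') (f + f') (g + g') (h + h') (l + l').
Proof.
by apply/matrixP => i j; rewrite !mxE; case: (ord3P i) => ->; case: (ord3P j) => ->.
Qed.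

Lemma scalar_mx3 x : x%:M = mx3 x 0 0 0 x 0 0 0 x.
Proof.
by apply/matrixP => i j; rewrite !mxE; case: (ord3P i) => ->; case: (ord3P j) => ->.
Qed.

Lemma det2 (M : 'M[k]_2) :
  \det M = M ord0 ord0 * M ord_max ord_max - M ord0 ord_max * M ord_max ord0.
Proof.
rewrite (expand_det_row _ ord0) big_ord_recl big_ord1 /cofactor !det_mx11 !mxE.
have e1 : lift ord0 ord0 = ord_max :> 'I_2 by apply: val_inj.
have e2 : lift (ord_max : 'I_2) ord0 = ord0 by apply: val_inj.
by rewrite !e1 !e2 /= expr0 expr1; ring.
Qed.

Lemma delta_cv (i : 'I_3) :
  delta_mx i 0 = cv (i == o0)%:R (i == o1)%:R (i == o2)%:R :> 'cV[k]_3.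
Proof. by apply/colP => j; rewrite !mxE andbT eq_sym; case: (ord3P j) => ->. Qed.

Lemma reg_mx3 (X : pspace k) (x : X) (a b c d e f g h l : X -> k) :
  reg x a -> reg x b -> reg x c -> reg x d -> reg x e -> reg x f -> reg x g ->
  reg x h -> reg x l -> forall i j,
  reg x (fun y => mx3 (a y) (b y) (c y) (d y) (e y) (f y) (g y) (h y) (l y) i j).
Proof.
move=> ra rb rc rd re rf rg rh rl i j.
by case: (ord3P i) => ->; case: (ord3P j) => ->;
  [ apply: (eq_reg _ ra) | apply: (eq_reg _ rb) | apply: (eq_reg _ rc)
  | apply: (eq_reg _ rd) | apply: (eq_reg _ re) | apply: (eq_reg _ rf)
  | apply: (eq_reg _ rg) | apply: (eq_reg _ rh) | apply: (eq_reg _ rl)] => y; rewrite mxE.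
Qed.

End Coordinates.

(** * Quadratic forms in three variables and their coefficients *)

Section Quadrics.
Variable k : closedFieldType.
Notation quad := (quad k).

Definition evq (Q : quad) (v : 'cV[k]_3) : k := (mpoly_of_dhomog Q).@[v^~ 0].

Lemma evq_scalar v : scalar (evq^~ v).
Proof. by move=> a P Q; rewrite /evq /= !mevalD mevalZ. Qed.

Lemma mq_homog (M : 'M[k]_3) :
  \sum_i \sum_j M i j *: ('X_i * 'X_j) \is 2.-homog.
Proof.
apply: rpred_sum => i _; apply: rpred_sum => j _; apply: dhomogZ.
by rewrite -mpolyXD dhomogX /= mdegD !mdeg1.
Qed.

Definition mq (M : 'M[k]_3) : quad := DHomog (mq_homog M).

Lemma mq_linear : linear mq.
Proof.
move=> a M N; apply: val_inj; rewrite /= scaler_sumr -big_split /=.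
apply: eq_bigr => i _; rewrite scaler_sumr -big_split /=; apply: eq_bigr => j _.
by rewrite !mxE scalerDl scalerA.
Qed.

HB.instance Definition _ := GRing.isLinear.Build k 'M[k]_3 quad _ mq mq_linear.

Lemma evq_mq M v : evq (mq M) v = \sum_i \sum_j M i j * (v i 0 * v j 0).
Proof.
rewrite /evq /= raddf_sum; apply: eq_bigr => i _.
rewrite raddf_sum; apply: eq_bigr => j _.
by rewrite /= mevalZ mevalM !mevalXU.
Qed.

Lemma evq_mqE M v : evq (mq M) v = (v^T *m M *m v) 0 0.
Proof.
rewrite evq_mq mxE exchange_big; apply: eq_bigr => j _ /=.
by rewrite !mxE mulr_suml; apply: eq_bigr => i _; rewrite !mxE; ring.
Qed.

Lemma evq_mulmx M (G : 'M[k]_3) v : evq (mq M) (G *m v) = evq (mq (G^T *m M *m G)) v.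
Proof. by rewrite !evq_mqE trmx_mul !mulmxA. Qed.

Lemma mq_surj (Q : quad) : exists M, Q = mq M.
Proof.
suff [M ME] : exists M, val Q = val (mq M) by exists M; apply: val_inj.
have /dhomogP hQ : val Q \is 2.-homog by apply: valP.
rewrite [val Q]mpolyE big_seq.
pose P (p : {mpoly k[3]}) := exists M, p = val (mq M).
apply: (big_ind P) => [|p q [M ->] [N ->]|m /hQ /= m2].
- by exists 0; rewrite linear0.
- by exists (M + N); rewrite linearD.
have [i mi] : exists i, m i != 0%N.
  case: (pickP (fun i => m i != 0%N)) => [i mi|m0]; first by exists i.
  suff m_eq0 : m = 0%MM by move: m2; rewrite m_eq0 mdeg0.
  by apply/mnmP => i; rewrite mnm0E; apply/eqP/negbFE/m0.
have := lep1mP i m; rewrite mi => /submK mE.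
have /eqP/mdeg1P[j /eqP jE] : mdeg (m - U_(i)) = 1%N.
  by move: m2; rewrite -{1}mE mdegD mdeg1 addn1 => -[].
exists ((val Q)@_m *: delta_mx j i); rewrite linearZ /= -mE jE mpolyXD; congr (_ *: _).
rewrite (bigD1 j) //= (bigD1 i) //= !mxE !eqxx scale1r.
rewrite big1 => [|l lj]; last by rewrite mxE (negPf lj) andbF scale0r.
rewrite big1 => [|l li]; first by rewrite !addr0.
by rewrite big1 // => n _; rewrite mxE (negPf li) scale0r.
Qed.

(** The values at e_i and e_i + e_j force the matrix of the difference to have zero diagonal and to
    be antisymmetric, and such a matrix gives the zero form. *)
Lemma quad_eq (P Q : quad) : (forall v, evq P v = evq Q v) -> P = Q.
Proof.
move=> PQ; apply/eqP; rewrite -subr_eq0; have [M ME] := mq_surj (P - Q).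
have M0 v : evq (mq M) v = 0.
  by rewrite -ME (scalarfD (evq_scalar v)) -scaleN1r (scalarfZ (evq_scalar v)) mulN1r PQ subrr.
have E (a b c : k) : M o0 o0 * (a * a) + M o1 o1 * (b * b) + M o2 o2 * (c * c)
   + (M o0 o1 + M o1 o0) * (a * b) + (M o0 o2 + M o2 o0) * (a * c)
   + (M o1 o2 + M o2 o1) * (b * c) = 0.
  have := M0 (cv a b c); rewrite evq_mq !sum3 !mxE /= => <-; ring.
have E00 := E 1 0 0; have E11 := E 0 1 0; have E22 := E 0 0 1.
have E01 := E 1 1 0; have E02 := E 1 0 1; have E12 := E 0 1 1.
have e00 : M o0 o0 = 0 by rewrite -E00; ring.
have e11 : M o1 o1 = 0 by rewrite -E11; ring.
have e22 : M o2 o2 = 0 by rewrite -E22; ring.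
have e01 : M o0 o1 = - M o1 o0.
  by apply/eqP; rewrite -subr_eq0 opprK -E01 e00 e11 e22; apply/eqP; ring.
have e02 : M o0 o2 = - M o2 o0.
  by apply/eqP; rewrite -subr_eq0 opprK -E02 e00 e11 e22; apply/eqP; ring.
have e12 : M o1 o2 = - M o2 o1.
  by apply/eqP; rewrite -subr_eq0 opprK -E12 e00 e11 e22; apply/eqP; ring.
apply/eqP; rewrite ME; apply: val_inj; rewrite /= !sum3 e00 e11 e22 e01 e02 e12 !scaleNr.
by rewrite -!mul_mpolyC !mpolyC0; ring.
Qed.

(* In the coordinates H, the form with the given coefficients of x^2, xy, xw,
   y^2, yw and w^2. *)
Definition qf (H : 'M[k]_3) (a b c d e f : k) : quad :=
  mq (H^T *m mx3 a b c 0 d e 0 0 f *m H).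

Lemma evq_qf H a b c d e f v x y w : H *m v = cv x y w ->
  evq (qf H a b c d e f) v = a * (x * x) + b * (x * y) + c * (x * w)
    + d * (y * y) + e * (y * w) + f * (w * w).
Proof.
move=> Hv; transitivity ((v^T *m (H^T *m mx3 a b c 0 d e 0 0 f *m H) *m v) 0 0).
  exact: evq_mqE.
rewrite !mulmxA -trmx_mul Hv -mulmxA Hv -mulmxA mul_mx3_cv mxE sum3 !mxE /=; ring.
Qed.

(** The mixed coefficients come from polarization, so no division by 2 occurs and the result is
    linear in the form. *)
Definition qcoef (G : 'M[k]_3) (Q : quad) (i j : 'I_3) : k :=
  let E l := G *m delta_mx l 0 : 'cV_3 in
  if i == j then evq Q (E i) else evq Q (E i + E j) - evq Q (E i) - evq Q (E j).

Lemma qcoef_scalar G i j : scalar (fun Q => qcoef G Q i j).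
Proof.
move=> a P Q; rewrite /qcoef; case: ifP => _; first exact: evq_scalar.
by rewrite !(evq_scalar _ a P Q); ring.
Qed.

Lemma evq_qcoef G Q x y w : evq Q (G *m cv x y w) =
  qcoef G Q o0 o0 * (x * x) + qcoef G Q o0 o1 * (x * y) + qcoef G Q o0 o2 * (x * w)
  + qcoef G Q o1 o1 * (y * y) + qcoef G Q o1 o2 * (y * w) + qcoef G Q o2 o2 * (w * w).
Proof.
have [M ->] := mq_surj Q.
rewrite /qcoef /= -!mulmxDr !evq_mulmx; set N := _ *m G.
by rewrite !evq_mq !sum3 !mxE /=; ring.
Qed.

Lemma qf_qcoef G H Q : G *m H = 1%:M -> Q = qf H (qcoef G Q o0 o0) (qcoef G Q o0 o1)
  (qcoef G Q o0 o2) (qcoef G Q o1 o1) (qcoef G Q o1 o2) (qcoef G Q o2 o2).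
Proof.
move=> GH; apply: quad_eq => v; have Hv := cvE (H *m v).
by rewrite (evq_qf _ _ _ _ _ _ Hv) -evq_qcoef -Hv mulmxA GH mul1mx.
Qed.

Lemma qf_linear H x a b c d e f a' b' c' d' e' f' :
  x *: qf H a b c d e f + qf H a' b' c' d' e' f' =
  qf H (x * a + a') (x * b + b') (x * c + c') (x * d + d') (x * e + e') (x * f + f').
Proof.
apply: quad_eq => v; have Hv := cvE (H *m v).
by rewrite (evq_scalar v) !(evq_qf _ _ _ _ _ _ Hv); ring.
Qed.

Lemma qcoef_qf G H a b c d e f : H *m G = 1%:M ->
  [/\ qcoef G (qf H a b c d e f) o0 o0 = a, qcoef G (qf H a b c d e f) o0 o1 = b,
      qcoef G (qf H a b c d e f) o0 o2 = c & [/\ qcoef G (qf H a b c d e f) o1 o1 = d,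
      qcoef G (qf H a b c d e f) o1 o2 = e & qcoef G (qf H a b c d e f) o2 o2 = f]].
Proof.
move=> HG; have E v x y w : v = cv x y w -> H *m (G *m v) = cv x y w.
  by move->; rewrite mulmxA HG mul1mx.
rewrite /qcoef /= -!mulmxDr !delta_cv /= !add_cv !(evq_qf _ _ _ _ _ _ (E _ _ _ _ erefl)).
by do ![split]; ring.
Qed.

Lemma qf0 H : qf H 0 0 0 0 0 0 = 0.
Proof.
apply: quad_eq => v; rewrite (evq_qf _ _ _ _ _ _ (cvE (H *m v))).
by rewrite (scalarf0 (evq_scalar v)); ring.
Qed.

Lemma qf_congr H a b c d e f a' b' c' d' e' f' :
  a = a' -> b = b' -> c = c' -> d = d' -> e = e' -> f = f' ->
  qf H a b c d e f = qf H a' b' c' d' e' f'.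
Proof. by move=> -> -> -> -> -> ->. Qed.

Lemma regv_qf (X : pspace k) (x : X) (H : X -> 'M[k]_3) (a b c d e f : X -> k) :
  (forall i j, reg x (fun y => H y i j)) ->
  reg x a -> reg x b -> reg x c -> reg x d -> reg x e -> reg x f ->
  regv x (fun y => qf (H y) (a y) (b y) (c y) (d y) (e y) (f y)).
Proof.
move=> rH ra rb rc rd re rf; apply: regv_linear; apply: regv_mx.
apply: reg_mulmx => //; apply: reg_mulmx => i j.
  by apply: eq_reg (rH j i) => y; rewrite mxE.
have r0 := reg_const x 0; exact: (reg_mx3 ra rb rc r0 rd re r0 r0 rf).
Qed.

End Quadrics.

(** * Traceless matrices as matrices modulo scalars *)

Section Sl3.
Variable k : closedFieldType.
Hypothesis char0 : [pchar k] =i pred0.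
Notation sl3 := (sl3 k).

Lemma nat_neq0 n : (n.+1)%:R != 0 :> k.
Proof. by move/pcharf0P: char0 => ->. Qed.

(** The projection along the scalar matrices. Bases of algebras can then be written with any
    convenient representative modulo scalars; off-diagonal entries are unaffected. *)
Definition slm (M : 'M[k]_3) : sl3 := vsproj _ (M - (\tr M / 3)%:M).

Lemma slm_linear : linear slm.
Proof.
move=> a M N; rewrite /slm -linearP; congr (vsproj _ _).
apply/matrixP => i j; rewrite linearP !mxE /=.
by case: (i == j); rewrite ?mulr1n ?mulr0n; ring.
Qed.
HB.instance Definition _ := GRing.isLinear.Build k 'M[k]_3 sl3 _ slm slm_linear.

Lemma sl3_trace (A : sl3) : \tr (vsval A) = 0.
Proof. by have := subvsP A; rewrite memv_ker lfunE => /eqP. Qed.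

Lemma val_slm M : vsval (slm M) = M - (\tr M / 3)%:M.
Proof.
rewrite /slm vsprojK // memv_ker lfunE /= raddfB /= mxtrace_scalar.
by rewrite -[(_ / _) *+ 3]mulr_natr divfK ?subrr // nat_neq0.
Qed.

Lemma slmK (A : sl3) : slm (vsval A) = A.
Proof. by apply: val_inj; rewrite /= [LHS]val_slm sl3_trace mul0r raddf0 subr0. Qed.

Lemma slm_scalar a : slm a%:M = 0.
Proof.
apply: val_inj; rewrite /= [LHS]val_slm mxtrace_scalar -[a *+ 3]mulr_natr mulfK ?subrr //.
exact: nat_neq0.
Qed.

Lemma regv_slm (X : pspace k) (x : X) (M : X -> 'M[k]_3) :
  (forall i j, reg x (fun y => M y i j)) -> regv x (fun y => slm (M y)).
Proof. by move=> rM; apply: regv_linear; apply: regv_mx. Qed.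

Definition slc (G H : 'M[k]_3) (i j : 'I_3) (A : sl3) : k := (H *m vsval A *m G) i j.

Lemma slc_scalar G H i j : scalar (slc G H i j).
Proof.
move=> a A B; rewrite /slc (_ : vsval (a *: A + B) = a *: vsval A + vsval B) // mulmxDr
  -scalemxAr mulmxDl -scalemxAl.
by rewrite !mxE.
Qed.

Lemma slc_slm G H i j M : i != j -> H *m G = 1%:M -> slc G H i j (slm M) = (H *m M *m G) i j.
Proof.
move=> ij HG; rewrite /slc val_slm mulmxBr mulmxBl.
by rewrite scalar_mxC -[_%:M *m H *m G]mulmxA HG mulmx1 !mxE (negPf ij) mulr0n subr0.
Qed.

End Sl3.

(** * Triangles *)

Section Flags.
Variable k : closedFieldType.
Notation V3 := 'cV[k]_3.
Notation P2 := (Gr 1 V3).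
Notation P2dual := (Gr 2 V3).

Definition rho (R : 'M[k]_3) (j : 'I_3) (v : V3) : k := (R *m v) j 0.

Lemma rho_scalar R j : scalar (rho R j).
Proof. by move=> a u v; rewrite /rho mulmxDr -scalemxAr !mxE. Qed.

Definition fpoint (R : 'M[k]_3) : 'I_1 -> V3 -> k := fun=> rho R o0.
Definition fline (R : 'M[k]_3) : 'I_2 -> V3 -> k :=
  fun b => rho R (if b == ord0 then o0 else o1).

Lemma fpoint_scalar R b : scalar (fpoint R b). Proof. exact: rho_scalar. Qed.
Lemma fline_scalar R b : scalar (fline R b). Proof. exact: rho_scalar. Qed.

(** In the coordinates [R] the point is (1, pa, pb), and the line is the graph with intercept [lc]
    and slope [lm]. *)
Definition pa R (x : P2) := gcoord (fpoint R) (rho R o1) ord0 x.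
Definition pb R (x : P2) := gcoord (fpoint R) (rho R o2) ord0 x.
Definition lc R (l : P2dual) := gcoord (fline R) (rho R o2) ord0 l.
Definition lm R (l : P2dual) := gcoord (fline R) (rho R o2) ord_max l.

Section Frame.
Variables (G H : 'M[k]_3).
Hypothesis HG : H *m G = 1%:M.

Lemma point_free a b : free [:: G *m cv 1 a b].
Proof.
rewrite seq1_free; apply/eqP => /(congr1 (mulmx H)).
rewrite mulmxA HG mul1mx mulmx0 => /colP/(_ o0).
by rewrite !mxE; apply/eqP; rewrite oner_neq0.
Qed.

Lemma line_free a b m : free [:: G *m cv 1 a b; G *m cv 0 1 m].
Proof.
apply: (@free_minor _ 2 _ (fline H)) => //; first exact: fline_scalar.
by rewrite det2 !mxE /= /fline /rho /= !mulmxA HG !mul1mx !mxE /= mulr0 subr0 mulr1 oner_neq0.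
Qed.

End Frame.

Section Coord.
Variable R : 'M[k]_3.
Hypothesis uR : R \in unitmx.

Lemma rhoK v : v = invmx R *m cv (rho R o0 v) (rho R o1 v) (rho R o2 v).
Proof. by rewrite -[cv _ _ _]cvE mulKmx. Qed.

Lemma rho_cv a b c : [/\ rho R o0 (invmx R *m cv a b c) = a,
  rho R o1 (invmx R *m cv a b c) = b & rho R o2 (invmx R *m cv a b c) = c].
Proof. by split; rewrite /rho mulKVmx // mxE. Qed.

Lemma point_basis (x : P2) : minor (fpoint R) x != 0 ->
  basis_of (val x) [:: invmx R *m cv 1 (pa R x) (pb R x)].
Proof.
move=> xR; apply: basis_of_Gr => //; first by apply: (point_free (H := R)); rewrite mulmxV.
move=> w; rewrite inE => /eqP->.
have := frame_mem (fpoint R) x ord0; rewrite [frame _ _ _]rhoK.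
rewrite (frame_gcoord (fpoint R) x ord0 (rho_scalar R o1)).
rewrite (frame_gcoord (fpoint R) x ord0 (rho_scalar R o2)).
by rewrite -[rho R o0 _]/(fpoint R ord0 _) frame_dual // => b; apply: fpoint_scalar.
Qed.

Lemma line_mem (l : P2dual) v : minor (fline R) l != 0 -> v \in val l ->
  rho R o2 v = rho R o0 v * lc R l + rho R o1 v * lm R l.
Proof.
move=> lR vl; rewrite (Gr_mem (fline_scalar R) lR (rho_scalar R o2) vl).
by rewrite big_ord_recl big_ord1 /lc /lm [lift _ _](_ : _ = ord_max) //; apply: val_inj.
Qed.

Lemma line_basis (l : P2dual) : minor (fline R) l != 0 ->
  basis_of (val l) [:: invmx R *m cv 1 0 (lc R l); invmx R *m cv 0 1 (lm R l)].
Proof.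
move=> lR; apply: basis_of_Gr => //; first by apply: (line_free (H := R)); rewrite mulmxV.
move=> w; rewrite !inE.
have fr b := frame_mem (fline R) l b.
have fE b : frame (fline R) l b = invmx R *m cv (b == ord0)%:R (b == ord_max)%:R
    (gcoord (fline R) (rho R o2) b l).
  rewrite [LHS]rhoK (frame_gcoord (fline R) l b (rho_scalar R o2)).
  rewrite -[rho R o0 _]/(fline R ord0 _) -[rho R o1 _]/(fline R ord_max _).
  by rewrite !(frame_dual (fline_scalar R) lR) ![b == _]eq_sym.
by case/orP=> /eqP->; [have := fr ord0|have := fr ord_max]; rewrite fE.
Qed.

Lemma line_in (l : P2dual) a b c : minor (fline R) l != 0 ->
  c = a * lc R l + b * lm R l -> invmx R *m cv a b c \in val l.
Proof.
move=> lR ->; have /andP[/eqP <- _] := line_basis lR.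
set v1 := _ *m cv 1 0 _; set v2 := _ *m cv 0 1 _.
have -> : invmx R *m cv a b (a * lc R l + b * lm R l) = a *: v1 + b *: v2.
  by rewrite !scalemxAr -mulmxDr !scale_cv add_cv; congr (_ *m cv _ _ _); ring.
by rewrite memvD // memvZ // memv_span // !inE eqxx ?orbT.
Qed.

End Coord.

Definition x1 (t : flags k) : P2 := t.1.1.1.
Definition x2 (t : flags k) : P2 := t.1.1.2.
Definition x3 (t : flags k) : P2 := t.1.2.
Definition l12 (t : flags k) : P2dual := t.2.1.1.
Definition l13 (t : flags k) : P2dual := t.2.1.2.
Definition l23 (t : flags k) : P2dual := t.2.2.

(** No vertex lies on the line at infinity and no side passes through the vertical point at
    infinity. *)
Definition good R (t : flags k) : Prop :=
  [/\ minor (fpoint R) (x1 t) != 0, minor (fpoint R) (x2 t) != 0,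
      minor (fpoint R) (x3 t) != 0 & 
      [/\ minor (fline R) (l12 t) != 0, minor (fline R) (l13 t) != 0 &
          minor (fline R) (l23 t) != 0]].

Definition incident R t : Prop :=
  [/\ pb R (x1 t) = lc R (l12 t) + pa R (x1 t) * lm R (l12 t),
      pb R (x2 t) = lc R (l12 t) + pa R (x2 t) * lm R (l12 t),
      pb R (x1 t) = lc R (l13 t) + pa R (x1 t) * lm R (l13 t) &
   [/\ pb R (x3 t) = lc R (l13 t) + pa R (x3 t) * lm R (l13 t),
      pb R (x2 t) = lc R (l23 t) + pa R (x2 t) * lm R (l23 t) &
      pb R (x3 t) = lc R (l23 t) + pa R (x3 t) * lm R (l23 t)]].

Lemma point_on_line R (x : P2) (l : P2dual) : R \in unitmx ->
  minor (fpoint R) x != 0 -> minor (fline R) l != 0 -> (val x <= val l)%VS ->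
  pb R x = lc R l + pa R x * lm R l.
Proof.
move=> uR xR lR xl; have /andP[/eqP spx _] := point_basis uR xR.
have /(line_mem lR) : invmx R *m cv 1 (pa R x) (pb R x) \in val l.
  by apply: (subvP xl); rewrite -spx memv_span // inE.
by have [-> -> ->] := rho_cv uR 1 (pa R x) (pb R x); rewrite mul1r.
Qed.

Lemma general_incident R t : R \in unitmx -> good R t -> general_triangle t -> incident R t.
Proof.
move: t => [[[y1 y2] y3] [[m1 m2] m3]] uR [/= g1 g2 g3 [h1 h2 h3]] [_ e1 e2 e3].
rewrite /incident /x1 /x2 /x3 /l12 /l13 /l23 /= in g1 g2 g3 h1 h2 h3 *.
have {}e1 : val m1 = (val y1 + val y2)%VS by [].
have {}e2 : val m2 = (val y1 + val y3)%VS by [].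
have {}e3 : val m3 = (val y2 + val y3)%VS by [].
by do ![split]; apply: point_on_line => //; rewrite ?e1 ?e2 ?e3 ?addvSl ?addvSr.
Qed.

(* The frame with origin at the first vertex (1, a, b) and with the first side,
   of slope m, as an axis. *)
Definition Gp R (a b m : k) : 'M[k]_3 := invmx R *m mx3 1 0 0 a 1 0 b m 1.
(** The inverse of [Gp]. It is polynomial in a, b, m because the frame is unipotent relative to
    [R]. *)
Definition Hp R (a b m : k) : 'M[k]_3 := mx3 1 0 0 (- a) 1 0 (m * a - b) (- m) 1 *m R.

Lemma HGp R a b m : R \in unitmx -> Hp R a b m *m Gp R a b m = 1%:M.
Proof.
move=> uR; rewrite /Hp /Gp mulmxA -[_ *m R *m _]mulmxA mulmxV // mulmx1 mul_mx3 scalar_mx3.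
by congr mx3; ring.
Qed.

Definition Gmat R t := Gp R (pa R (x1 t)) (pb R (x1 t)) (lm R (l12 t)).
Definition Hmat R t := Hp R (pa R (x1 t)) (pb R (x1 t)) (lm R (l12 t)).

Lemma HGmat R t : R \in unitmx -> Hmat R t *m Gmat R t = 1%:M.
Proof. exact: HGp. Qed.

(* The triangle whose vertices and sides are given, in the coordinates G, by
   x1 = (1,0,0), x2 = (1,u,0), x3 = (1,v,v m2) and by the slopes 0, m2, m1. *)
Definition flagrep (G : 'M[k]_3) u v m1 m2 (t : flags k) : Prop :=
  [/\ basis_of (val (x1 t)) [:: G *m cv 1 0 0],
      basis_of (val (x2 t)) [:: G *m cv 1 u 0],
      basis_of (val (x3 t)) [:: G *m cv 1 v (v * m2)] &
  [/\ basis_of (val (l12 t)) [:: G *m cv 1 0 0; G *m cv 0 1 0],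
      basis_of (val (l13 t)) [:: G *m cv 1 0 0; G *m cv 0 1 m2] &
      basis_of (val (l23 t)) [:: G *m cv 1 0 ((m2 - m1) * v); G *m cv 0 1 m1]]].

Definition tu R t := pa R (x2 t) - pa R (x1 t).
Definition tv R t := pa R (x3 t) - pa R (x1 t).
Definition tm1 R t := lm R (l23 t) - lm R (l12 t).
Definition tm2 R t := lm R (l13 t) - lm R (l12 t).

(** The last equation computes the ordinate of x3 in the frame twice: along the second side from x1,
    and along the third from x2. Both x1 and x2 have ordinate 0 there. *)
Lemma flag_form R t : R \in unitmx -> good R t -> incident R t ->
  flagrep (Gmat R t) (tu R t) (tv R t) (tm1 R t) (tm2 R t) t /\
  tm1 R t * (tv R t - tu R t) = tm2 R t * tv R t.
Proof.
move=> uR [g1 g2 g3 [h1 h2 h3]] [i1 i2 i3 [i4 i5 i6]]; rewrite /flagrep /Gmat /Gp /tu /tv /tm1 /tm2.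
rewrite -!(mulmxA (invmx R)) !mul_mx3_cv.
set a1 := pa R (x1 t) in i1 i3 *; set a2 := pa R (x2 t) in i2 i5 *.
set a3 := pa R (x3 t) in i4 i6 *; set b1 := pb R (x1 t) in i1 i3 *.
set m3 := lm R (l12 t) in i1 i2 *; set m2 := lm R (l13 t) in i3 i4 *.
set m1 := lm R (l23 t) in i5 i6 *.
have lf a b m := line_free (mulmxV uR) a b m.
have lb (l : P2dual) a b c m : minor (fline R) l != 0 -> 
    a = 1 -> c = 1 * lc R l + b * lm R l -> m = lm R l ->
    forall z o, z = 0 -> o = 1 ->
    basis_of (val l) [:: invmx R *m cv a b c; invmx R *m cv z o m].
  move=> lR -> -> -> z o -> ->; apply: basis_of_Gr => // w; rewrite !inE.
  by case/orP=> /eqP->; apply: line_in => //; ring.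
split; last first.
  have E1 : pb R (x3 t) - pb R (x2 t) = m1 * (a3 - a2) by rewrite i5 i6; ring.
  have E2 : pb R (x3 t) - b1 = m2 * (a3 - a1) by rewrite i3 i4; ring.
  have E3 : pb R (x2 t) - b1 = m3 * (a2 - a1) by rewrite i1 i2; ring.
  transitivity (m1 * (a3 - a2) - m3 * (a3 - a2)); first ring.
  transitivity (m2 * (a3 - a1) - m3 * (a3 - a1)); last ring.
  have E4 : m3 * (a3 - a2) = m3 * (a3 - a1) - (pb R (x2 t) - b1) by rewrite E3; ring.
  by rewrite -E1 -E2 E4; ring.
split.
- rewrite (_ : cv _ _ _ = cv 1 a1 b1); last by congr cv; ring.
  exact: point_basis.
- rewrite (_ : cv _ _ _ = cv 1 a2 (pb R (x2 t))); first exact: point_basis.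
  by congr cv; rewrite ?i1 ?i2; ring.
- rewrite (_ : cv _ _ _ = cv 1 a3 (pb R (x3 t))); first exact: point_basis.
  by congr cv; rewrite ?i4 ?i3; ring.
split.
- by apply: lb => //; rewrite -?/m3 ?i1; ring.
- by apply: lb => //; rewrite -?/m2 ?i3; ring.
- apply: lb => //; rewrite -?/m1; try ring.
  have -> : lc R (l23 t) = pb R (x3 t) - a3 * m1 by rewrite i6; ring.
  by rewrite i4 i3; ring.
Qed.

Lemma general_nondegenerate G H u v m1 m2 t : H *m G = 1%:M -> flagrep G u v m1 m2 t ->
  (val (x1 t) + val (x2 t) + val (x3 t) = fullv)%VS -> u != 0 /\ v * m2 != 0.
Proof.
move=> HG [/andP[/eqP s1 _] /andP[/eqP s2 _] /andP[/eqP s3 _] _] full.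
have kill (f : V3 -> k) : scalar f -> f (G *m cv 1 0 0) = 0 -> f (G *m cv 1 u 0) = 0 ->
    f (G *m cv 1 v (v * m2)) = 0 -> forall w, f w = 0.
  move=> lf f1 f2 f3 w; have: w \in (val (x1 t) + val (x2 t) + val (x3 t))%VS.
    by rewrite full memvf.
  rewrite -s1 -s2 -s3 !span_seq1.
  move=> /memv_addP[w12 /memv_addP[_ /vlineP[c1 ->] [_ /vlineP[c2 ->] ->]] [_ /vlineP[c3 ->] ->]].
  by rewrite !(scalarfD lf) !(scalarfZ lf) f1 f2 f3 !mulr0 !addr0.
have HGv a b c : H *m (G *m cv a b c) = cv a b c by rewrite mulmxA HG mul1mx.
have rE j a b c : rho H j (G *m cv a b c) = cv a b c j 0 by rewrite /rho HGv.
have [vm|vm] := eqVneq (v * m2) 0.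
  have := kill (rho H o2) (@rho_scalar H o2);
    rewrite !rE !mxE /= => /(_ erefl erefl vm (G *m cv 0 0 1)).
  by rewrite rE mxE /= => /eqP; rewrite oner_eq0.
split=> //; apply: contraTneq vm => u0; rewrite negbK.
(* This functional vanishes at x1 and x3 always, and at x2 when u = 0; its value at (0, 1, 0) is v
   m2. *)
pose f w := v * m2 * rho H o1 w - v * rho H o2 w.
have fE a b c : f (G *m cv a b c) = v * m2 * b - v * c by rewrite /f !rE !mxE.
have lf : scalar f by move=> a w w'; rewrite /f !(rho_scalar _ _ a w); ring.
have := kill f lf; rewrite !fE => /(_ _ _ _ (G *m cv 0 1 0)); rewrite fE => f0.
by apply/eqP; rewrite -[RHS]f0 ?u0; ring.
Qed.

Lemma poly_nonroot (s : seq {poly k}) : all (fun p => p != 0) s ->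
  exists a : k, all (fun p : {poly k} => p.[a] != 0) s.
Proof.
move=> s0; have: \prod_(p <- s) p != 0.
  by rewrite prodf_seq_neq0; apply: sub_all s0 => p ->.
by move=> /closed_nonrootP[a]; rewrite /root horner_prod prodf_seq_neq0 => ?; exists a.
Qed.

(** Any 2 by 2 minor of functionals on [w], [w'] is, by Cauchy-Binet, a combination of the
    components of their cross product, and some minor of a line is nonzero. *)
Lemma line_cross (l : P2dual) (w := (vbasis (val l))`_0) (w' := (vbasis (val l))`_1) :
  [|| w o1 0 * w' o2 0 - w o2 0 * w' o1 0 != 0,
      w o2 0 * w' o0 0 - w o0 0 * w' o2 0 != 0 |
      w o0 0 * w' o1 0 - w o1 0 * w' o0 0 != 0].
Proof.
have [f [lf]] := minor_neq0 l; rewrite /minor det2 !mxE /= -/w -/w'.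
apply: contraNT; rewrite !negb_or !negbK => /and3P[/eqP e1 /eqP e2 /eqP e3].
have fE b x : f b x = x o0 0 * f b (delta_mx o0 0) + x o1 0 * f b (delta_mx o1 0)
    + x o2 0 * f b (delta_mx o2 0).
  have {1}-> : x = \sum_i x i 0 *: delta_mx i 0.
    by rewrite {1}[x]matrix_sum_delta; apply: eq_bigr => i _; rewrite big_ord1.
  by rewrite (scalarf_sum (lf b)) sum3.
rewrite (fE ord0 w) (fE ord0 w') (fE ord_max w) (fE ord_max w'); set p0 := f ord0 _;
  set p1 := f ord0 _; set p2 := f ord0 _.
set q0 := f ord_max _; set q1 := f ord_max _; set q2 := f ord_max _.
apply/eqP; transitivity (
  (w o1 0 * w' o2 0 - w o2 0 * w' o1 0) * (p1 * q2 - p2 * q1)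
  + (w o2 0 * w' o0 0 - w o0 0 * w' o2 0) * (p2 * q0 - p0 * q2)
  + (w o0 0 * w' o1 0 - w o1 0 * w' o0 0) * (p0 * q1 - p1 * q0)); first ring.
by rewrite e1 e2 e3; ring.
Qed.

(* For general s the point (1, s, s^2) lies on no side of the triangle, and for
   general s' the line with covector (-s - s' s^2, 1, s') through it contains no vertex:
   the point is made vertical and the line the line at infinity. *)
Lemma good_exists t : exists2 R, R \in unitmx & good R t.
Proof.
(* The first two rows vanish at (1, s, s^2), which becomes the vertical point; the first row alone
   is the line at infinity. *)
pose Rs (s s' : k) := mx3 (- s - s' * s ^+ 2) 1 s' (- s ^+ 2) 0 1 1 0 0.
have uR s s' : Rs s s' \in unitmx.
  have /mulmx1_unit[] // : Rs s s' *m mx3 0 0 1 1 (- s') s 0 1 (s ^+ 2) = 1%:M.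
  by rewrite mul_mx3 scalar_mx3; congr mx3; ring.
have rE s s' w : [/\ rho (Rs s s') o0 w = (w o1 0 - s * w o0 0) + s' * (w o2 0 - s ^+ 2 * w o0 0)
    & rho (Rs s s') o1 w = w o2 0 - s ^+ 2 * w o0 0].
  by split; rewrite /rho mxE sum3 !mxE /=; ring.
(* The covector of l evaluated at (1, s, s^2): a nonzero polynomial, since the points of the conic
   span the space. *)
pose Pl (l : P2dual) : {poly k} := let w := (vbasis (val l))`_0 in let w' := (vbasis (val l))`_1 in
   Poly [:: w o1 0 * w' o2 0 - w o2 0 * w' o1 0; w o2 0 * w' o0 0 - w o0 0 * w' o2 0;
            w o0 0 * w' o1 0 - w o1 0 * w' o0 0].
have Pl0 l : Pl l != 0.
  apply: contraTneq (line_cross l) => P0; rewrite !negb_or !negbK.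
  have /= c0 := congr1 (fun p : {poly k} => p`_0) P0.
  have /= c1 := congr1 (fun p : {poly k} => p`_1) P0.
  have /= c2 := congr1 (fun p : {poly k} => p`_2) P0.
  by move: c0 c1 c2; rewrite /Pl !coef_Poly !coef0 /= => -> -> ->; rewrite eqxx.
have PlE l s s' : minor (fline (Rs s s')) l = (Pl l).[s].
  rewrite /minor det2 !mxE /fline /=; set w := (vbasis _)`_0; set w' := (vbasis _)`_1.
  have [-> ->] := rE s s' w; have [-> ->] := rE s s' w'.
  by rewrite /Pl -/w -/w' horner_Poly /=; ring.
(* If this is nonzero at s then x is not the point (1, s, s^2). A point whose first two coordinates
   vanish is never on this curve, hence the constant 1. *)
pose Qx (x : P2) : {poly k} := let w := (vbasis (val x))`_0 in
  if (w o0 0 == 0) && (w o1 0 == 0) then 1 else (w o1 0)%:P - (w o0 0)%:P * 'X.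
have Qx0 x : Qx x != 0.
  rewrite /Qx /=; set w := (vbasis _)`_0; case: ifPn => [_|]; first exact: oner_neq0.
  apply: contraNneq => Q0.
  have c0 := congr1 (fun p : {poly k} => p`_0) Q0; have c1 := congr1 (fun p : {poly k} => p`_1) Q0.
  move: c0 c1; rewrite !coefB !coefCM !coefC !coefX /= !mulr0 !mulr1 subr0 sub0r => -> /eqP.
  by rewrite oppr_eq0 => ->; rewrite eqxx.
have /poly_nonroot[s] : all (fun p => p != 0) [:: Pl (l12 t); Pl (l13 t); Pl (l23 t);
    Qx (x1 t); Qx (x2 t); Qx (x3 t)] by rewrite /= !Pl0 !Qx0.
case/and5P=> p1 p2 p3 q1 /and3P[q2 q3 _].
(* The covector of the line at infinity evaluated at x, as a polynomial in s'. Both coefficients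
   vanish only if x is (1, s, s^2). *)
pose Sx (x : P2) : {poly k} := let w := (vbasis (val x))`_0 in
  (w o1 0 - s * w o0 0)%:P + (w o2 0 - s ^+ 2 * w o0 0)%:P * 'X.
have Sx0 x : (Qx x).[s] != 0 -> Sx x != 0.
  rewrite /Qx /Sx /=; set w := (vbasis _)`_0 => qx; apply/eqP => S0.
  have c0 := congr1 (fun p : {poly k} => p`_0) S0; have c1 := congr1 (fun p : {poly k} => p`_1) S0.
  move: c0 c1 qx; rewrite !coefD !coefCM !coefC !coefX /= !mulr0 !mulr1 addr0 add0r => c0 c1.
  case: ifPn => [/andP[/eqP w0 /eqP w1] _|_].
    have w2 : w o2 0 = 0 by rewrite -c1 w0; ring.
    have [f [lf]] := minor_neq0 x; rewrite /minor det_mx11 mxE -/w.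
    rewrite (_ : w = 0) ?(scalarf0 (lf _)) ?eqxx // [w]cvE w0 w1 w2.
    by apply/colP => i; rewrite !mxE; case: (ord3P i) => ->.
  by rewrite !hornerE (mulrC _ s) c0 eqxx.
have /poly_nonroot[s'] : all (fun p => p != 0) [:: Sx (x1 t); Sx (x2 t); Sx (x3 t)].
  by rewrite /= !Sx0.
case/and4P=> s1 s2 s3 _.
have SxE x : minor (fpoint (Rs s s')) x = (Sx x).[s'].
  rewrite /minor det_mx11 mxE /fpoint /Sx /=; set w := (vbasis _)`_0.
  by have [-> _] := rE s s' w; rewrite !hornerE /=; ring.
by exists (Rs s s') => //; rewrite /good !SxE !PlE.
Qed.

Definition fpull (X : pspace k) (x : X) (pi : X -> flags k) : Prop :=
  [/\ pull x (x1 \o pi), pull x (x2 \o pi), pull x (x3 \o pi) &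
  [/\ pull x (l12 \o pi), pull x (l13 \o pi) & pull x (l23 \o pi)]].

Section Regular.
Variables (X : pspace k) (x : X) (pi : X -> flags k) (R : 'M[k]_3).
Hypotheses (fp : fpull x pi) (gR : good R (pi x)).

Lemma near_good : near x (fun y => good R (pi y)).
Proof.
case: fp gR => [p1 p2 p3 [p4 p5 p6]] [g1 g2 g3 [g4 g5 g6]].
have n1 := near_minor p1 (fpoint_scalar R) g1; have n2 := near_minor p2 (fpoint_scalar R) g2.
have n3 := near_minor p3 (fpoint_scalar R) g3; have n4 := near_minor p4 (fline_scalar R) g4.
have n5 := near_minor p5 (fline_scalar R) g5; have n6 := near_minor p6 (fline_scalar R) g6.
apply: near_imp (near_and (near_and n1 (near_and n2 n3)) (near_and n4 (near_and n5 n6))).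
by move=> y [[? [? ?]] [? [? ?]]].
Qed.

Lemma reg_flag_coords :
  [/\ reg x (fun y => pa R (x1 (pi y))), reg x (fun y => pa R (x2 (pi y))),
      reg x (fun y => pa R (x3 (pi y))) &
  [/\ reg x (fun y => pb R (x1 (pi y))), reg x (fun y => pb R (x2 (pi y))) &
      reg x (fun y => pb R (x3 (pi y)))]] /\
  [/\ reg x (fun y => lm R (l12 (pi y))), reg x (fun y => lm R (l13 (pi y))),
      reg x (fun y => lm R (l23 (pi y))) &
  [/\ reg x (fun y => lc R (l12 (pi y))), reg x (fun y => lc R (l13 (pi y))) &
      reg x (fun y => lc R (l23 (pi y)))]].
Proof.
case: fp gR => [p1 p2 p3 [p4 p5 p6]] [g1 g2 g3 [g4 g5 g6]].
by do ![split]; apply: reg_gcoord => //; try exact: fpoint_scalar; try exact: fline_scalar;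
  exact: rho_scalar.
Qed.

Lemma reg_Gmat i j : reg x (fun y => Gmat R (pi y) i j).
Proof.
have [[ra1 _ _ [rb1 _ _]] [rm3 _ _ _]] := reg_flag_coords;
  have [r0 r1] := (reg_const x 0, reg_const x 1).
apply: reg_mulmx => {i j} i j; first exact: reg_const.
exact: (reg_mx3 r1 r0 r0 ra1 r1 r0 rb1 rm3 r1).
Qed.

Lemma reg_Hmat i j : reg x (fun y => Hmat R (pi y) i j).
Proof.
have [[ra1 _ _ [rb1 _ _]] [rm3 _ _ _]] := reg_flag_coords;
  have [r0 r1] := (reg_const x 0, reg_const x 1).
apply: reg_mulmx => {i j} i j; last exact: reg_const.
exact: (reg_mx3 r1 r0 r0 (regN ra1) r1 r0 (regB (regM rm3 ra1) rb1) (regN rm3) r1).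
Qed.

Lemma reg_tcoords : [/\ reg x (fun y => tu R (pi y)), reg x (fun y => tv R (pi y)),
  reg x (fun y => tm1 R (pi y)) & reg x (fun y => tm2 R (pi y))].
Proof.
have [[ra1 ra2 ra3 _] [rm3 rm2 rm1 _]] := reg_flag_coords.
by split; apply: regB.
Qed.

(** Each incidence is an equality of functions regular at x, which holds for general triangles near
    x. *)
Lemma closure_incident (B : X -> Prop) : R \in unitmx -> zclosure B x ->
  (forall y, B y -> general_triangle (pi y)) -> incident R (pi x).
Proof.
move=> uR clx Bg; have [[ra1 ra2 ra3 [rb1 rb2 rb3]] [rm3 rm2 rm1 [rc3 rc2 rc1]]] := reg_flag_coords.
have lim sb sc sa sm : reg x sb -> reg x sc -> reg x sa -> reg x sm ->
    (forall y, incident R (pi y) -> sb y = sc y + sa y * sm y) -> sb x = sc x + sa x * sm x.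
  move=> rb rc ra rm sE; apply/eqP; rewrite -subr_eq0; apply/eqP.
  apply: (zclosure_lim (s := fun y => sb y - (sc y + sa y * sm y)) clx).
    by apply: regB rb (regD rc (regM ra rm)).
  apply: near_imp near_good => y gy /Bg/(general_incident uR gy)/sE ->.
  by rewrite subrr.
split; last split.
- by apply: (lim _ _ _ _ rb1 rc3 ra1 rm3) => y [].
- by apply: (lim _ _ _ _ rb2 rc3 ra2 rm3) => y [].
- by apply: (lim _ _ _ _ rb1 rc2 ra1 rm2) => y [].
- by apply: (lim _ _ _ _ rb3 rc2 ra3 rm2) => y [_ _ _ []].
- by apply: (lim _ _ _ _ rb2 rc1 ra2 rm1) => y [_ _ _ []].
- by apply: (lim _ _ _ _ rb3 rc1 ra3 rm1) => y [_ _ _ []].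
Qed.

End Regular.

End Flags.

(** * Degenerate triangles: local forms of algebras and nets *)

Section Local.
Variable k : closedFieldType.
Hypothesis char0 : [pchar k] =i pred0.
Notation V3 := 'cV[k]_3.
Notation sl3 := (sl3 k).
Notation quad := (quad k).

Lemma det3 (M : 'M[k]_3) : \det M =
  M o0 o0 * (M o1 o1 * M o2 o2 - M o1 o2 * M o2 o1)
  - M o0 o1 * (M o1 o0 * M o2 o2 - M o1 o2 * M o2 o0)
  + M o0 o2 * (M o1 o0 * M o2 o1 - M o1 o1 * M o2 o0).
Proof.
rewrite (expand_det_row _ o0) sum3 /cofactor !det2 !mxE.
have e00 : lift o0 (ord0 : 'I_2) = o1 by apply: val_inj.
have e01 : lift o0 (ord_max : 'I_2) = o2 by apply: val_inj.
have e10 : lift o1 (ord0 : 'I_2) = o0 by apply: val_inj.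
have e11 : lift o1 (ord_max : 'I_2) = o2 by apply: val_inj.
have e20 : lift o2 (ord0 : 'I_2) = o0 by apply: val_inj.
have e21 : lift o2 (ord_max : 'I_2) = o1 by apply: val_inj.
by rewrite e00 e01 e10 e11 e20 e21 /= expr0 expr1 sqrrN expr1n; ring.
Qed.

(** Under [ok], in the coordinates G, the vertices are eigenvectors of Y with eigenvalues 0, p u, p
    v (p times the abscissas), and [Zmx v (v * m2)] kills x1 and x2 and multiplies x3 by v m2. The
    matrices need not be traceless; [slm] corrects this. For u = v = m2 = 0 they are p E01 + q E12
    and E02. *)
Definition Ymx (p q u v : k) := mx3 0 p 0 0 (p * u) q 0 0 (p * v).
Definition Zmx (v t : k) := mx3 0 0 1 0 0 v 0 0 t.

Definition algbasis (G H : 'M[k]_3) u v m2 p q : seq sl3 :=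
  [:: slm (G *m Ymx p q u v *m H); slm (G *m Zmx v (v * m2) *m H)].

(** In coordinates x, y, w these are w (y - v x), w (w - v m2 x) and p y (y - u x) - q x w. The
    first two are the first side plus a line through x3; the third takes at x3 the value v (p (v -
    u) - q m2), which is 0 under [ok]. *)
Definition qbasis (H : 'M[k]_3) u v m2 p q : seq quad :=
  [:: qf H 0 0 (- v) 0 1 0; qf H 0 0 (- (v * m2)) 0 0 1; qf H 0 (- (p * u)) (- q) p 0 0].

(* The differences of the abscissas of the vertices and of the slopes of the
   sides are proportional; the ratio (p : q) is an extra datum when they all
   vanish. *)
Definition ok (u v m1 m2 p q : k) : Prop :=
  [/\ (p != 0) || (q != 0), q * m1 = p * v & q * m2 = p * (v - u)].

Section Frame.
Variables (G H : 'M[k]_3) (u v m1 m2 : k).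
Hypotheses (HG : H *m G = 1%:M).
Let GH : G *m H = 1%:M. Proof. exact: mulmx1C. Qed.

(** Triangularity says that A preserves x1 and the first side. The other equations are the
    eigenvector conditions at x2 and x3 after division; the last two say that (M01, M12 - v M02)
    stands in the ratio (p : q) of the rows (m1, m2) and (v, v - u). *)
Definition aform (A : sl3) : Prop :=
  let M i j := slc G H i j A in
  [/\ M o1 o0 = 0, M o2 o0 = 0, M o2 o1 = 0 &
  [/\ M o1 o1 - M o0 o0 = M o0 o1 * u,
      M o2 o2 - M o0 o0 = M o0 o1 * v + M o0 o2 * (v * m2),
      m1 * (M o1 o2 - v * M o0 o2) = M o0 o1 * v &
      m2 * (M o1 o2 - v * M o0 o2) = M o0 o1 * (v - u)]].

Lemma aform_slm A : aform A ->
  A = slm (G *m Ymx (slc G H o0 o1 A) (slc G H o1 o2 A - v * slc G H o0 o2 A) u v *m H)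
      + slc G H o0 o2 A *: slm (G *m Zmx v (v * m2) *m H).
Proof.
case=> M10 M20 M21 [M11 M22 _ _]; rewrite /slc in M10 M20 M21 M11 M22 *.
have AE : vsval A = G *m (H *m vsval A *m G) *m H by rewrite !mulmxA GH mul1mx -mulmxA GH mulmx1.
rewrite -[in LHS](slmK char0 A) [in LHS]AE; set M := H *m _ *m G in M10 M20 M21 M11 M22 *.
rewrite -linearZ -linearD /= scalemxAl scalemxAr -mulmxDl -mulmxDr.
have ME : M = (M o0 o0)%:M + (Ymx (M o0 o1) (M o1 o2 - v * M o0 o2) u v + M o0 o2 *: Zmx v (v *
  m2)).
  have E11 : M o1 o1 = M o0 o0 + M o0 o1 * u by rewrite -M11; ring.
  have E22 : M o2 o2 = M o0 o0 + (M o0 o1 * v + M o0 o2 * (v * m2)) by rewrite -M22; ring.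
  rewrite {1}[M]mx3E scalar_mx3 scale_mx3 !add_mx3 M10 M20 M21 E11 E22.
  by congr mx3; ring.
rewrite [in LHS]ME mulmxDr mulmxDl linearD /= scalar_mxC -[_%:M *m G *m H]mulmxA GH mulmx1.
by rewrite (slm_scalar char0) add0r.
Qed.

(** This is the corner entry of the commutator. When all differences vanish, [aform] leaves the
    three-dimensional space of E01, E12, E02 modulo scalars, and only this relation makes (P : Q)
    the same for all elements of an algebra. *)
Lemma aform_commute A B : aform A -> aform B -> vsval A *m vsval B = vsval B *m vsval A ->
  slc G H o0 o1 A * (slc G H o1 o2 B - v * slc G H o0 o2 B) =
  slc G H o0 o1 B * (slc G H o1 o2 A - v * slc G H o0 o2 A).
Proof.
case=> A10 A20 A21 [A11 A22 _ _] [B10 B20 B21 [B11 B22 _ _]] AB.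
have mulE (C D : sl3) : (H *m vsval C *m G) *m (H *m vsval D *m G) = H *m (vsval C *m vsval D) *m G.
  by rewrite !mulmxA -[_ *m G *m H]mulmxA GH mulmx1.
have: ((H *m vsval A *m G) *m (H *m vsval B *m G)) o0 o2 =
      ((H *m vsval B *m G) *m (H *m vsval A *m G)) o0 o2 by rewrite !mulE AB.
rewrite !mxE !sum3 -!/(slc G H _ _ A) -!/(slc G H _ _ B) => E.
apply/eqP; rewrite -subr_eq0; apply/eqP.
transitivity ((slc G H o0 o0 A * slc G H o0 o2 B + slc G H o0 o1 A * slc G H o1 o2 B
   + slc G H o0 o2 A * slc G H o2 o2 B) - (slc G H o0 o0 B * slc G H o0 o2 A +
   slc G H o0 o1 B * slc G H o1 o2 A + slc G H o0 o2 B * slc G H o2 o2 A)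
   + slc G H o0 o2 B * (slc G H o2 o2 A - slc G H o0 o0 A)
   - slc G H o0 o2 A * (slc G H o2 o2 B - slc G H o0 o0 B)
   - v * slc G H o0 o1 A * slc G H o0 o2 B + v * slc G H o0 o1 B * slc G H o0 o2 A); first ring.
by rewrite E A22 B22; ring.
Qed.

Lemma slc_Y p q : [/\ slc G H o0 o1 (slm (G *m Ymx p q u v *m H)) = p,
  slc G H o1 o2 (slm (G *m Ymx p q u v *m H)) = q &
  slc G H o0 o2 (slm (G *m Ymx p q u v *m H)) = 0].
Proof.
by split; rewrite (slc_slm char0) // !mulmxA HG mul1mx -mulmxA HG mulmx1 mxE.
Qed.

Lemma slc_Z t : [/\ slc G H o0 o1 (slm (G *m Zmx v t *m H)) = 0,
  slc G H o1 o2 (slm (G *m Zmx v t *m H)) = v &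
  slc G H o0 o2 (slm (G *m Zmx v t *m H)) = 1].
Proof.
by split; rewrite (slc_slm char0) // !mulmxA HG mul1mx -mulmxA HG mulmx1 mxE.
Qed.

Lemma algbasis_free p q : (p != 0) || (q != 0) -> free (algbasis G H u v m2 p q).
Proof.
have [Y01 Y12 Y02] := slc_Y p q; have [Z01 Z12 Z02] := slc_Z (v * m2).
case/orP=> pq0.
  apply: (@free_minor _ 2 _ (fun b => if b == ord0 then slc G H o0 o1 else slc G H o0 o2)) => //.
    by move=> b; case: ifP => _; apply: slc_scalar.
  by rewrite det2 !mxE /= Y01 Y02 Z01 Z02 mulr1 mulr0 subr0.
apply: (@free_minor _ 2 _ (fun b => if b == ord0 then slc G H o1 o2 else slc G H o0 o2)) => //.
  by move=> b; case: ifP => _; apply: slc_scalar.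
by rewrite det2 !mxE /= Y12 Y02 Z12 Z02 mulr1 mul0r subr0.
Qed.

Lemma Ymx_scale c p q p' q' : p' = c * p -> q' = c * q ->
  slm (G *m Ymx p' q' u v *m H) = c *: slm (G *m Ymx p q u v *m H).
Proof.
move=> -> ->; rewrite -linearZ /= scalemxAl scalemxAr scale_mx3.
by rewrite /Ymx !mulr0 !mulrA.
Qed.

Lemma subspace_ne (V : vectType k) (U W : {vspace V}) : (\dim W < \dim U)%N ->
  exists2 w, w \in U & w \notin W.
Proof. by move=> dWU; apply/subvPn; apply: contraL dWU => /dimvS; rewrite leqNgt. Qed.

Lemma alg_local (h : Gr 2 sl3) : (forall A, A \in val h -> aform A) ->
  (forall A B, A \in val h -> B \in val h -> vsval A *m vsval B = vsval B *m vsval A) ->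
  exists p q, ok u v m1 m2 p q /\ basis_of (val h) (algbasis G H u v m2 p q).
Proof.
move=> hform hcomm; set Z := slm (G *m Zmx v (v * m2) *m H).
pose P A := slc G H o0 o1 A; pose Q A := slc G H o1 o2 A - v * slc G H o0 o2 A.
have PQ0 A : A \in val h -> P A = 0 -> Q A = 0 -> A = slc G H o0 o2 A *: Z.
  move=> Ah PA QA; rewrite [LHS](aform_slm (hform _ Ah)) -/(P A) -/(Q A) PA QA.
  rewrite (_ : Ymx 0 0 u v = 0) ?mulmx0 ?mul0mx ?linear0 ?add0r //.
  by apply/matrixP => i j; rewrite !mxE !mul0r; case: (ord3P i) => ->; case: (ord3P j) => ->.
have lt1 (w : sl3) : (\dim <[w]> < \dim (val h))%N by rewrite Gr_dim dim_vline; case: eqP.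
(* D is not a multiple of Z, so its pair (P, Q) is nonzero and serves as (p, q); B is independent of
   D. *)
have [D Dh DZ] := subspace_ne (lt1 Z); have [B Bh BD] := subspace_ne (lt1 D).
have pq0 : (P D != 0) || (Q D != 0).
  rewrite -negb_and; apply: contra DZ => /andP[/eqP PD /eqP QD].
  by rewrite (PQ0 _ Dh PD QD) memvZ // memv_line.
have := aform_commute (hform _ Dh) (hform _ Bh) (hcomm _ _ Dh Bh).
rewrite -/(P D) -/(P B) -/(Q D) -/(Q B) => PQ.
have [c [PB QB]] : exists c, P B = c * P D /\ Q B = c * Q D.
  have [p0|p0] := eqVneq (P D) 0.
    have q0 : Q D != 0 by move: pq0; rewrite p0 eqxx.
    exists (Q B / Q D); rewrite divfK // p0 mulr0; split=> //.
    by move/eqP: PQ; rewrite p0 mul0r eq_sym mulf_eq0 (negPf q0) orbF => /eqP.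
  exists (P B / P D); rewrite divfK //; split=> //.
  by rewrite mulrAC -PQ mulrAC divff // mul1r.
(* Eliminating (P, Q) leaves a nonzero element of the algebra proportional to Z, so Z itself lies in
   the algebra. *)
pose C := B - c *: D; have Ch : C \in val h by rewrite rpredB // memvZ.
have CE f : scalar f -> f C = f B - c * f D.
  by move=> lf; rewrite /C -scaleNr (scalarfD lf) (scalarfZ lf) mulNr.
have CZ : C = slc G H o0 o2 C *: Z.
  apply: PQ0 => //; rewrite /P /Q !CE; try exact: slc_scalar.
    by rewrite -/(P B) -/(P D) PB subrr.
  transitivity (Q B - c * Q D); first by rewrite /Q; ring.
  by rewrite QB subrr.
have Zh : Z \in val h.
  have r0 : slc G H o0 o2 C != 0.
    apply: contraNneq BD => r0; rewrite -(subrK (c *: D) B) -/C CZ r0 scale0r add0r.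
    by rewrite memvZ // memv_line.
  by rewrite -[Z](scalerK r0) -CZ memvZ.
exists (P D), (Q D); have [_ _ _ [_ _ e1 e2]] := hform D Dh.
split; first by split; rewrite // mulrC -/(Q D).
apply: basis_of_Gr => //; first exact: algbasis_free.
move=> w; rewrite !inE => /orP[/eqP->|/eqP->//].
have := aform_slm (hform _ Dh); rewrite -/(P D) -/(Q D) -/Z => DE.
have -> : slm (G *m Ymx (P D) (Q D) u v *m H) = D - slc G H o0 o2 D *: Z.
  by apply/eqP; rewrite eq_sym subr_eq -DE.
by rewrite rpredB // memvZ.
Qed.

(* The quadratic form vanishes at x1, and on each of the three sides it is a
   multiple of the form that vanishes at the two vertices. *)
Definition qform (Q : quad) : Prop :=
  let C i j := qcoef G Q i j in
  let r := C o0 o2 + C o1 o2 * v + C o2 o2 * (v * m2) in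
  [/\ C o0 o0 = 0, C o0 o1 = - (C o1 o1 * u),
      C o1 o1 * v = - (m1 * r) & C o1 o1 * (v - u) = - (m2 * r)].

Lemma qform_qf Q : qform Q -> let p := qcoef G Q o1 o1 in
  let q := - (qcoef G Q o0 o2 + qcoef G Q o1 o2 * v + qcoef G Q o2 o2 * (v * m2)) in
  Q = qcoef G Q o1 o2 *: qf H 0 0 (- v) 0 1 0 +
      (qcoef G Q o2 o2 *: qf H 0 0 (- (v * m2)) 0 0 1 + qf H 0 (- (p * u)) (- q) p 0 0).
Proof.
case=> C00 C01 _ _ /=; rewrite {1}(qf_qcoef Q GH) !qf_linear C00 C01.
move: (qcoef G Q o0 o2) (qcoef G Q o1 o1) (qcoef G Q o1 o2) (qcoef G Q o2 o2) => c02 c11 c12 c22.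
by apply: qf_congr; ring.
Qed.

Lemma qbasis_free p q : (p != 0) || (q != 0) -> free (qbasis H u v m2 p q).
Proof.
have [a0 a1 a2 [a3 a4 a5]] := qcoef_qf 0 0 (- v) 0 1 0 HG.
have [b0 b1 b2 [b3 b4 b5]] := qcoef_qf 0 0 (- (v * m2)) 0 0 1 HG.
have [c0 c1 c2 [c3 c4 c5]] := qcoef_qf 0 (- (p * u)) (- q) p 0 0 HG.
case/orP=> pq0.
  pose f (b : 'I_3) Q := nth 0 [:: qcoef G Q o1 o2; qcoef G Q o2 o2; qcoef G Q o1 o1] b.
  apply: (@free_minor _ 3 _ f) => //.
    by move=> b; case: (ord3P b) => ->; apply: qcoef_scalar.
  by rewrite det3 !mxE /f /= a3 a4 a5 b3 b4 b5 c3 c4 c5 (_ : _ + _ = p) //; ring.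
pose f (b : 'I_3) Q := nth 0 [:: qcoef G Q o1 o2; qcoef G Q o2 o2; qcoef G Q o0 o2] b.
apply: (@free_minor _ 3 _ f) => //.
  by move=> b; case: (ord3P b) => ->; apply: qcoef_scalar.
rewrite det3 !mxE /f /= a2 a4 a5 b2 b4 b5 c2 c4 c5 (_ : _ + _ = - q) ?oppr_eq0 //; ring.
Qed.

(** The two forms containing the first side are given, so a third element of the net, taken modulo
    them, provides p and q. *)
Lemma quad_local (N : Gr 3 quad) : (forall Q, Q \in val N -> qform Q) ->
  qf H 0 0 (- v) 0 1 0 \in val N -> qf H 0 0 (- (v * m2)) 0 0 1 \in val N ->
  exists p q, ok u v m1 m2 p q /\ basis_of (val N) (qbasis H u v m2 p q).
Proof.
move=> Nform N1 N2; set q1 := qf H 0 0 (- v) 0 1 0 in N1 *.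
set q2 := qf H 0 0 _ 0 0 1 in N2 *.
have [Q QN Q12] : exists2 Q, Q \in val N & Q \notin <<[:: q1; q2]>>%VS.
  by apply: subspace_ne; rewrite Gr_dim ltnS dim_span.
have [C00 C01 e1 e2] := Nform Q QN; have /= QE := qform_qf (Nform Q QN).
rewrite -/q1 -/q2 in QE.
set p := qcoef G Q o1 o1 in e1 e2 QE; set r := _ + _ in e1 e2 QE.
have q3E : qf H 0 (- (p * u)) (- - r) p 0 0 = Q - qcoef G Q o1 o2 *: q1 - qcoef G Q o2 o2 *: q2.
  apply/eqP; rewrite eq_sym !subr_eq {1}QE; apply/eqP; rewrite [RHS]addrC.
  by congr (_ + _); rewrite addrC.
have pq0 : (p != 0) || (- r != 0).
  rewrite -negb_and; apply: contra Q12 => /andP[/eqP p0 /eqP r0].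
  rewrite QE p0 r0 mul0r !oppr0 qf0 addr0.
  by rewrite memvD // memvZ // memv_span // !inE eqxx ?orbT.
exists p, (- r); split; first by split; rewrite // mulNr mulrC.
apply: basis_of_Gr => //; first exact: qbasis_free.
move=> w; rewrite !inE => /or3P[/eqP->//|/eqP->//|/eqP->].
by rewrite q3E !rpredB // memvZ.
Qed.

End Frame.
End Local.

(** * Nondegenerate triangles *)

Section Minors.
Variable k : closedFieldType.
Hypothesis char0 : [pchar k] =i pred0.
Notation sl3 := (sl3 k).
Notation quad := (quad k).
Variable R : 'M[k]_3.

(** Entries are taken in the fixed coordinates [R]: in the moving frame the functionals would depend
    on the point. In the moving frame the basis Y, Z has the minors p and q, and conjugation by the
    unipotent frame matrices preserves these two values. *)
Definition hP : 'I_2 -> sl3 -> k :=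
  fun b => if b == ord0 then slc (invmx R) R o0 o1 else slc (invmx R) R o0 o2.
Definition hQ : 'I_2 -> sl3 -> k :=
  fun b => if b == ord0 then slc (invmx R) R o1 o2 else slc (invmx R) R o0 o2.
Definition nP : 'I_3 -> quad -> k := fun b Q => nth 0
  [:: qcoef (invmx R) Q o1 o2; qcoef (invmx R) Q o2 o2; qcoef (invmx R) Q o1 o1] b.
(** The sign is there because the third form of [qbasis] has the coefficient -q at x w. *)
Definition nQ : 'I_3 -> quad -> k := fun b Q => nth 0
  [:: qcoef (invmx R) Q o1 o2; qcoef (invmx R) Q o2 o2; - qcoef (invmx R) Q o0 o2] b.

Lemma hP_scalar b : scalar (hP b).
Proof. by rewrite /hP; case: ifP => _; apply: slc_scalar. Qed.
Lemma hQ_scalar b : scalar (hQ b).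
Proof. by rewrite /hQ; case: ifP => _; apply: slc_scalar. Qed.
Lemma nP_scalar b : scalar (nP b).
Proof. by case: (ord3P b) => -> a A B; rewrite /nP /= qcoef_scalar. Qed.
Lemma nQ_scalar b : scalar (nQ b).
Proof. by case: (ord3P b) => -> a A B; rewrite /nQ /= qcoef_scalar; last ring. Qed.

Hypothesis uR : R \in unitmx.
Variable t : flags k.
Let G := Gmat R t.
Let H := Hmat R t.

Lemma conj_GH M : R *m (G *m M *m H) *m invmx R =
  mx3 1 0 0 (pa R (x1 t)) 1 0 (pb R (x1 t)) (lm R (l12 t)) 1 *m M *m
  mx3 1 0 0 (- pa R (x1 t)) 1 0 (lm R (l12 t) * pa R (x1 t) - pb R (x1 t)) (- lm R (l12 t)) 1.
Proof.
rewrite /G /H /Gmat /Hmat /Gp /Hp !mulmxA mulmxV // mul1mx -[_ *m R *m invmx R]mulmxA mulmxV //.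
by rewrite mulmx1.
Qed.

Lemma h_minors h u v m2 p q : basis_of (val h) (algbasis G H u v m2 p q) ->
  exists2 c : k, c != 0 & minor hP h = c * p /\ minor hQ h = c * q.
Proof.
move=> /minor_basis[c c0 cE]; exists c => //.
rewrite (cE _ hP_scalar) (cE _ hQ_scalar) !det2 !mxE /hP /hQ /=.
rewrite !(slc_slm char0) ?mulmxV // !conj_GH !mul_mx3 !mxE /=.
by split; congr (_ * _); ring.
Qed.

Lemma H_invR x y w : H *m (invmx R *m cv x y w) =
  cv x (y - pa R (x1 t) * x) (w - lm R (l12 t) * y + (lm R (l12 t) * pa R (x1 t) - pb R (x1 t)) *
    x).
Proof.
by rewrite mulmxA /H /Hmat /Hp -[_ *m R *m _]mulmxA mulmxV // mulmx1 mul_mx3_cv; congr cv; ring.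
Qed.

Lemma n_minors N u v m2 p q : basis_of (val N) (qbasis H u v m2 p q) ->
  exists2 c : k, c != 0 & minor nP N = c * p /\ minor nQ N = c * q.
Proof.
move=> /minor_basis[c c0 cE]; exists c => //.
rewrite (cE _ nP_scalar) (cE _ nQ_scalar) !det3 !mxE /nP /nQ /=.
rewrite /qcoef /= -!mulmxDr !delta_cv /= !add_cv !(evq_qf _ _ _ _ _ _ (H_invR _ _ _)).
move: (pa R _) (pb R _) (lm R _) => a b m.
by split; congr (_ * _); ring.
Qed.

End Minors.

Section VertexConditions.
Variable k : closedFieldType.
Hypothesis char0 : [pchar k] =i pred0.
Notation sl3 := (sl3 k).
Notation quad := (quad k).

Lemma span2P (V : vectType k) (a b w : V) :
  w \in <<[:: a; b]>>%VS -> exists x y, w = x *: a + y *: b.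
Proof.
by rewrite span_cons span_seq1 => /memv_addP[_ /vlineP[x ->] [_ /vlineP[y ->] ->]]; exists x, y.
Qed.

Lemma span3P (V : vectType k) (a b c w : V) :
  w \in <<[:: a; b; c]>>%VS -> exists x y z, w = x *: a + (y *: b + z *: c).
Proof.
rewrite span_cons => /memv_addP[_ /vlineP[x ->] [w' /span2P[y [z ->]] ->]].
by exists x, y, z.
Qed.

Variables (G H : 'M[k]_3) (u v m1 m2 : k).
Hypotheses (HG : H *m G = 1%:M).
Let GH : G *m H = 1%:M. Proof. exact: mulmx1C. Qed.
Hypotheses (u0 : u != 0) (vm0 : v * m2 != 0) (tri : m1 * (v - u) = m2 * v).

Definition eigen (A : sl3) a b c : Prop := 
  exists l, vsval A *m (G *m cv a b c) = l *: (G *m cv a b c).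

Lemma eigenE (A : sl3) a b c l : vsval A *m (G *m cv a b c) = l *: (G *m cv a b c) <->
  (H *m vsval A *m G) *m cv a b c = l *: cv a b c.
Proof.
split=> /= E.
  by rewrite -!mulmxA E -scalemxAr mulmxA HG mul1mx.
by rewrite scalemxAr -E !mulmxA GH mul1mx.
Qed.

Lemma nondeg : [/\ v != 0, m2 != 0, m1 != 0 & v - u != 0].
Proof.
move: vm0; rewrite mulf_eq0 negb_or => /andP[v0 m20].
have: m1 * (v - u) != 0 by rewrite tri mulrC.
by rewrite mulf_eq0 negb_or => /andP[? ?].
Qed.

(** The eigenvector equations may be divided here by u, v and v m2; the quotients still say
    something when these factors tend to 0. *)
Lemma eigen_aform A : eigen A 1 0 0 -> eigen A 1 u 0 -> eigen A 1 v (v * m2) ->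
  aform G H u v m1 m2 A.
Proof.
have [v0 m20 m10 vu0] := nondeg.
move=> [a /eigenE E1] [b /eigenE E2] [c /eigenE E3]; rewrite /aform /slc.
set M := _ *m G in E1 E2 E3 *.
rewrite [M]mx3E mul_mx3_cv scale_cv in E1; rewrite [M]mx3E mul_mx3_cv scale_cv in E2.
rewrite [M]mx3E mul_mx3_cv scale_cv in E3.
move: E1 E2 E3 => /cv_inj[] e00 e10 e20 /cv_inj[] f0 f1 f2 /cv_inj[] g0 g1 g2 /=.
have M10 : M o1 o0 = 0 by rewrite -(mulr0 a) -e10; ring.
have M20 : M o2 o0 = 0 by rewrite -(mulr0 a) -e20; ring.
have M21 : M o2 o1 = 0.
  by apply: (mulIf u0); rewrite mul0r -(mulr0 b) -f2 M20; ring.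
have M11 : M o1 o1 = b by apply: (mulIf u0); rewrite -f1 M10; ring.
have M22 : M o2 o2 = c by apply: (mulIf vm0); rewrite -g2 M20 M21; ring.
have E1 : M o1 o1 - M o0 o0 = M o0 o1 * u by rewrite M11 -[b]mulr1 -f0; ring.
have E2 : M o2 o2 - M o0 o0 = M o0 o1 * v + M o0 o2 * (v * m2) by rewrite M22 -[c]mulr1 -g0; ring.
have E3 : m2 * (M o1 o2 - v * M o0 o2) = M o0 o1 * (v - u).
  apply: (mulfI v0).
  transitivity (v * M o1 o1 + v * m2 * M o1 o2 - v * (M o1 o1 - M o0 o0) - v * M o0 o0 - v * (v *
    m2 * M o0 o2)).
    ring.
  rewrite E1 (_ : v * M o1 o1 + v * m2 * M o1 o2 = v * M o2 o2).
    transitivity (v * (M o2 o2 - M o0 o0) - v * (M o0 o1 * u) - v * (v * m2 * M o0 o2)); first ring.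
    by rewrite E2; ring.
  by rewrite M22 [RHS]mulrC -g1 M10; ring.
rewrite -/M; split=> //; split=> //.
(* The condition with m1 follows from the one with m2 by the equation of the triangle. *)
apply: (mulIf vu0); transitivity ((m1 * (v - u)) * (M o1 o2 - v * M o0 o2)); first ring.
rewrite tri; transitivity (v * (m2 * (M o1 o2 - v * M o0 o2))); first ring.
by rewrite E3; ring.
Qed.

Lemma vanish_qform Q : evq Q (G *m cv 1 0 0) = 0 -> evq Q (G *m cv 1 u 0) = 0 ->
  evq Q (G *m cv 1 v (v * m2)) = 0 -> qform G u v m1 m2 Q.
Proof.
have [v0 m20 m10 vu0] := nondeg.
rewrite !evq_qcoef /qform.
move: (qcoef G Q o0 o0) (qcoef G Q o0 o1) (qcoef G Q o0 o2) (qcoef G Q o1 o1)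
  (qcoef G Q o1 o2) (qcoef G Q o2 o2) => c00 c01 c02 c11 c12 c22 E1 E2 E3.
have C00 : c00 = 0 by rewrite -[RHS]E1; ring.
have C01 : c01 = - (c11 * u).
  by apply: (mulIf u0); apply/eqP; rewrite -subr_eq0; apply/eqP; rewrite -[RHS]E2 C00; ring.
have C4 : c11 * (v - u) = - (m2 * (c02 + c12 * v + c22 * (v * m2))).
  by apply: (mulIf v0); apply/eqP; rewrite -subr_eq0; apply/eqP; rewrite -[RHS]E3 C00 C01; ring.
split=> //; apply: (mulIf vu0).
transitivity (c11 * (v - u) * v); first ring.
rewrite C4; set r := _ + _; transitivity (- ((m2 * v) * r)); first ring.
by rewrite -tri; ring.
Qed.

Section Rep.
Variable t : flags k.
Hypothesis ft : flagrep G u v m1 m2 t.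

Lemma rep_general : general_triangle t.
Proof.
have [v0 m20 m10 vu0] := nondeg.
move: t ft => [[[y1 y2] y3] [[n12 n13] n23]]; rewrite /flagrep /x1 /x2 /x3 /l12 /l13 /l23 /=.
move=> [b1 b2 b3 [c12 c13 c23]].
have HGv a b c : H *m (G *m cv a b c) = cv a b c by rewrite mulmxA HG mul1mx.
have f123 : free [:: G *m cv 1 0 0; G *m cv 1 u 0; G *m cv 1 v (v * m2)].
  apply: (@free_minor _ 3 _ (rho H)) => //; first exact: rho_scalar.
  rewrite det3 !mxE /rho /= !HGv !mxE /= (_ : _ + _ = u * (v * m2)) ?mulf_neq0 //; ring.
have s1 : val y1 = <[G *m cv 1 0 0]>%VS by rewrite -span_seq1; case/andP: b1 => /eqP.
have s2 : val y2 = <[G *m cv 1 u 0]>%VS by rewrite -span_seq1; case/andP: b2 => /eqP.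
have s3 : val y3 = <[G *m cv 1 v (v * m2)]>%VS by rewrite -span_seq1; case/andP: b3 => /eqP.
have memG a b c (l : Gr 2 'cV[k]_3) c0 m : basis_of (val l) [:: G *m cv 1 0 c0; G *m cv 0 1 m] ->
    a * c0 + b * m = c -> G *m cv a b c \in val l.
  case/andP=> /eqP <- _ <-.
  rewrite (_ : G *m _ = a *: (G *m cv 1 0 c0) + b *: (G *m cv 0 1 m)).
    by rewrite memvD // memvZ // memv_span // !inE eqxx ?orbT.
  by rewrite !scalemxAr -mulmxDr !scale_cv add_cv; congr (_ *m cv _ _ _); ring.
have side (l : Gr 2 'cV[k]_3) w w' : free [:: w; w'] -> w \in val l -> w' \in val l ->
    val l = (<[w]> + <[w']>)%VS.
  move=> fw wl wl'; apply/esym/eqP; rewrite eqEdim Gr_dim subv_add -!memvE wl wl' /=.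
  by have := fw; rewrite /free span_cons span_seq1 => /eqP->.
have /andP[_ f23] : (G *m cv 1 0 0 \notin <<[:: G *m cv 1 u 0; G *m cv 1 v (v * m2)]>>%VS) &&
   free [:: G *m cv 1 u 0; G *m cv 1 v (v * m2)] by rewrite -free_cons.
have f12 : free [:: G *m cv 1 0 0; G *m cv 1 u 0].
  by move: f123; rewrite -[[:: _; _; _]]/([:: _; _] ++ [:: _]) => /catl_free.
have f13 : free [:: G *m cv 1 0 0; G *m cv 1 v (v * m2)].
  have: free [:: G *m cv 1 u 0; G *m cv 1 0 0; G *m cv 1 v (v * m2)].
    by rewrite -(perm_free (permEl (perm_catCA [:: G *m cv 1 0 0] [:: G *m cv 1 u 0]
      [:: G *m cv 1 v (v * m2)]))).
  by rewrite free_cons => /andP[].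
rewrite -[sval y1]/(val y1) -[sval y2]/(val y2) -[sval y3]/(val y3).
split.
- rewrite s1 s2 s3 -addvA -!span_seq1 -!span_cat /=; apply/eqP.
  rewrite eqEdim subvf dimvf /=; have := f123; rewrite /free => /eqP->.
  by rewrite /dim /= muln1.
- rewrite -[sval n12]/(val n12) s1 s2; apply: side => //.
    by apply: memG c12 _; ring.
  by apply: memG c12 _; ring.
- rewrite -[sval n13]/(val n13) s1 s3; apply: side => //.
    by apply: memG c13 _; ring.
  by apply: memG c13 _; ring.
- rewrite -[sval n23]/(val n23) s2 s3; apply: side => //.
    apply: memG c23 _; apply/eqP; rewrite -subr_eq0; apply/eqP.
    by transitivity (m2 * v - m1 * (v - u)); [ring|rewrite tri subrr].
  by apply: memG c23 _; ring.
Qed.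

End Rep.
End VertexConditions.

Section VanishingQuadrics.
Variable k : closedFieldType.
Notation quad := (quad k).

Lemma evq_scale (Q : quad) c w : evq Q (c *: w) = c ^+ 2 * evq Q w.
Proof.
have [M ->] := mq_surj Q; rewrite !evq_mq mulr_sumr; apply: eq_bigr => i _.
by rewrite mulr_sumr; apply: eq_bigr => j _; rewrite !mxE; ring.
Qed.

Lemma vanishing_quadricsP (t : flags k) G u v m1 m2 (N : {vspace quad}) :
  flagrep G u v m1 m2 t -> vanishing_quadrics t N <-> forall Q, Q \in N <->
  [/\ evq Q (G *m cv 1 0 0) = 0, evq Q (G *m cv 1 u 0) = 0 & evq Q (G *m cv 1 v (v * m2)) = 0].
Proof.
move: t => [[[y1 y2] y3] ls] [b1 b2 b3 _]; rewrite /x1 /x2 /x3 /= in b1 b2 b3.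
have line Q (y : Gr 1 'cV[k]_3) w : basis_of (val y) [:: w] ->
    (forall z, z \in val y -> evq Q z = 0) <-> evq Q w = 0.
  case/andP=> /eqP <- _; split=> [|Qw z]; first by apply; rewrite memv_span // inE.
  by rewrite span_seq1 => /vlineP[e ->]; rewrite evq_scale Qw mulr0.
have vE Q : (forall z, [|| z \in val y1, z \in val y2 | z \in val y3] -> evq Q z = 0) <->
  [/\ evq Q (G *m cv 1 0 0) = 0, evq Q (G *m cv 1 u 0) = 0 & evq Q (G *m cv 1 v (v * m2)) = 0].
  split=> [E|[/(line _ _ _ b1) q1 /(line _ _ _ b2) q2 /(line _ _ _ b3) q3] z]; last first.
    by case/or3P => [/q1|/q2|/q3].
  split; [apply/(line _ _ _ b1)|apply/(line _ _ _ b2)|apply/(line _ _ _ b3)] => z zy; apply/E/or3P.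
  - by constructor 1.
  - by constructor 2.
  - by constructor 3.
by split=> NE Q; [rewrite -vE; apply: NE|rewrite NE -vE].
Qed.

End VanishingQuadrics.

Section Nondegenerate.
Variable k : closedFieldType.
Hypothesis char0 : [pchar k] =i pred0.
Notation sl3 := (sl3 k).
Notation quad := (quad k).
Variables (G H : 'M[k]_3) (u v m1 m2 p q : k).
Hypotheses (HG : H *m G = 1%:M).
Let GH : G *m H = 1%:M. Proof. exact: mulmx1C. Qed.

Lemma algbasis_mem (h : {vspace sl3}) A : basis_of h (algbasis G H u v m2 p q) -> A \in h ->
  exists x y c, forall a b d, vsval A *m (G *m cv a b d) =
    G *m cv (x * p * b + y * d - c * a) (x * (p * u * b + q * d) + y * v * d - c * b)
            (x * p * v * d + y * (v * m2) * d - c * d).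
Proof.
move=> /andP[/eqP <- _] /span2P[x [y ->]].
have -> : x *: slm (G *m Ymx p q u v *m H) + y *: slm (G *m Zmx v (v * m2) *m H) =
    slm (G *m (x *: Ymx p q u v + y *: Zmx v (v * m2)) *m H).
  by rewrite mulmxDr mulmxDl linearD -!scalemxAr -!scalemxAl !linearZ.
rewrite !scale_mx3 add_mx3.
set M := mx3 _ _ _ _ _ _ _ _ _; exists x, y, (\tr (G *m M *m H) / 3) => a b d.
rewrite (val_slm char0) mulmxBl mul_scalar_mx -!mulmxA (mulmxA H) HG mul1mx.
rewrite scalemxAr -mulmxBr mul_mx3_cv scale_cv -scaleN1r scale_cv add_cv.
by congr (_ *m cv _ _ _); ring.
Qed.

Lemma mx_ext (M N : 'M[k]_3) : (forall a b c, M *m (G *m cv a b c) = N *m (G *m cv a b c)) -> M = N.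
Proof.
move=> MN; suff: M *m G = N *m G by move/(congr1 (mulmx^~ H)); rewrite -!mulmxA GH !mulmx1.
apply/matrixP => i j; have := MN (j == o0)%:R (j == o1)%:R (j == o2)%:R.
rewrite (_ : cv _ _ _ = delta_mx j 0).
  by rewrite !mulmxA -!colE => /colP/(_ i); rewrite !mxE.
by apply/colP => l; rewrite !mxE andbT; case: (ord3P l) => -> /=; rewrite eq_sym.
Qed.

Hypothesis hok : ok u v m1 m2 p q.

Lemma ok_tri : m1 * (v - u) = m2 * v.
Proof.
case: hok => /orP[p0|q0] e1 e2.
  apply: (mulfI p0); transitivity (m1 * (p * (v - u))); first ring.
  by rewrite -e2; transitivity ((q * m1) * m2); [ring|rewrite e1; ring].
apply: (mulfI q0); transitivity ((q * m1) * (v - u)); first ring.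
by rewrite e1; transitivity (v * (p * (v - u))); [ring|rewrite -e2; ring].
Qed.

Hypotheses (u0 : u != 0) (vm0 : v * m2 != 0).

Lemma ok_pq : p != 0 /\ q != 0.
Proof.
have [v0 m20 m10 vu0] := nondeg vm0 ok_tri.
have [pq e1 _] := hok.
have p0 : p != 0.
  apply/eqP => p0; move: e1 pq; rewrite p0 mul0r eqxx => /eqP.
  by rewrite mulf_eq0 (negPf m10) orbF => /eqP->; rewrite eqxx.
split=> //; apply/eqP => q0.
by move/eqP: e1; rewrite q0 mul0r eq_sym mulf_eq0 (negPf p0) (negPf v0).
Qed.

(** Over a nondegenerate triangle (p : q) is no extra datum: m2 and v - u are nonzero and determine
    it. *)
Lemma ok_prop p' q' : m2 * q' = p' * (v - u) -> exists c, p' = c * p /\ q' = c * q.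
Proof.
have [v0 m20 m10 vu0] := nondeg vm0 ok_tri; have [p0 q0] := ok_pq.
move=> e'; exists (p' / p); rewrite divfK //; split=> //.
apply: (mulfI m20); rewrite e'; case: hok => _ _ e.
transitivity (p' / p * (q * m2)); last ring.
by rewrite e; field.
Qed.

Lemma eigen_alg (h : {vspace sl3}) A : basis_of h (algbasis G H u v m2 p q) ->
  A \in h <-> [/\ eigen G A 1 0 0, eigen G A 1 u 0 & eigen G A 1 v (v * m2)].
Proof.
move=> hb; split.
  move=> /(algbasis_mem hb)[x [y [c AE]]]; have [_ e1 e2] := hok.
  split; [exists (- c)|exists (x * p * u - c)|exists (x * p * v + y * (v * m2) - c)];
    rewrite AE scalemxAr scale_cv; congr (_ *m cv _ _ _); try ring.
  have -> : q * (v * m2) = v * (q * m2) by ring.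
  by rewrite e2; ring.
case=> E1 E2 E3; have aA := eigen_aform HG u0 vm0 ok_tri E1 E2 E3.
have [_ _ _ [_ _ _ e]] := aA; rewrite (aform_slm char0 HG aA).
have [c [pE qE]] := ok_prop e; rewrite (Ymx_scale G H u v pE qE).
case/andP: hb => /eqP <- _.
by rewrite memvD // memvZ // memv_span // !inE eqxx ?orbT.
Qed.

Variable t : flags k.
Hypothesis ft : flagrep G u v m1 m2 t.

Lemma rep_diagonal (h : {vspace sl3}) : basis_of h (algbasis G H u v m2 p q) ->
  diagonal_algebra t h.
Proof.
move=> hb; move: t ft => [[[y1 y2] y3] ls] [b1 b2 b3 _].
rewrite /x1 /x2 /x3 /= in b1 b2 b3.
exists (G *m cv 1 0 0), (G *m cv 1 u 0), (G *m cv 1 v (v * m2)).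
have line (U : {vspace 'cV[k]_3}) w : basis_of U [:: w] -> U = <[w]>%VS.
  by case/andP=> /eqP <- _; rewrite span_seq1.
split; [exact: line b1|exact: line b2|exact: line b3|].
move=> A; rewrite (eigen_alg A hb); split.
  by case=> -[a ?] [b ?] [c ?]; exists a, b, c.
by case=> a [b [c [? ? ?]]]; split; [exists a|exists b|exists c].
Qed.

Lemma general_diag (h : {vspace sl3}) A : diagonal_algebra t h -> A \in h ->
  [/\ eigen G A 1 0 0, eigen G A 1 u 0 & eigen G A 1 v (v * m2)].
Proof.
move: t ft => [[[y1 y2] y3] ls] [b1 b2 b3 _] /=.
rewrite /x1 /x2 /x3 /= in b1 b2 b3; move=> [e1 [e2 [e3 [s1 s2 s3 hE]]]] /hE[a1 [a2 [a3 [A1 A2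
  A3]]]].
have eig e w a (y : Gr 1 'cV[k]_3) : basis_of (val y) [:: w] -> val y = <[e]>%VS ->
    vsval A *m e = a *: e -> exists l, vsval A *m w = l *: w.
  case/andP=> /eqP sw _ se Ae; have /vlineP[c ->] : w \in <[e]>%VS.
    by rewrite -se -sw memv_span // inE.
  by exists a; rewrite -scalemxAr Ae !scalerA mulrC.
by split; [apply: eig b1 s1 A1|apply: eig b2 s2 A2|apply: eig b3 s3 A3].
Qed.

Lemma eigen_commute (A B : sl3) :
  [/\ eigen G A 1 0 0, eigen G A 1 u 0 & eigen G A 1 v (v * m2)] ->
  [/\ eigen G B 1 0 0, eigen G B 1 u 0 & eigen G B 1 v (v * m2)] ->
  vsval A *m vsval B = vsval B *m vsval A.
Proof.
move=> [[a1 A1] [a2 A2] [a3 A3]] [[b1 B1] [b2 B2] [b3 B3]].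
have comm (w : 'cV[k]_3) a b : vsval A *m w = a *: w -> vsval B *m w = b *: w ->
    (vsval A *m vsval B) *m w = (vsval B *m vsval A) *m w.
  move=> Aw Bw; rewrite -!mulmxA Aw Bw -!scalemxAr Aw Bw !scalerA mulrC //.
have C1 := comm _ _ _ A1 B1; have C2 := comm _ _ _ A2 B2; have C3 := comm _ _ _ A3 B3.
apply: mx_ext => a b c.
have /andP[v0 m20] : (v != 0) && (m2 != 0) by rewrite -negb_or -mulf_eq0.
(* The coefficients of x3 and x2 are read off from the third and then the second coordinate. *)
pose z := c / (v * m2); pose y := (b - z * v) / u.
have -> : G *m cv a b c = (a - y - z) *: (G *m cv 1 0 0) + (y *: (G *m cv 1 u 0) +
    z *: (G *m cv 1 v (v * m2))).
  rewrite !scalemxAr -!mulmxDr !scale_cv !add_cv /y /z; congr (_ *m cv _ _ _); field;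
  by rewrite ?u0 ?v0 ?m20.
by rewrite !mulmxDr -!scalemxAr C1 C2 C3.
Qed.

Lemma lie_commute (A B : sl3) : vsval A *m vsval B = vsval B *m vsval A -> lie A B = 0.
Proof. by move=> AB; rewrite /lie AB subrr linear0. Qed.

Lemma val_lie (A B : sl3) : vsval (lie A B) = vsval A *m vsval B - vsval B *m vsval A.
Proof.
by rewrite /lie vsprojK // memv_ker lfunE /= raddfB /= mxtrace_mulC subrr.
Qed.

(** The algebra is abelian, hence nilpotent. For self-normalization the bracket with Y suffices:
    modulo scalars Y has the distinct eigenvalues 0, p u, p v. If [A, Y] has the eigenvector x_i,
    then (l - Y) A x_i is a multiple of x_i, which forces A x_i to be one too. *)
Lemma rep_cartan (h : {vspace sl3}) : basis_of h (algbasis G H u v m2 p q) ->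
  cartan_subalgebra h.
Proof.
move=> hb; have [p0 q0] := ok_pq; have [v0 m20 m10 vu0] := nondeg vm0 ok_tri.
have comm A B : A \in h -> B \in h -> lie A B = 0.
  by move=> /(eigen_alg _ hb) eA /(eigen_alg _ hb) eB; apply/lie_commute/eigen_commute.
split; [split|].
- by move=> A B Ah Bh; rewrite comm // mem0v.
- exists 1%N; rewrite /= /lieS; apply/eqP; rewrite -subv0; apply/span_subvP.
  by move=> _ /allpairsP[[A B] [/= Ah Bh ->]]; rewrite comm ?mem0v //; apply: vbasis_mem.
move=> A Anorm; set Y := slm (G *m Ymx p q u v *m H).
have Yh : Y \in h by case/andP: hb => /eqP <- _; rewrite memv_span // inE eqxx.
have /(eigen_alg _ hb)[L1 L2 L3] := Anorm Y Yh; apply/(eigen_alg _ hb).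
have [c YE] : exists c, forall a b d, vsval Y *m (G *m cv a b d) =
    G *m cv (p * b - c * a) (p * u * b + q * d - c * b) (p * v * d - c * d).
  exists (\tr (G *m Ymx p q u v *m H) / 3) => a b d.
  rewrite (val_slm char0) mulmxBl mul_scalar_mx -!mulmxA (mulmxA H) HG mul1mx.
  rewrite scalemxAr -mulmxBr mul_mx3_cv scale_cv -scaleN1r scale_cv add_cv.
  by congr (_ *m cv _ _ _); ring.
have HGv (w : 'cV[k]_3) : H *m (G *m w) = w by rewrite mulmxA HG mul1mx.
have GHv w : G *m (H *m w) = w by rewrite mulmxA GH mul1mx.
have [e1 e2] : q * m1 = p * v /\ q * m2 = p * (v - u) by case: hok.
(* The scalar l is the eigenvalue of Y at the vertex, and w0, w1, w2 are the frame coordinates of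
   its image under A; c is the trace correction. *)
have main a b d l : vsval Y *m (G *m cv a b d) = l *: (G *m cv a b d) ->
  eigen G (lie A Y) a b d -> exists w0 w1 w2 m, vsval A *m (G *m cv a b d) = G *m cv w0 w1 w2 /\
    [/\ l * w0 - (p * w1 - c * w0) = m * a, l * w1 - (p * u * w1 + q * w2 - c * w1) = m * b &
        l * w2 - (p * v * w2 - c * w2) = m * d].
  move=> Yw [m]; rewrite val_lie mulmxBl -!mulmxA Yw.
  set w := vsval A *m (G *m cv a b d); rewrite -scalemxAr -/w.
  have [w0 [w1 [w2 wE]]] : exists w0 w1 w2, w = G *m cv w0 w1 w2.
    by exists ((H *m w) o0 0), ((H *m w) o1 0), ((H *m w) o2 0); rewrite -cvE GHv.
  rewrite wE YE => /(congr1 (mulmx H)); rewrite mulmxBr -!scalemxAr !HGv.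
  rewrite !scale_cv -scaleN1r scale_cv add_cv => /cv_inj[E1 E2 E3].
  by exists w0, w1, w2, m; split=> //; split; rewrite -?E1 -?E2 -?E3; ring.
split.
- have [|w0 [w1 [w2 [m [wE [E1 E2 E3]]]]]] := main 1 0 0 (- c) _ L1.
    by rewrite YE scalemxAr scale_cv; congr (_ *m cv _ _ _); ring.
  have w20 : w2 = 0.
    apply: (mulfI (mulf_neq0 p0 v0)); rewrite mulr0 -[RHS]oppr0 -[in RHS](mulr0 m) -E3; ring.
  have w10 : w1 = 0.
    apply: (mulfI (mulf_neq0 p0 u0)); rewrite mulr0 -[RHS]oppr0 -[in RHS](mulr0 m) -E2 w20; ring.
  by exists w0; rewrite wE w10 w20 scalemxAr scale_cv mulr0 mulr1.
- have [|w0 [w1 [w2 [m [wE [E1 E2 E3]]]]]] := main 1 u 0 (p * u - c) _ L2.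
    by rewrite YE scalemxAr scale_cv; congr (_ *m cv _ _ _); ring.
  have w20 : w2 = 0.
    apply: (mulfI (mulf_neq0 p0 vu0)); rewrite mulr0 -[RHS]oppr0 -[in RHS](mulr0 m) -E3; ring.
  have m0 : m = 0 by apply: (mulIf u0); rewrite -E2 w20; ring.
  have w1E : w1 = u * w0.
    apply: (mulfI p0); apply/eqP; rewrite -subr_eq0; apply/eqP.
    by rewrite -[RHS]oppr0 -[in RHS](mul0r 1) -m0 -E1; ring.
  by exists w0; rewrite wE w1E w20 scalemxAr scale_cv mulr0 mulr1 mulrC.
have [|w0 [w1 [w2 [m [wE [E1 E2 E3]]]]]] := main 1 v (v * m2) (p * v - c) _ L3.
  rewrite YE scalemxAr scale_cv; congr (_ *m cv _ _ _); try ring.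
  by transitivity (p * u * v + v * (q * m2) - c * v); [ring|rewrite e2; ring].
have m0 : m = 0 by apply: (mulIf vm0); rewrite -E3; ring.
have w1E : w1 = v * w0.
  apply: (mulfI p0); apply/eqP; rewrite -subr_eq0; apply/eqP.
  by rewrite -[RHS]oppr0 -[in RHS](mul0r 1) -m0 -E1; ring.
have w2E : w2 = v * m2 * w0.
  apply: (mulfI q0); transitivity (v * (q * m2) * w0); last ring.
  rewrite e2; apply/eqP; rewrite -subr_eq0; apply/eqP.
  by rewrite -[RHS]oppr0 -[in RHS](mul0r v) -m0 -E2 w1E; ring.
by exists w0; rewrite wE w1E w2E scalemxAr scale_cv mulr1 ![_ * w0]mulrC.
Qed.

Lemma rep_vanishing (N : {vspace quad}) : basis_of N (qbasis H u v m2 p q) ->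
  vanishing_quadrics t N.
Proof.
move=> Nb; suff NE Q : Q \in N <-> [/\ evq Q (G *m cv 1 0 0) = 0, evq Q (G *m cv 1 u 0) = 0 &
    evq Q (G *m cv 1 v (v * m2)) = 0] by exact/(vanishing_quadricsP _ ft).
have HGv (w : 'cV[k]_3) : H *m (G *m w) = w by rewrite mulmxA HG mul1mx.
have [_ e1 e2] := hok.
split.
  have /andP[/eqP <- _] := Nb => /span3P[x [y [z ->]]].
  have vE w : evq (x *: qf H 0 0 (- v) 0 1 0 + (y *: qf H 0 0 (- (v * m2)) 0 0 1 +
      z *: qf H 0 (- (p * u)) (- q) p 0 0)) w = x * evq (qf H 0 0 (- v) 0 1 0) w +
      (y * evq (qf H 0 0 (- (v * m2)) 0 0 1) w + z * evq (qf H 0 (- (p * u)) (- q) p 0 0) w).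
    have sw := evq_scalar w.
    by rewrite !(scalarfD sw) !(scalarfZ sw).
  rewrite !vE !(evq_qf _ _ _ _ _ _ (HGv _)); split; try ring.
  transitivity (z * v * (p * (v - u) - q * m2)); first ring.
  by rewrite e2 subrr mulr0.
case=> q1 q2 q3; have Qf := vanish_qform u0 vm0 ok_tri q1 q2 q3.
have [_ _ _ e] := Qf; have /= -> := qform_qf HG Qf.
have [|c [pE qE]] := ok_prop (p' := qcoef G Q o1 o1) 
  (q' := - (qcoef G Q o0 o2 + qcoef G Q o1 o2 * v + qcoef G Q o2 o2 * (v * m2))).
  by rewrite mulrN -e.
case/andP: Nb => /eqP <- _.
have -> : qf H 0 (- (qcoef G Q o1 o1 * u)) (- - (qcoef G Q o0 o2 + qcoef G Q o1 o2 * v +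
    qcoef G Q o2 o2 * (v * m2))) (qcoef G Q o1 o1) 0 0 = c *: qf H 0 (- (p * u)) (- q) p 0 0.
  by rewrite qE pE -[RHS]addr0 -(qf0 H) qf_linear; apply: qf_congr; ring.
by rewrite !memvD // memvZ // memv_span // !inE eqxx ?orbT.
Qed.

End Nondegenerate.

(** * Passing to the closure *)

Section Closure.
Variable k : closedFieldType.
Hypothesis char0 : [pchar k] =i pred0.
Notation sl3 := (sl3 k).
Notation quad := (quad k).

Lemma general_at R (t : flags k) : R \in unitmx -> good R t -> general_triangle t ->
  [/\ flagrep (Gmat R t) (tu R t) (tv R t) (tm1 R t) (tm2 R t) t,
      tm1 R t * (tv R t - tu R t) = tm2 R t * tv R t, tu R t != 0 & tv R t * tm2 R t != 0].
Proof.
move=> uR gR gt; have [ft tri] := flag_form uR gR (general_incident uR gR gt).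
have [|u0 vm0] := general_nondegenerate (HGmat t uR) ft; last by split.
by move: t gt {gR ft tri} => [[[y1 y2] y3] [[n1 n2] n3]] [].
Qed.

Lemma reg_slc (X : pspace k) (x : X) (G H : X -> 'M[k]_3) (s : X -> sl3) i j :
  (forall i j, reg x (fun y => G y i j)) -> (forall i j, reg x (fun y => H y i j)) ->
  regv x s -> reg x (fun y => slc (G y) (H y) i j (s y)).
Proof.
move=> rG rH rs; apply: reg_mulmx => //; apply: reg_mulmx => // a b.
exact: mx_reg (regv_linear vsval rs).
Qed.

Lemma reg_evq (X : pspace k) (x : X) (s : X -> quad) (w : X -> 'cV[k]_3) :
  regv x s -> (forall i, reg x (fun y => w y i 0)) -> reg x (fun y => evq (s y) (w y)).
Proof.
move=> rs rw; have rc i j : reg x (fun y => qcoef 1%:M (s y) i j).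
  exact: rs (qcoef_scalar _ _ _).
apply: (eq_reg (s' := fun y =>
  qcoef 1%:M (s y) o0 o0 * (w y o0 0 * w y o0 0) + qcoef 1%:M (s y) o0 o1 * (w y o0 0 * w y o1 0)
  + qcoef 1%:M (s y) o0 o2 * (w y o0 0 * w y o2 0) + qcoef 1%:M (s y) o1 o1 * (w y o1 0 * w y o1 0)
  + qcoef 1%:M (s y) o1 o2 * (w y o1 0 * w y o2 0) + qcoef 1%:M (s y) o2 o2 * (w y o2 0 * w y o2
    0))).
  by move=> y; rewrite {1}[w y]cvE -[cv _ _ _]mul1mx evq_qcoef.
by do ![apply: regD]; apply: regM => //; apply: regM.
Qed.

Lemma reg_qcoef (X : pspace k) (x : X) (G : X -> 'M[k]_3) (s : X -> quad) i j :
  (forall i j, reg x (fun y => G y i j)) -> regv x s ->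
  reg x (fun y => qcoef (G y) (s y) i j).
Proof.
move=> rG rs; have rE l a : reg x (fun y => (G y *m delta_mx l 0 : 'cV[k]_3) a 0).
  by apply: reg_mulmx => // b c; apply: reg_const.
rewrite /qcoef; case: (i == j); first exact: reg_evq.
apply: regB; last exact: reg_evq.
apply: regB; last exact: reg_evq.
by apply: reg_evq => // a; apply: eq_reg (regD (rE i a) (rE j a)) => y; rewrite !mxE.
Qed.

Section Point.
Variables (X : pspace k) (x : X) (pi : X -> flags k) (R : 'M[k]_3) (B : X -> Prop).
Hypotheses (fp : fpull x pi) (uR : R \in unitmx) (gR : good R (pi x)).
Hypotheses (clx : zclosure B x) (Bg : forall y, B y -> general_triangle (pi y)).
Let G y := Gmat R (pi y).
Let H y := Hmat R (pi y).
Let u y := tu R (pi y).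
Let v y := tv R (pi y).
Let m1 y := tm1 R (pi y).
Let m2 y := tm2 R (pi y).

(** Each element of the limit algebra extends to a local section. Along general triangles the
    section satisfies the equations of [aform], and two sections commute; both properties are
    regular identities and survive at x. *)
Lemma alg_closure (ph : X -> Gr 2 sl3) : pull x ph ->
  (forall y, B y -> diagonal_algebra (pi y) (val (ph y))) ->
  exists p q, ok (u x) (v x) (m1 x) (m2 x) p q /\
    basis_of (val (ph x)) (algbasis (G x) (H x) (u x) (v x) (m2 x) p q).
Proof.
move=> pullh Bd.
have rG := reg_Gmat fp gR; have rH := reg_Hmat fp gR.
have [ru rv rm1 rm2] := reg_tcoords fp gR.
have gen y A : B y -> good R (pi y) -> A \in val (ph y) -> 
    [/\ eigen (G y) A 1 0 0, eigen (G y) A 1 (u y) 0 & eigen (G y) A 1 (v y) (v y * m2 y)].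
  move=> By gy Ay; have [fy _ _ _] := general_at uR gy (Bg By).
  exact: general_diag fy _ _ (Bd y By) Ay.
apply: (alg_local char0 (HGmat _ uR)).
  move=> A /(Gr_section pullh)[s [sx rs ns]].
  have form y : B y -> good R (pi y) -> s y \in val (ph y) ->
      aform (G y) (H y) (u y) (v y) (m1 y) (m2 y) (s y).
    move=> By gy sy; have [_ tri u0 vm0] := general_at uR gy (Bg By).
    have [E1 E2 E3] := gen y _ By gy sy.
    exact: (eigen_aform (HGmat _ uR)).
  pose M i j y := slc (G y) (H y) i j (s y).
  have rM i j : reg x (M i j) by apply: reg_slc.
  have lims (e : X -> k) : reg x e -> (forall y,
    aform (G y) (H y) (u y) (v y) (m1 y) (m2 y) (s y) -> e y = 0) ->
      e x = 0.
    move=> re e0; apply: (zclosure_lim clx re).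
    by apply: near_imp (near_and ns (near_good fp gR)) => y [sy gy] By; apply/e0/form.
  have rq : reg x (fun y => M o1 o2 y - v y * M o0 o2 y) by apply: regB => //; apply: regM.
  rewrite -sx; split; [| | |split].
  - by apply: (lims (M o1 o0) (rM _ _)) => y [].
  - by apply: (lims (M o2 o0) (rM _ _)) => y [].
  - by apply: (lims (M o2 o1) (rM _ _)) => y [].
  - apply/eqP; rewrite -subr_eq0; apply/eqP;
    apply: (lims (fun y => M o1 o1 y - M o0 o0 y - M o0 o1 y * u y)).
      by apply: regB; [apply: regB|apply: regM].
    by move=> y [_ _ _ [E _ _ _]]; rewrite /M E subrr.
  - apply/eqP; rewrite -subr_eq0; apply/eqP;
    apply: (lims (fun y => M o2 o2 y - M o0 o0 y - (M o0 o1 y * v y + M o0 o2 y * (v y * m2 y)))).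
      apply: regB; [exact: regB|apply: regD; [exact: regM|]].
      by apply: regM => //; apply: regM.
    by move=> y [_ _ _ [_ E _ _]]; rewrite /M E subrr.
  - apply/eqP; rewrite -subr_eq0; apply/eqP;
    apply: (lims (fun y => m1 y * (M o1 o2 y - v y * M o0 o2 y) - M o0 o1 y * v y)).
      by apply: regB; apply: regM.
    by move=> y [_ _ _ [_ _ E _]]; rewrite /M E subrr.
  - apply/eqP; rewrite -subr_eq0; apply/eqP;
    apply: (lims (fun y => m2 y * (M o1 o2 y - v y * M o0 o2 y) - M o0 o1 y * (v y - u y))).
      by apply: regB; apply: regM => //; apply: regB.
    by move=> y [_ _ _ [_ _ _ E]]; rewrite /M E subrr.
move=> A C /(Gr_section pullh)[s [sx rs ns]] /(Gr_section pullh)[r [rx rr nr]].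
have rs' i j := mx_reg i j (regv_linear vsval rs).
have rr' i j := mx_reg i j (regv_linear vsval rr).
apply/matrixP => i j; apply/eqP; rewrite -subr_eq0; apply/eqP; rewrite -sx -rx.
apply: (zclosure_lim (s := fun y => (vsval (s y) *m vsval (r y)) i j -
  (vsval (r y) *m vsval (s y)) i j) clx).
  by apply: regB; apply: reg_mulmx.
apply: near_imp (near_and (near_and ns nr) (near_good fp gR)) => y [[sy ry] gy] By.
have [_ _ _ vm0] := general_at uR gy (Bg By).
have u0 : u y != 0 by have [] := general_at uR gy (Bg By).
by rewrite (eigen_commute (HGmat _ uR) u0 vm0 (gen y _ By gy sy) (gen y _ By gy ry)) subrr.
Qed.

(** The two forms containing the first side do not involve (p : q), so they vary regularly and lie
    in the limit net. The third cannot be carried over in this way, since p and q are not yet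
    functions near x; it is recovered from [qform]. *)
Lemma quad_closure (pN : X -> Gr 3 quad) : pull x pN ->
  (forall y, B y -> vanishing_quadrics (pi y) (val (pN y))) ->
  exists p q, ok (u x) (v x) (m1 x) (m2 x) p q /\
    basis_of (val (pN x)) (qbasis (H x) (u x) (v x) (m2 x) p q).
Proof.
move=> pullN Bv.
have rG := reg_Gmat fp gR; have rH := reg_Hmat fp gR.
have [ru rv rm1 rm2] := reg_tcoords fp gR.
have [r0 r1] := (reg_const x 0, reg_const x 1).
have rvm : reg x (fun y => v y * m2 y) by apply: regM.
have HGv y (w : 'cV[k]_3) : H y *m (G y *m w) = w by rewrite mulmxA (HGmat _ uR) mul1mx.
apply: (quad_local (HGmat _ uR)).
- move=> Q /(Gr_section pullN)[s [sx rs ns]].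
  have form y : B y -> good R (pi y) -> s y \in val (pN y) ->
      qform (G y) (u y) (v y) (m1 y) (m2 y) (s y).
    move=> By gy sy; have [fy tri u0 vm0] := general_at uR gy (Bg By).
    have [E1 E2 E3] := ((vanishing_quadricsP _ fy).1 (Bv y By) _).1 sy.
    exact: (vanish_qform u0 vm0 tri).
  pose C i j y := qcoef (G y) (s y) i j.
  have rC i j : reg x (C i j) by apply: reg_qcoef.
  pose r y := C o0 o2 y + C o1 o2 y * v y + C o2 o2 y * (v y * m2 y).
  have rr : reg x r by apply: regD; [apply: regD|]; rewrite //; apply: regM.
  have lims (e : X -> k) : reg x e -> (forall y,
    qform (G y) (u y) (v y) (m1 y) (m2 y) (s y) -> e y = 0) ->
      e x = 0.
    move=> re e0; apply: (zclosure_lim clx re).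
    by apply: near_imp (near_and ns (near_good fp gR)) => y [sy gy] By; apply/e0/form.
  rewrite -sx; split.
  + by apply: (lims (C o0 o0) (rC _ _)) => y [].
  + apply/eqP; rewrite -subr_eq0 opprK; apply/eqP;
    apply: (lims (fun y => C o0 o1 y + C o1 o1 y * u y)); first by apply: regD => //; apply: regM.
    by move=> y [_ E _ _]; rewrite /C E addNr.
  + apply/eqP; rewrite -subr_eq0 opprK; apply/eqP;
    apply: (lims (fun y => C o1 o1 y * v y + m1 y * r y)); first by apply: regD; apply: regM.
    by move=> y [_ _ E _]; rewrite /C E addNr.
  + apply/eqP; rewrite -subr_eq0 opprK; apply/eqP;
    apply: (lims (fun y => C o1 o1 y * (v y - u y) + m2 y * r y)).
      by apply: regD; apply: regM => //; apply: regB.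
    by move=> y [_ _ _ E]; rewrite /C E addNr.
- apply: (Gr_lim (s := fun y => qf (H y) 0 0 (- v y) 0 1 0) pullN clx).
    by apply: regv_qf => //; apply: regN.
  apply: near_imp (near_good fp gR) => y gy By; have [fy tri u0 vm0] := general_at uR gy (Bg By).
  apply/((vanishing_quadricsP _ fy).1 (Bv y By)).
  by rewrite !(evq_qf _ _ _ _ _ _ (HGv y _)); split; rewrite /v /u /m2; ring.
- apply: (Gr_lim (s := fun y => qf (H y) 0 0 (- (v y * m2 y)) 0 0 1) pullN clx).
    by apply: regv_qf => //; apply: regN.
  apply: near_imp (near_good fp gR) => y gy By; have [fy tri u0 vm0] := general_at uR gy (Bg By).
  apply/((vanishing_quadricsP _ fy).1 (Bv y By)).
  by rewrite !(evq_qf _ _ _ _ _ _ (HGv y _)); split; rewrite /v /u /m2; ring.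
Qed.

End Point.
End Closure.

(** * Existence of triangles with given coordinates *)

Section RegularFamilies.
Variable k : closedFieldType.
Hypothesis char0 : [pchar k] =i pred0.
Notation sl3 := (sl3 k).
Notation quad := (quad k).
Variables (X : pspace k) (x : X) (G H : X -> 'M[k]_3) (u v m1 m2 p q : X -> k).
Hypotheses (rG : forall i j, reg x (fun y => G y i j)) (rH : forall i j, reg x (fun y => H y i j)).
Hypotheses (ru : reg x u) (rv : reg x v) (rm1 : reg x m1) (rm2 : reg x m2) (rp : reg x p) (rq :
  reg x q).
Let r0 := reg_const x 0.
Let r1 := reg_const x 1.

Lemma regv_Gcv (a b c : X -> k) : reg x a -> reg x b -> reg x c ->
  regv x (fun y => G y *m cv (a y) (b y) (c y)).
Proof.
move=> ra rb rc; apply: regv_mx; apply: reg_mulmx => // i j.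
by case: (ord3P i) => ->; [apply: (eq_reg _ ra)|apply: (eq_reg _ rb)|apply: (eq_reg _ rc)] => y;
  rewrite mxE.
Qed.

Lemma regrel_flagrep : regrel x (fun y t => flagrep (G y) (u y) (v y) (m1 y) (m2 y) t).
Proof.
have rvm : reg x (fun y => v y * m2 y) by apply: regM.
have point (a b : X -> k) : reg x a -> reg x b ->
    regrel x (fun y (z : Gr 1 'cV[k]_3) => basis_of (val z) [:: G y *m cv 1 (a y) (b y)]).
  move=> ra rb; apply: regrel_Gr => i; rewrite ord1 /=.
  by apply: (@regv_Gcv (fun=> 1)).
have line (a b : X -> k) : reg x a -> reg x b ->
    regrel x (fun y (z : Gr 2 'cV[k]_3) =>
      basis_of (val z) [:: G y *m cv 1 0 (a y); G y *m cv 0 1 (b y)]).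
  move=> ra rb; apply: regrel_Gr => i.
  case: i => -[|[|//]] lti /=; first by apply: (@regv_Gcv (fun=> 1) (fun=> 0)).
  by apply: (@regv_Gcv (fun=> 0) (fun=> 1)).
have rP := regrel_prodp (regrel_prodp (point _ _ r0 r0) (point _ _ ru r0)) (point _ _ rv rvm).
have rk : reg x (fun y => (m2 y - m1 y) * v y) by apply: regM => //; apply: regB.
have rL := regrel_prodp (regrel_prodp (line _ _ r0 r0) (line _ _ r0 rm2)) (line _ _ rk rm1).
apply: regrel_imp (regrel_prodp rP rL); apply: nearW => y t.
by move=> [? ? ? [? ? ?]].
Qed.

Lemma regv_algbasis i : regv x (fun y => (algbasis (G y) (H y) (u y) (v y) (m2 y) (p y) (q y))`_i).
Proof.
have rvm : reg x (fun y => v y * m2 y) by apply: regM.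
case: i => [|[|i]] /=; last by rewrite nth_nil; apply: regv_const.
  apply: regv_slm; apply: reg_mulmx => //; apply: reg_mulmx => //.
  apply: (@reg_mx3 _ _ _ (fun=> 0) p (fun=> 0) (fun=> 0) (fun y => p y * u y) q (fun=> 0) (fun=> 0)
    (fun y => p y * v y)) => //; exact: regM.
apply: regv_slm; apply: reg_mulmx => //; apply: reg_mulmx => //.
exact: (@reg_mx3 _ _ _ (fun=> 0) (fun=> 0) (fun=> 1) (fun=> 0) (fun=> 0) v (fun=> 0) (fun=> 0)
    (fun y => v y * m2 y)).
Qed.

Lemma regv_qbasis i : regv x (fun y => (qbasis (H y) (u y) (v y) (m2 y) (p y) (q y))`_i).
Proof.
have rvm : reg x (fun y => v y * m2 y) by apply: regM.
case: i => [|[|[|i]]] /=; last by rewrite nth_nil; apply: regv_const.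
- by apply: (@regv_qf _ _ _ H (fun=> 0) (fun=> 0) (fun y => - v y) (fun=> 0) (fun=> 1) (fun=> 0))
  => //; apply: regN.
- by apply: (@regv_qf _ _ _ H (fun=> 0) (fun=> 0) (fun y => - (v y * m2 y)) (fun=> 0) (fun=> 0)
  (fun=> 1)) => //; apply: regN.
apply: (@regv_qf _ _ _ H (fun=> 0) (fun y => - (p y * u y)) (fun y => - q y) p (fun=> 0) (fun=>
  0)) => //.
  by apply: regN; apply: regM.
exact: regN.
Qed.

Lemma regrel_algbasis : regrel x (fun y (h : Gr 2 sl3) =>
  basis_of (val h) (algbasis (G y) (H y) (u y) (v y) (m2 y) (p y) (q y))).
Proof. by apply: regrel_Gr => i; apply: regv_algbasis. Qed.

Lemma regrel_qbasis : regrel x (fun y (N : Gr 3 quad) =>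
  basis_of (val N) (qbasis (H y) (u y) (v y) (m2 y) (p y) (q y))).
Proof. by apply: regrel_Gr => i; apply: regv_qbasis. Qed.

End RegularFamilies.

Section Existence.
Variable k : closedFieldType.
Hypothesis char0 : [pchar k] =i pred0.
Notation sl3 := (sl3 k).
Notation quad := (quad k).

Definition repThat G H u v m1 m2 p q (z : That k) : Prop :=
  flagrep G u v m1 m2 (sval (sval z).1) /\
  basis_of (val (sval (sval z).2)) (algbasis G H u v m2 p q).

Definition repTSch G H u v m1 m2 p q (z : TSch k) : Prop :=
  flagrep G u v m1 m2 (sval z).1 /\ basis_of (val (sval z).2) (qbasis H u v m2 p q).

(** A factorization of the rank-one matrix with rows (m1, m2) and (v, v - u) as the product of the
    column (p, q) and the row (a, b). *)
Lemma ok_param u v m1 m2 p q : ok u v m1 m2 p q ->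
  exists a b, [/\ v = q * a, u = q * (a - b), m1 = p * a & m2 = p * b :> k].
Proof.
case=> /orP[p0|q0] e1 e2.
  exists (m1 / p), (m2 / p); split; try by rewrite mulrC divfK.
    by apply: (mulfI p0); rewrite -e1; field.
  by apply: (mulfI p0); transitivity (p * v - p * (v - u)); [ring|rewrite -e1 -e2; field].
exists (v / q), ((v - u) / q); split; try by field.
  by apply: (mulfI q0); rewrite e1; field.
by apply: (mulfI q0); rewrite e2; field.
Qed.

Variables (G H : 'M[k]_3).
Hypothesis HG : H *m G = 1%:M.

Lemma flag_exists u v m1 m2 : exists t, flagrep G u v m1 m2 t.
Proof.
have point a b := Gr_exists (point_free HG a b) erefl.
have line a b m := Gr_exists (line_free HG a b m) erefl.
have [[[y1 b1] [y2 b2]] [y3 b3]] := (point 0 0, point u 0, point v (v * m2)).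
have [[[n1 c1] [n2 c2]] [n3 c3]] := (line 0 0 0, line 0 0 m2, line 0 ((m2 - m1) * v) m1).
by exists ((y1, y2, y3), (n1, n2, n3)).
Qed.

(** * A curve of general triangles through a given point *)

Section Curve.
Variables a b p q : k.
(** The factors p, q, a, b are deformed, rather than u, v, m1, m2, so that the relations [ok]
    persist along the curve. Moving a and b in opposite directions makes a - b nonconstant as well,
    so that u = q (a - b) is nonzero for general values. *)
Definition cp (y : aff k 1) := p + (y : 'rV_1) 0 0.
Definition cq (y : aff k 1) := q + (y : 'rV_1) 0 0.
Definition ca (y : aff k 1) := a + (y : 'rV_1) 0 0.
Definition cb (y : aff k 1) := b - (y : 'rV_1) 0 0.
Definition cu y := cq y * (ca y - cb y).
Definition cvv y := cq y * ca y.
Definition cm1 y := cp y * ca y.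
Definition cm2 y := cp y * cb y.

Definition cD : {poly k} :=
  ('X + p%:P) * ('X + q%:P) * ('X + a%:P) * ('X - b%:P) * (2%:P * 'X + (a - b)%:P).

Lemma cD_neq0 : cD != 0.
Proof.
have X0 c : 'X + c%:P != 0 :> {poly k} by rewrite -size_poly_eq0 size_XaddC.
rewrite /cD !mulf_neq0 ?X0 // ?polyXsubC_eq0 //.
(* The leading coefficient 2 of the factor coming from a - b is nonzero. *)
apply/eqP => /(congr1 (fun r : {poly k} => r`_1)) /eqP.
by rewrite coefD coefCM coefX coefC coef0 /= mulr1 addr0 (negPf (nat_neq0 char0 1)).
Qed.

Lemma curve_reg y : [/\ reg y cp, reg y cq, reg y cu, reg y cvv & reg y cm1 /\ reg y cm2].
Proof.
have rc c : reg y (fun y => c + (y : 'rV_1) 0 0) by apply: regD; [apply: reg_const|apply: reg_affX].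
have rb : reg y cb by apply: regB; [apply: reg_const|apply: reg_affX].
split; [exact: rc|exact: rc| | |split]; apply: regM => //; try exact: rc.
by apply: regB => //; exact: rc.
Qed.

Lemma curve_ok y : (cp y != 0) || (cq y != 0) -> ok (cu y) (cvv y) (cm1 y) (cm2 y) (cp y) (cq y).
Proof. by split; rewrite // /cu /cvv /cm1 /cm2; ring. Qed.

Lemma curve0 : [/\ cp (pt1 0) = p, cq (pt1 0) = q, cu (pt1 0) = q * (a - b),
  cvv (pt1 0) = q * a & cm1 (pt1 0) = p * a /\ cm2 (pt1 0) = p * b].
Proof. by rewrite /cu /cvv /cm1 /cm2 /cp /cq /ca /cb mxE !addr0 subr0. Qed.

Lemma curve_general c : cD.[c] != 0 -> [/\ cu (pt1 c) != 0, cvv (pt1 c) * cm2 (pt1 c) != 0 &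
  ok (cu (pt1 c)) (cvv (pt1 c)) (cm1 (pt1 c)) (cm2 (pt1 c)) (cp (pt1 c)) (cq (pt1 c))].
Proof.
rewrite /cD !hornerE => D0.
have : [&& cp (pt1 c) != 0, cq (pt1 c) != 0, ca (pt1 c) != 0,
  cb (pt1 c) != 0 & ca (pt1 c) - cb (pt1 c) != 0].
  apply: contraNT D0; rewrite /cp /cq /ca /cb mxE !negb_and !negbK.
  rewrite !mulf_eq0 -!orbA => /or4P[/eqP E|/eqP E|/eqP E|/orP[/eqP E|/eqP E]].
  - by rewrite addrC E eqxx.
  - by rewrite [c + q]addrC E eqxx !orbT.
  - by rewrite [c + a]addrC E eqxx !orbT.
  - by rewrite -[c - b]opprB E oppr0 eqxx !orbT.
  - by rewrite /= (_ : 2 * c + a - b = 0) ?eqxx ?orbT // -[RHS]E; ring.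
case/and5P=> p0 q0 a0 b0 ab0; split; rewrite ?mulf_neq0 //.
by apply: curve_ok; rewrite p0.
Qed.

End Curve.

Lemma flag_closure u v m1 m2 p q t : ok u v m1 m2 p q -> flagrep G u v m1 m2 t ->
  zclosure (@general_triangle k) t.
Proof.
move=> hok ft C clC gC; have [a [b [vE uE m1E m2E]]] := ok_param hok.
have [c0p c0q c0u c0v [c0m1 c0m2]] := curve0 a b p q.
have [rp rq ru rv [rm1 rm2]] := curve_reg a b p q (pt1 0).
have rG i j := reg_const (pt1 0 : aff k 1) (G i j).
apply: (zclosed_curve (D := cD a b p q) clC (regrel_flagrep rG ru rv rm1 rm2)).
- by rewrite c0u c0v c0m1 c0m2 -uE -vE -m1E -m2E.
- exact: cD_neq0.
move=> c /curve_general[u0 vm0 okc].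
have [t' ft'] := flag_exists (cu a b q (pt1 c)) (cvv a q (pt1 c)) (cm1 a p (pt1 c)) (cm2 b p (pt1
  c)).
by exists t' => //; apply: gC; apply: (rep_general HG u0 vm0 (ok_tri okc) ft').
Qed.

Lemma alg_exists u v m2 p q : (p != 0) || (q != 0) ->
  exists h : Gr 2 sl3, basis_of (val h) (algbasis G H u v m2 p q).
Proof. by move=> pq; apply: Gr_exists => //; apply: algbasis_free. Qed.

Lemma quad_exists u v m2 p q : (p != 0) || (q != 0) ->
  exists N : Gr 3 quad, basis_of (val N) (qbasis H u v m2 p q).
Proof. by move=> pq; apply: Gr_exists => //; apply: (qbasis_free _ _ _ HG). Qed.

(** [That] is a closure inside [T ** reductions], so a limit algebra must first be a point of
    [reductions]; the same curve shows this. *)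
Lemma alg_cartan_closure u v m1 m2 p q (h : Gr 2 sl3) : ok u v m1 m2 p q ->
  basis_of (val h) (algbasis G H u v m2 p q) ->
  zclosure (fun h : Gr 2 sl3 => cartan_subalgebra (val h)) h.
Proof.
move=> hok hb C clC gC; have [a [b [vE uE m1E m2E]]] := ok_param hok.
have [c0p c0q c0u c0v [c0m1 c0m2]] := curve0 a b p q.
have [rp rq ru rv [rm1 rm2]] := curve_reg a b p q (pt1 0).
have rG i j := reg_const (pt1 0 : aff k 1) (G i j).
have rH i j := reg_const (pt1 0 : aff k 1) (H i j).
apply: (zclosed_curve (D := cD a b p q) clC (regrel_algbasis rG rH ru rv rm2 rp rq)).
- by rewrite c0u c0v c0m2 c0p c0q -uE -vE -m2E.
- exact: cD_neq0.
move=> c /curve_general[u0 vm0 okc].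
have [h' hb'] := alg_exists (cu a b q (pt1 c)) (cvv a q (pt1 c)) (cm2 b p (pt1 c)) (let: And3 pq
  _ _ := okc in pq).
by exists h' => //; apply: gC; apply: (rep_cartan char0 HG okc u0 vm0 hb').
Qed.

Lemma That_exists u v m1 m2 p q : ok u v m1 m2 p q -> exists z, repThat G H u v m1 m2 p q z.
Proof.
move=> hok; have [pq _ _] := hok.
have [t ft] := flag_exists u v m1 m2; have [h hb] := alg_exists u v m2 pq.
pose t' : T k := exist _ t (flag_closure hok ft).
pose h' : reductions k := exist _ h (alg_cartan_closure hok hb).
pose B (z : (T k ** reductions k)%PS) :=
  general_triangle (sval z.1) /\ diagonal_algebra (sval z.1) (val (sval z.2)).
suff clz : zclosure B (t', h') by exists (exist _ (t', h') clz).
move=> C clC gC; have [a [b [vE uE m1E m2E]]] := ok_param hok.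
have [c0p c0q c0u c0v [c0m1 c0m2]] := curve0 a b p q.
have [rp rq ru rv [rm1 rm2]] := curve_reg a b p q (pt1 0).
have rG i j := reg_const (pt1 0 : aff k 1) (G i j).
have rH i j := reg_const (pt1 0 : aff k 1) (H i j).
have rT := regrel_sub (zclosure (@general_triangle k)) (regrel_flagrep rG ru rv rm1 rm2).
have rR := regrel_sub (zclosure (fun h : Gr 2 sl3 => cartan_subalgebra (val h)))
  (regrel_algbasis rG rH ru rv rm2 rp rq).
apply: (zclosed_curve (D := cD a b p q) clC (regrel_prodp rT rR)).
- by rewrite /= c0u c0v c0m1 c0m2 c0p c0q -uE -vE -m1E -m2E.
- exact: cD_neq0.
move=> c /curve_general[u0 vm0 okc].
have [h2 hb2] := alg_exists (cu a b q (pt1 c)) (cvv a q (pt1 c)) (cm2 b p (pt1 c)) (let: And3 pq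
  _ _ := okc in pq).
have [t2 ft2] := flag_exists (cu a b q (pt1 c)) (cvv a q (pt1 c)) (cm1 a p (pt1 c)) (cm2 b p (pt1
  c)).
have gt2 := rep_general HG u0 vm0 (ok_tri okc) ft2.
have ch2 := rep_cartan char0 HG okc u0 vm0 hb2.
exists (exist _ t2 (zclosure_self gt2), exist _ h2 (zclosure_self ch2)) => //.
by apply: gC; split=> //=; apply: (rep_diagonal char0 HG okc u0 vm0 ft2 hb2).
Qed.

Lemma TSch_exists u v m1 m2 p q : ok u v m1 m2 p q -> exists z, repTSch G H u v m1 m2 p q z.
Proof.
move=> hok; have [pq _ _] := hok.
have [t ft] := flag_exists u v m1 m2; have [N Nb] := quad_exists u v m2 pq.
suff clz : zclosure (@TSch_general k) (t, N) by exists (exist _ (t, N) clz).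
move=> C clC gC; have [a [b [vE uE m1E m2E]]] := ok_param hok.
have [c0p c0q c0u c0v [c0m1 c0m2]] := curve0 a b p q.
have [rp rq ru rv [rm1 rm2]] := curve_reg a b p q (pt1 0).
have rG i j := reg_const (pt1 0 : aff k 1) (G i j).
have rH i j := reg_const (pt1 0 : aff k 1) (H i j).
apply: (zclosed_curve (D := cD a b p q) clC (regrel_prodp (regrel_flagrep rG ru rv rm1 rm2)
  (regrel_qbasis rH ru rv rm2 rp rq))).
- by rewrite /= c0u c0v c0m1 c0m2 c0p c0q -uE -vE -m1E -m2E.
- exact: cD_neq0.
move=> c /curve_general[u0 vm0 okc].
have [N2 Nb2] := quad_exists (cu a b q (pt1 c)) (cvv a q (pt1 c)) (cm2 b p (pt1 c)) (let: And3 pq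
  _ _ := okc in pq).
have [t2 ft2] := flag_exists (cu a b q (pt1 c)) (cvv a q (pt1 c)) (cm1 a p (pt1 c)) (cm2 b p (pt1
  c)).
exists (t2, N2) => //; apply: gC; split=> /=.
  exact: (rep_general HG u0 vm0 (ok_tri okc) ft2).
exact: (rep_vanishing HG okc u0 vm0 ft2 Nb2).
Qed.

End Existence.

(** * Charts *)

Section Charts.
Variable k : closedFieldType.
Hypothesis char0 : [pchar k] =i pred0.
Notation sl3 := (sl3 k).
Notation quad := (quad k).

Lemma sub_inj (X : pspace k) (A : X -> Prop) (x y : sub A) : sval x = sval y -> x = y.
Proof.
by case: x y => [x Ax] [y Ay] /= xy; move: Ax; rewrite xy => Ax;
  rewrite (proof_irrelevance _ Ax Ay).
Qed.

Lemma flagrep_inj G u v m1 m2 (t t' : flags k) :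
  flagrep G u v m1 m2 t -> flagrep G u v m1 m2 t' -> t = t'.
Proof.
move: t t' => [[[y1 y2] y3] [[n1 n2] n3]] [[[y1' y2'] y3'] [[n1' n2'] n3']].
case=> b1 b2 b3 [c1 c2 c3] [b1' b2' b3' [c1' c2' c3']].
rewrite /x1 /x2 /x3 /l12 /l13 /l23 /= in b1 b2 b3 c1 c2 c3 b1' b2' b3' c1' c2' c3'.
by rewrite (Gr_inj b1 b1') (Gr_inj b2 b2') (Gr_inj b3 b3') (Gr_inj c1 c1') (Gr_inj c2 c2')
  (Gr_inj c3 c3').
Qed.

Lemma repThat_inj G H u v m1 m2 p q (z z' : That k) :
  repThat G H u v m1 m2 p q z -> repThat G H u v m1 m2 p q z' -> z = z'.
Proof.
case=> f b [f' b']; apply: sub_inj; rewrite [sval z]surjective_pairing [sval z']surjective_pairing.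
by congr pair; apply: sub_inj; [apply: flagrep_inj f f'|apply: Gr_inj b b'].
Qed.

Lemma repTSch_inj G H u v m1 m2 p q (z z' : TSch k) :
  repTSch G H u v m1 m2 p q z -> repTSch G H u v m1 m2 p q z' -> z = z'.
Proof.
case=> f b [f' b']; apply: sub_inj; rewrite [sval z]surjective_pairing [sval z']surjective_pairing.
by congr pair; [apply: flagrep_inj f f'|apply: Gr_inj b b'].
Qed.

(** Unlike [pull], this has the same kind of function on both sides, so that the nested projections
    out of [sub] and [**] compose. *)
Definition lpull (X Y : pspace k) (x : X) (f : X -> Y) : Prop :=
  forall s : Y -> k, lrat (f x) s -> lrat x (fun y => s (f y)).

Lemma lpull_fpull (X : pspace k) (x : X) (pi : X -> flags k) : lpull x pi -> fpull x pi.
Proof.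
move=> lpi; split; last split; move=> s ls; apply: lrat_reg.
- exact: (lpi _ (lrat_fst (lrat_fst (lrat_fst ls)))).
- exact: (lpi _ (lrat_fst (lrat_fst (lrat_snd ls)))).
- exact: (lpi _ (lrat_fst (lrat_snd ls))).
- exact: (lpi _ (lrat_snd (lrat_fst (lrat_fst ls)))).
- exact: (lpi _ (lrat_snd (lrat_fst (lrat_snd ls)))).
- exact: (lpi _ (lrat_snd (lrat_snd ls))).
Qed.

Definition tri (z : That k) : flags k := sval (sval z).1.
Definition alg (z : That k) : Gr 2 sl3 := sval (sval z).2.
Definition triS (z : TSch k) : flags k := (sval z).1.
Definition net (z : TSch k) : Gr 3 quad := (sval z).2.

Lemma lpull_tri z : lpull z tri.
Proof. by move=> s ls; apply: (lrat_sub (lrat_fst (lrat_sub ls))). Qed.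

Lemma lpull_alg z : lpull z alg.
Proof. by move=> s ls; apply: (lrat_sub (lrat_snd (lrat_sub ls))). Qed.

Lemma lpull_triS z : lpull z triS.
Proof. by move=> s ls; apply: (lrat_sub (lrat_fst ls)). Qed.

Lemma lpull_net z : lpull z net.
Proof. by move=> s ls; apply: (lrat_sub (lrat_snd ls)). Qed.

Lemma lpull_pull (X : pspace k) (x : X) d (V : vectType k) (f : X -> Gr d V) : lpull x f ->
  pull x f.
Proof. by move=> lf s /lf/lrat_reg. Qed.

Definition repT_at R (t : flags k) p q (z : That k) :=
  repThat (Gmat R t) (Hmat R t) (tu R t) (tv R t) (tm1 R t) (tm2 R t) p q z.
Definition repS_at R (t : flags k) p q (z : TSch k) :=
  repTSch (Gmat R t) (Hmat R t) (tu R t) (tv R t) (tm1 R t) (tm2 R t) p q z.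
Definition ok_at R (t : flags k) p q := ok (tu R t) (tv R t) (tm1 R t) (tm2 R t) p q.

Lemma That_local R z : R \in unitmx -> good R (tri z) ->
  exists p q, ok_at R (tri z) p q /\ repT_at R (tri z) p q z.
Proof.
move=> uR gR; pose pi (w : (T k ** reductions k)%PS) := sval w.1.
pose ph (w : (T k ** reductions k)%PS) := sval w.2.
have fp : fpull (sval z) pi.
  by apply: lpull_fpull => s ls; apply: (lrat_fst (lrat_sub ls)).
have pullh : pull (sval z) ph.
  by apply: lpull_pull => s ls; apply: (lrat_snd (lrat_sub ls)).
have clz := svalP z; have iz := closure_incident fp gR uR clz (fun _ => @proj1 _ _).
have [ft _] := flag_form uR gR iz.
have [p [q [hok hb]]] := alg_closure char0 fp uR gR clz (fun _ => @proj1 _ _) pullh (fun _ =>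
  @proj2 _ _).
by exists p, q.
Qed.

Lemma TSch_local R z : R \in unitmx -> good R (triS z) ->
  exists p q, ok_at R (triS z) p q /\ repS_at R (triS z) p q z.
Proof.
move=> uR gR; pose pi (w : (flags k ** Gr 3 quad)%PS) := w.1.
pose ph (w : (flags k ** Gr 3 quad)%PS) := w.2.
have fp : fpull (sval z) pi by apply: lpull_fpull => s ls; apply: (lrat_fst ls).
have pullh : pull (sval z) ph by apply: lpull_pull => s ls; apply: (lrat_snd ls).
have clz := svalP z; have iz := closure_incident fp gR uR clz (fun _ => @proj1 _ _).
have [ft _] := flag_form uR gR iz.
have [p [q [hok hb]]] := quad_closure fp uR gR clz (fun _ => @proj1 _ _) pullh (fun _ => @proj2 _
  _).
by exists p, q.
Qed.

Lemma ok_scale (u v m1 m2 p q c : k) : c != 0 -> ok u v m1 m2 p q -> ok u v m1 m2 (c * p) (c * q).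
Proof.
move=> c0 [pq e1 e2]; split; first by rewrite !mulf_eq0 !(negPf c0).
  by rewrite -!mulrA e1.
by rewrite -!mulrA e2.
Qed.

Lemma algbasis_scale G H u v m2 p q c (h : Gr 2 sl3) : H *m G = 1%:M -> c != 0 ->
  (p != 0) || (q != 0) ->
  basis_of (val h) (algbasis G H u v m2 p q) ->
    basis_of (val h) (algbasis G H u v m2 (c * p) (c * q)).
Proof.
move=> HG c0 pq /andP[/eqP sh _]; apply: basis_of_Gr => //.
  by apply: algbasis_free => //; rewrite !mulf_eq0 !(negPf c0).
move=> w; rewrite -sh !inE (Ymx_scale G H u v (erefl (c * p)) (erefl (c * q))).
by case/orP=> /eqP->; rewrite ?memvZ // memv_span // !inE eqxx ?orbT.
Qed.

Lemma qbasis_scale G H u v m2 p q c (N : Gr 3 quad) : H *m G = 1%:M -> c != 0 ->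
  (p != 0) || (q != 0) ->
  basis_of (val N) (qbasis H u v m2 p q) -> basis_of (val N) (qbasis H u v m2 (c * p) (c * q)).
Proof.
move=> HG c0 pq /andP[/eqP sN _]; apply: basis_of_Gr => //.
  by apply: (qbasis_free _ _ _ HG); rewrite !mulf_eq0 !(negPf c0).
move=> w; rewrite -sN !inE.
have -> : qf H 0 (- (c * p * u)) (- (c * q)) (c * p) 0 0 = c *: qf H 0 (- (p * u)) (- q) p 0 0.
  by apply: quad_eq => z; have Hz := cvE (H *m z);
    rewrite (scalarfZ (evq_scalar z)) !(evq_qf _ _ _ _ _ _ Hz); ring.
by case/or3P=> /eqP->; rewrite ?memvZ // memv_span // !inE eqxx ?orbT.
Qed.

(* The two coordinates on the exceptional line, and the choice of one of them
   as denominator. *)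
Definition hW (R : 'M[k]_3) (e : bool) := if e then hQ R else hP R.
Definition nW (R : 'M[k]_3) (e : bool) := if e then nQ R else nP R.

Lemma hW_scalar R e b : scalar (hW R e b).
Proof. by case: e; [apply: hQ_scalar|apply: hP_scalar]. Qed.
Lemma nW_scalar R e b : scalar (nW R e b).
Proof. by case: e; [apply: nQ_scalar|apply: nP_scalar]. Qed.

(** The unknown factor of [h_minors] cancels in the ratios, so p and q become functions on the
    chart: q = 1 for [e] true and p = 1 otherwise. *)
Lemma That_chart R e z : R \in unitmx -> good R (tri z) -> minor (hW R e) (alg z) != 0 ->
  let p := minor (hP R) (alg z) / minor (hW R e) (alg z) in
  let q := minor (hQ R) (alg z) / minor (hW R e) (alg z) in
  ok_at R (tri z) p q /\ repT_at R (tri z) p q z.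
Proof.
move=> uR gR W0 /=; have [p [q [hok [ft hb]]]] := That_local uR gR.
have [c c0 [-> ->]] := h_minors char0 uR hb; set w := minor _ _ in W0 *.
have cw : c / w != 0 by rewrite mulf_neq0 ?invr_eq0.
rewrite -![c * _ / w]mulrAC; split; first exact: ok_scale.
by split=> //; apply: algbasis_scale => //; [apply: HGmat|case: hok].
Qed.

Lemma TSch_chart R e z : R \in unitmx -> good R (triS z) -> minor (nW R e) (net z) != 0 ->
  let p := minor (nP R) (net z) / minor (nW R e) (net z) in
  let q := minor (nQ R) (net z) / minor (nW R e) (net z) in
  ok_at R (triS z) p q /\ repS_at R (triS z) p q z.
Proof.
move=> uR gR W0 /=; have [p [q [hok [ft hb]]]] := TSch_local uR gR.
have [c c0 [-> ->]] := n_minors uR hb; set w := minor _ _ in W0 *.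
have cw : c / w != 0 by rewrite mulf_neq0 ?invr_eq0.
rewrite -![c * _ / w]mulrAC; split; first exact: ok_scale.
by split=> //; apply: (qbasis_scale (HGmat _ uR)) => //; case: hok.
Qed.

Lemma That_cover z : exists R e, [/\ R \in unitmx, good R (tri z) & minor (hW R e) (alg z) != 0].
Proof.
have [R uR gR] := good_exists (tri z); have [p [q [[pq _ _] [_ hb]]]] := That_local uR gR.
have [c c0 [hp hq]] := h_minors char0 uR hb; exists R, (q != 0); split=> //.
rewrite /hW; case: ifPn => [q0|/negbNE/eqP q0]; first by rewrite hq mulf_neq0.
by move: pq; rewrite q0 eqxx orbF => p0; rewrite hp mulf_neq0.
Qed.

Lemma TSch_cover z : exists R e, [/\ R \in unitmx, good R (triS z) & minor (nW R e) (net z) != 0].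
Proof.
have [R uR gR] := good_exists (triS z); have [p [q [[pq _ _] [_ hb]]]] := TSch_local uR gR.
have [c c0 [hp hq]] := n_minors uR hb; exists R, (q != 0); split=> //.
rewrite /nW; case: ifPn => [q0|/negbNE/eqP q0]; first by rewrite hq mulf_neq0.
by move: pq; rewrite q0 eqxx orbF => p0; rewrite hp mulf_neq0.
Qed.

End Charts.

(** * The correspondence between algebras and nets *)

Section Correspondence.
Variable k : closedFieldType.
Hypothesis char0 : [pchar k] =i pred0.
Notation sl3 := (sl3 k).
Notation quad := (quad k).

(* The quadratic forms S(w, A w), for S alternating and A in the algebra, vanish
   at the common eigenvectors of the algebra. *)
Definition inc (h : {vspace sl3}) (N : {vspace quad}) : Prop :=
  forall A S, A \in h -> S^T = - S -> mq (S *m vsval A) \in N.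

Section Frame.
Variables (G H : 'M[k]_3) (u v m1 m2 p q : k).
Hypotheses (HG : H *m G = 1%:M) (hok : ok u v m1 m2 p q).
Let GH : G *m H = 1%:M. Proof. exact: mulmx1C. Qed.

(** The form S(w, A w) is written out in [qbasis], with [e] the alternating matrix S in the frame. A
    scalar part of A contributes nothing because S is alternating. *)
Lemma inc_comb x y S (e := G^T *m S *m G) : S^T = - S ->
  mq (S *m vsval (x *: slm (G *m Ymx p q u v *m H) + y *: slm (G *m Zmx v (v * m2) *m H))) =
  (- e o0 o1 * y - e o0 o2 * x * p + e o1 o2 * (x * q * m2 + y * (v * m2))) *: qf H 0 0 (- v) 0 1
    0 +
  ((- e o0 o2 * y - e o1 o2 * (x * q + y * v)) *: qf H 0 0 (- (v * m2)) 0 0 1 +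
   (- e o0 o1 * x) *: qf H 0 (- (p * u)) (- q) p 0 0).
Proof.
move=> antiS; have eT : e^T = - e.
  by rewrite /e !trmx_mul trmxK antiS mulNmx mulmxN mulmxA.
have eN i j : e j i = - e i j by have /matrixP/(_ i j) := eT; rewrite !mxE.
have e_diag i : e i i = 0.
  apply/eqP; have := eN i i; move/eqP; rewrite -subr_eq0 opprK -mulr2n -mulr_natr mulf_eq0.
  by rewrite (negPf (nat_neq0 char0 1)) orbF.
apply: quad_eq => w; have [a [b [d ->]]] : exists a b d, w = G *m cv a b d.
  exists ((H *m w) o0 0), ((H *m w) o1 0), ((H *m w) o2 0).
  by rewrite -cvE mulmxA GH mul1mx.
have HGv (z : 'cV[k]_3) : H *m (G *m z) = z by rewrite mulmxA HG mul1mx.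
have sw := evq_scalar (G *m cv a b d).
rewrite !(scalarfD sw) !(scalarfZ sw) !(evq_qf _ _ _ _ _ _ (HGv _)).
have -> : x *: slm (G *m Ymx p q u v *m H) + y *: slm (G *m Zmx v (v * m2) *m H) =
    slm (G *m (x *: Ymx p q u v + y *: Zmx v (v * m2)) *m H).
  by rewrite mulmxDr mulmxDl linearD -!scalemxAr -!scalemxAl !linearZ.
rewrite (val_slm char0) !scale_mx3 add_mx3; set c := _ / _.
rewrite evq_mqE trmx_mul -!mulmxA.
rewrite mulmxBl mul_scalar_mx -!mulmxA HGv scalemxAr -mulmxBr mul_mx3_cv scale_cv -scaleN1r
  scale_cv add_cv.
rewrite !mulmxA -[_ *m G^T *m S]mulmxA -[_ *m (G^T *m S) *m G]mulmxA -/e.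
have [_ _ e2] := hok; clearbody e.
rewrite mxE sum3 !mxE !sum3 !mxE /= !e_diag (eN o0 o1) (eN o0 o2) (eN o1 o2).
apply/eqP; rewrite -subr_eq0; apply/eqP.
(* The two sides differ by a multiple of the relation q m2 = p (v - u). *)
transitivity (e o1 o2 * x * b * d * (p * (v - u) - q * m2)); first ring.
by rewrite e2 subrr mulr0.
Qed.

Lemma rep_inc (h : {vspace sl3}) (N : {vspace quad}) :
  basis_of h (algbasis G H u v m2 p q) -> basis_of N (qbasis H u v m2 p q) -> inc h N.
Proof.
move=> /andP[/eqP <- _] /andP[/eqP <- _] A S /span2P[x [y ->]] antiS.
by rewrite inc_comb // !memvD // memvZ // memv_span // !inE eqxx ?orbT.
Qed.

(** Three choices of (A, S) give the three basis forms exactly: Z with the first and with the second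
    alternating matrix below, and Y with the first. Hence the algebra determines the net, also over
    degenerate triangles. *)
Lemma inc_sub (h : {vspace sl3}) (N N' : {vspace quad}) :
  basis_of h (algbasis G H u v m2 p q) -> basis_of N (qbasis H u v m2 p q) -> inc h N' ->
    (N <= N')%VS.
Proof.
move=> /andP[/eqP sh _] /andP[/eqP <- _] ihN.
have main x y (e : 'M[k]_3) : e^T = - e ->
    mq (H^T *m e *m H *m vsval (x *: slm (G *m Ymx p q u v *m H) + y *: slm (G *m Zmx v (v * m2)
      *m H))) \in N'.
  move=> eT; apply: ihN; last by rewrite !trmx_mul trmxK eT mulNmx mulmxN mulmxA.
  by rewrite -sh memvD // memvZ // memv_span // !inE eqxx ?orbT.
have GTe (e : 'M[k]_3) : G^T *m (H^T *m e *m H) *m G = e.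
  by rewrite !mulmxA -trmx_mul HG trmx1 mul1mx -mulmxA HG mulmx1.
have eT (e : 'M[k]_3) : e^T = - e -> (H^T *m e *m H)^T = - (H^T *m e *m H).
  by move=> eT; rewrite !trmx_mul trmxK eT mulNmx mulmxN mulmxA.
have a01 : (mx3 0 (- 1) 0 1 0 0 0 0 0 : 'M[k]_3)^T = - mx3 0 (- 1) 0 1 0 0 0 0 0.
  by apply/matrixP => i j; rewrite !mxE; case: (ord3P i) => ->; case: (ord3P j) => -> /=;
    rewrite ?opprK ?oppr0.
have a02 : (mx3 0 0 (- 1) 0 0 0 1 0 0 : 'M[k]_3)^T = - mx3 0 0 (- 1) 0 0 0 1 0 0.
  by apply/matrixP => i j; rewrite !mxE; case: (ord3P i) => ->; case: (ord3P j) => -> /=;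
    rewrite ?opprK ?oppr0.
apply/span_subvP => w; rewrite !inE => /or3P[] /eqP->.
- have := main 0 1 _ a01; rewrite inc_comb; last exact: eT.
  by rewrite GTe !mxE /= !opprK !(mulr0, mul0r, mulr1, oppr0, subr0, addr0, scale0r, scale1r).
- have := main 0 1 _ a02; rewrite inc_comb; last exact: eT.
  by rewrite GTe !mxE /= !opprK !(mulr0, mul0r, mulr1, oppr0, subr0, addr0, add0r, scale0r,
    scale1r).
have := main 1 0 _ a01; rewrite inc_comb; last exact: eT.
by rewrite GTe !mxE /= !opprK !(mulr0, mul0r, mulr1, oppr0, subr0, addr0, add0r, scale0r, scale1r).
Qed.

End Frame.

Definition corr (z : That k) (w : TSch k) : Prop :=
  triS w = tri z /\ inc (val (alg z)) (val (net w)).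

Lemma rep_corr G H u v m1 m2 p q z w : H *m G = 1%:M -> ok u v m1 m2 p q ->
  repThat G H u v m1 m2 p q z -> repTSch G H u v m1 m2 p q w -> corr z w.
Proof.
move=> HG hok [ft hb] [ft' Nb]; split; first exact: flagrep_inj ft' ft.
exact: (rep_inc HG hok (h := val (alg z)) (N := val (net w)) hb Nb).
Qed.

Lemma corr_rep G H u v m1 m2 p q z w : H *m G = 1%:M -> ok u v m1 m2 p q ->
  repThat G H u v m1 m2 p q z -> corr z w -> repTSch G H u v m1 m2 p q w.
Proof.
move=> HG hok [ft hb] [tE izw]; split; first by rewrite -[(sval w).1]/(triS w) tE.
have [pq _ _] := hok; have [N Nb] := quad_exists HG u v m2 pq.
have NN := inc_sub HG hok hb Nb izw.
rewrite -[(sval w).2]/(net w); suff <- : val N = val (net w) by [].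
by apply/eqP; rewrite eqEdim NN !Gr_dim.
Qed.

Lemma corr_total z : exists w, corr z w.
Proof.
have [R uR gR] := good_exists (tri z); have [p [q [hok hz]]] := That_local char0 uR gR.
have [w hw] := TSch_exists char0 (HGmat (tri z) uR) hok.
by exists w; exact: (rep_corr (HGmat (tri z) uR) hok hz hw).
Qed.

Lemma corr_onto w : exists z, corr z w.
Proof.
have [R uR gR] := good_exists (triS w); have [p [q [hok hw]]] := TSch_local uR gR.
have [z hz] := That_exists char0 (HGmat (triS w) uR) hok.
by exists z; exact: (rep_corr (HGmat (triS w) uR) hok hz hw).
Qed.

Lemma corr_fun z w w' : corr z w -> corr z w' -> w = w'.
Proof.
have [R uR gR] := good_exists (tri z); have [p [q [hok hz]]] := That_local char0 uR gR.
by move=> /(corr_rep (HGmat _ uR) hok hz) h /(corr_rep (HGmat _ uR) hok hz); apply: repTSch_inj.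
Qed.

(** The common net determines (p : q) up to a factor through its own minors; together with the
    common triangle this fixes the algebra. *)
Lemma corr_inj z z' w : corr z w -> corr z' w -> z = z'.
Proof.
move=> czw cz'w; have tz : tri z' = tri z by rewrite -cz'w.1 czw.1.
have [R uR gR] := good_exists (tri z); have [p [q [hok hz]]] := That_local char0 uR gR.
have gR' : good R (tri z') by rewrite tz.
have [p' [q' [hok' hz']]] := That_local char0 uR gR'; rewrite tz in hok' hz'.
have [_ b] := corr_rep (HGmat _ uR) hok hz czw; have [_ b'] := corr_rep (HGmat _ uR) hok' hz' cz'w.
have [c c0 [P Q]] := n_minors uR b; have [c' c'0 [P' Q']] := n_minors uR b'.
have pE : p' = c / c' * p by apply: (mulfI c'0); rewrite -P' P; field.
have qE : q' = c / c' * q by apply: (mulfI c'0); rewrite -Q' Q; field.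
apply: repThat_inj hz'; case: hz => ft hb; split=> //; rewrite pE qE.
by apply: algbasis_scale => //; [apply: HGmat|rewrite mulf_neq0 ?invr_eq0|case: hok].
Qed.

(** The choice is harmless by [corr_fun]. As [corr] mentions no frame, no gluing of charts is
    required. *)
Definition phi (z : That k) : TSch k := sval (constructive_indefinite_description _ (corr_total z)).
Definition psi (w : TSch k) : That k := sval (constructive_indefinite_description _ (corr_onto w)).

Lemma phiP z : corr z (phi z). Proof. by rewrite /phi;
  case: constructive_indefinite_description. Qed.
Lemma psiP w : corr (psi w) w. Proof. by rewrite /psi;
  case: constructive_indefinite_description. Qed.

Lemma phiK : cancel phi psi.
Proof. by move=> z; apply: corr_inj (psiP _) (phiP z). Qed.

Lemma psiK : cancel psi phi.
Proof. by move=> w; apply: corr_fun (phiP _) (psiP w). Qed.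

Lemma reg_chartT R e (z : That k) : R \in unitmx -> good R (tri z) -> minor (hW R e) (alg z) != 0 ->
  [/\ reg z (fun y => minor (hP R) (alg y) / minor (hW R e) (alg y)),
      reg z (fun y => minor (hQ R) (alg y) / minor (hW R e) (alg y)) &
      near z (fun y => good R (tri y) /\ minor (hW R e) (alg y) != 0)].
Proof.
move=> uR gR W0; have pa := lpull_pull (@lpull_alg k z).
split; [| |apply: near_and].
- exact: (reg_minor_ratio pa (@hP_scalar _ R) (@hW_scalar _ R e) W0).
- exact: (reg_minor_ratio pa (@hQ_scalar _ R) (@hW_scalar _ R e) W0).
- exact: (near_good (lpull_fpull (@lpull_tri k z)) gR).
- exact: (near_minor pa (@hW_scalar _ R e) W0).
Qed.

Lemma reg_chartS R e (z : TSch k) : R \in unitmx -> good R (triS z) ->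
  minor (nW R e) (net z) != 0 ->
  [/\ reg z (fun y => minor (nP R) (net y) / minor (nW R e) (net y)),
      reg z (fun y => minor (nQ R) (net y) / minor (nW R e) (net y)) &
      near z (fun y => good R (triS y) /\ minor (nW R e) (net y) != 0)].
Proof.
move=> uR gR W0; have pa := lpull_pull (@lpull_net k z).
split; [| |apply: near_and].
- exact: (reg_minor_ratio pa (@nP_scalar _ R) (@nW_scalar _ R e) W0).
- exact: (reg_minor_ratio pa (@nQ_scalar _ R) (@nW_scalar _ R e) W0).
- exact: (near_good (lpull_fpull (@lpull_triS k z)) gR).
- exact: (near_minor pa (@nW_scalar _ R e) W0).
Qed.

Lemma phi_morphism : morphism phi.
Proof.
apply: regrel_morphism => z; have [R [e [uR gR W0]]] := That_cover char0 z.
have [rp rq nz] := reg_chartT uR gR W0.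
pose P y := minor (hP R) (alg y) / minor (hW R e) (alg y).
pose Q y := minor (hQ R) (alg y) / minor (hW R e) (alg y).
exists (fun y w => repS_at R (tri y) (P y) (Q y) w).
  have fp := lpull_fpull (@lpull_tri k z).
  have rG := reg_Gmat fp gR; have rH := reg_Hmat fp gR.
  have [ru rv rm1 rm2] := reg_tcoords fp gR.
  exact: (regrel_sub _ (regrel_prodp (regrel_flagrep rG ru rv rm1 rm2) (regrel_qbasis rH ru rv
    rm2 rp rq))).
apply: near_imp nz => y [gy Wy]; have [hok hy] := That_chart char0 uR gy Wy.
exact: corr_rep (HGmat _ uR) hok hy (phiP y).
Qed.

(** In a chart the inverse map is explicit: the algebra is built with the ratio (p : q) read from
    the net, and [corr_inj] identifies it with the chosen value. *)
Lemma psi_rep R e w : R \in unitmx -> good R (triS w) -> minor (nW R e) (net w) != 0 ->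
  repT_at R (triS w) (minor (nP R) (net w) / minor (nW R e) (net w))
    (minor (nQ R) (net w) / minor (nW R e) (net w)) (psi w).
Proof.
move=> uR gR W0; have [hok hw] := TSch_chart uR gR W0.
have [z hz] := That_exists char0 (HGmat (triS w) uR) hok.
have czw := rep_corr (HGmat _ uR) hok hz hw.
by rewrite -(corr_inj czw (psiP w)).
Qed.

Lemma psi_morphism : morphism psi.
Proof.
apply: regrel_morphism => w; have [R [e [uR gR W0]]] := TSch_cover w.
have [rp rq nz] := reg_chartS uR gR W0.
pose P y := minor (nP R) (net y) / minor (nW R e) (net y).
pose Q y := minor (nQ R) (net y) / minor (nW R e) (net y).
exists (fun y z => repT_at R (triS y) (P y) (Q y) z).
  have fp := lpull_fpull (@lpull_triS k w).
  have rG := reg_Gmat fp gR; have rH := reg_Hmat fp gR.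
  have [ru rv rm1 rm2] := reg_tcoords fp gR.
  exact: (regrel_sub _ (regrel_prodp (regrel_sub _ (regrel_flagrep rG ru rv rm1 rm2))
    (regrel_sub _ (regrel_algbasis rG rH ru rv rm2 rp rq)))).
by apply: near_imp nz => y [gy Wy]; apply: psi_rep.
Qed.

Lemma phi_isomorphism : isomorphism phi.
Proof.
split; first exact: phi_morphism.
by exists psi; split; [exact: psi_morphism|exact: phiK|exact: psiK].
Qed.

Lemma tau_phi z : tauSch (phi z) = tau z.
Proof. by apply: sub_inj; apply: (phiP z).1. Qed.

End Correspondence.

(** * Smoothness and the tautological bundle *)

Section Final.
Variable k : closedFieldType.
Hypothesis char0 : [pchar k] =i pred0.
Notation sl3 := (sl3 k).
Notation quad := (quad k).

Definition flagD R (t : flags k) : k :=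
  (minor (fpoint R) (x1 t) * minor (fpoint R) (x2 t) * minor (fpoint R) (x3 t)) *
  (minor (fline R) (l12 t) * minor (fline R) (l13 t) * minor (fline R) (l23 t)).

Lemma flagD_lin R : lin (flagD R).
Proof.
have lp := minor_lin (@fpoint_scalar k R); have ll := minor_lin (@fline_scalar k R).
exact: (lin_prodp (lin_prodp (lin_prodp lp lp) lp) (lin_prodp (lin_prodp ll ll) ll)).
Qed.

Lemma flagD_good R t : flagD R t != 0 <-> good R t.
Proof.
rewrite /flagD !mulf_eq0 !negb_or -!andbA; split=> [/and5P[? ? ? ? /andP[? ?]]|[? ? ? [? ? ?]]].
  by split=> //; split.
by apply/and5P; split=> //; apply/andP.
Qed.

Definition chartT R e (z : That k) : Prop := flagD R (tri z) * minor (hW R e) (alg z) != 0.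
Definition chartS R e (w : TSch k) : Prop := flagD R (triS w) * minor (nW R e) (net w) != 0.

Lemma chartT_open R e : zopen (chartT R e).
Proof.
have lW := minor_lin (@hW_scalar k R e).
exact: (zopen_lin (lin_sub _ (lin_prodp (lin_sub _ (flagD_lin R)) (lin_sub _ lW)))).
Qed.

Lemma chartS_open R e : zopen (chartS R e).
Proof.
have lW := minor_lin (@nW_scalar k R e).
exact: (zopen_lin (lin_sub _ (lin_prodp (flagD_lin R) lW))).
Qed.

Lemma chartTP R e z : chartT R e z <-> good R (tri z) /\ minor (hW R e) (alg z) != 0.
Proof.
rewrite /chartT mulf_eq0 negb_or; split=> [/andP[/flagD_good]|[/flagD_good ? ?]] //.
exact/andP.
Qed.

Lemma chartSP R e z : chartS R e z <-> good R (triS z) /\ minor (nW R e) (net z) != 0.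
Proof.
rewrite /chartS mulf_eq0 negb_or; split=> [/andP[/flagD_good]|[/flagD_good ? ?]] //.
exact/andP.
Qed.

(** No nondegeneracy is assumed: the commutator is computed directly, and its only possible nonzero
    entry is a multiple of q m2 - p (v - u). *)
Lemma algbasis_commute G H u v m1 m2 p q (h : {vspace sl3}) A B : H *m G = 1%:M ->
  ok u v m1 m2 p q -> basis_of h (algbasis G H u v m2 p q) -> A \in h -> B \in h -> lie A B = 0.
Proof.
move=> HG [_ _ e2] hb /(algbasis_mem char0 HG hb)[x [y [c AE]]].
move=> /(algbasis_mem char0 HG hb)[x' [y' [c' BE]]].
apply: lie_commute; apply: (mx_ext HG) => a b d; rewrite -!mulmxA AE BE AE BE.
congr (_ *m cv _ _ _); try ring.
apply/eqP; rewrite -subr_eq0; apply/eqP.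
by transitivity ((x * y' - y * x') * d * v * (q * m2 - p * (v - u))); [ring|rewrite e2 subrr mulr0].
Qed.

Lemma tautological_abelian (z : That k) : abelian_subalgebra (tautological z).
Proof.
have [R uR gR] := good_exists (tri z); have [p [q [hok [_ hb]]]] := That_local char0 uR gR.
have comm := algbasis_commute (HGmat (tri z) uR) hok hb.
by split=> A B Ah Bh; rewrite comm // mem0v.
Qed.

(** The local frame is [algbasis] with p and q taken from the net, so its coefficients are regular
    on the chart of complete triangles. *)
Lemma tautological_subbundle : subbundle 2 (fun w => tautological (psi char0 w)).
Proof.
move=> w; have [R [e [uR gR W0]]] := TSch_cover w.
exists (chartS R e); split; [exact: chartS_open|exact/chartSP|].
pose P y := minor (nP R) (net y) / minor (nW R e) (net y).
pose Q y := minor (nQ R) (net y) / minor (nW R e) (net y).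
pose S (y : TSch k) := algbasis (Gmat R (triS y)) (Hmat R (triS y)) (tu R (triS y)) (tv R (triS y))
  (tm2 R (triS y)) (P y) (Q y).
exists (fun i y => (S y)`_i); split=> [i j y /chartSP[gy Wy]|y /chartSP[gy Wy]].
  have [rp rq _] := reg_chartS uR gy Wy.
  have fp := lpull_fpull (@lpull_triS k y).
  have rG := reg_Gmat fp gy; have rH := reg_Hmat fp gy.
  have [ru rv _ rm2] := reg_tcoords fp gy.
  have [d [g [h [hg hh hy hE]]]] := regv_algbasis rG rH ru rv rm2 rp rq i (scalar_coord (vbasis
    {:sl3}) j).
  by exists d, g, h; split=> // z _; apply: hE.
have [_ hb] := psi_rep char0 uR gy Wy.
rewrite (_ : [seq _ | i : 'I_2] = S y) //.
apply: (@eq_from_nth _ 0) => [|i]; rewrite size_map size_enum_ord // => lti.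
by rewrite (nth_map (Ordinal lti)) ?size_enum_ord // nth_enum_ord.
Qed.

(** * Affine charts of dimension six *)

Section Smooth.
Variables (R : 'M[k]_3) (e : bool).
Hypothesis uR : R \in unitmx.

Lemma point_coords (x : Gr 1 'cV[k]_3) a b : basis_of (val x) [:: invmx R *m cv 1 a b] ->
  [/\ minor (fpoint R) x != 0, pa R x = a & pb R x = b].
Proof.
move=> /minor_basis[c c0 cE]; have [r0 r1 r2] := rho_cv uR 1 a b.
have upds j := upd_scalar ord0 (@fpoint_scalar k R) (@rho_scalar k R j).
rewrite /pa /pb /gcoord (cE _ (@fpoint_scalar k R)) !(cE _ (upds _)) !det_mx11 !mxE.
rewrite /upd eqxx /fpoint r0 r1 r2 mulr1.
by split=> //; rewrite mulrC mulKf.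
Qed.

Lemma line_coords (l : Gr 2 'cV[k]_3) s c m :
  basis_of (val l) [:: invmx R *m cv 1 s c; invmx R *m cv 0 1 m] ->
  minor (fline R) l != 0 /\ lm R l = m.
Proof.
move=> /minor_basis[d d0 dE]; have [r0 r1 r2] := rho_cv uR 1 s c.
have [t0 t1 t2] := rho_cv uR 0 1 m.
have upds := upd_scalar ord_max (@fline_scalar k R) (@rho_scalar k R o2).
rewrite /lm /gcoord (dE _ (@fline_scalar k R)) (dE _ upds) !det2 !mxE.
rewrite /upd /fline /= r0 r1 r2 t0 t1 t2 !mulr0 !subr0 !mulr1 mul1r.
by split=> //; rewrite mulrC mulKf.
Qed.

(** The converse of [flag_form]: a triangle built in this frame has it as its own moving frame, so
    the parameters can be recovered. *)
Lemma Gp_coords a b m u v m1 m2 t : flagrep (Gp R a b m) u v m1 m2 t -> good R t /\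
  [/\ pa R (x1 t) = a, pb R (x1 t) = b, lm R (l12 t) = m &
  [/\ tu R t = u, tv R t = v, tm1 R t = m1 & tm2 R t = m2]].
Proof.
rewrite /flagrep /Gp -!(mulmxA (invmx R)) !mul_mx3_cv !(mulr0, mulr1, mul0r, mul1r, addr0, add0r).
move=> [/point_coords[g1 a1 b1] /point_coords[g2 a2 _] /point_coords[g3 a3 _]].
move=> [/line_coords[h1 c1] /line_coords[h2 c2] /line_coords[h3 c3]].
split; first by split=> //; split.
by rewrite /tu /tv /tm1 /tm2 a1 a2 a3 b1 c1 c2 c3; do ![split] => //; rewrite addrC addKr.
Qed.

Definition c6 i : 'rV[k]_6 -> k := fun w => w 0 (inord i).

(** These formulas solve the relations [ok]. For q = 1 the free parameters are u, v, p; for p = 1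
    they are m1, m2, q. No equation remains, so the chart is the whole affine space. *)
Definition fp6 w := if e then c6 5 w else 1.
Definition fq6 w := if e then 1 else c6 5 w.
Definition fu6 w := if e then c6 3 w else c6 5 w * (c6 3 w - c6 4 w).
Definition fv6 w := if e then c6 4 w else c6 5 w * c6 3 w.
Definition fm16 w := if e then c6 5 w * c6 4 w else c6 3 w.
Definition fm26 w := if e then c6 5 w * (c6 4 w - c6 3 w) else c6 4 w.

Definition rep6 (w : 'rV[k]_6) (z : That k) : Prop :=
  repThat (Gp R (c6 0 w) (c6 1 w) (c6 2 w)) (Hp R (c6 0 w) (c6 1 w) (c6 2 w))
    (fu6 w) (fv6 w) (fm16 w) (fm26 w) (fp6 w) (fq6 w) z.

Definition coords6 (z : That k) : 'rV[k]_6 := \row_i [:: pa R (x1 (tri z)); pb R (x1 (tri z));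
  lm R (l12 (tri z)); (if e then tu R (tri z) else tm1 R (tri z));
  (if e then tv R (tri z) else tm2 R (tri z));
  (if e then minor (hP R) (alg z) / minor (hQ R) (alg z)
   else minor (hQ R) (alg z) / minor (hP R) (alg z))]`_i.

Lemma ok6 w : ok (fu6 w) (fv6 w) (fm16 w) (fm26 w) (fp6 w) (fq6 w).
Proof.
rewrite /ok /fu6 /fv6 /fm16 /fm26 /fp6 /fq6; case: e; rewrite oner_neq0 ?orbT; split=> //; ring.
Qed.

Lemma rep6_exists w : exists z, rep6 w z.
Proof. exact: (That_exists char0 (HGp _ _ _ uR) (ok6 w)). Qed.

Lemma rep6_coords w z : rep6 w z -> chartT R e z /\ coords6 z = w.
Proof.
case=> /[dup] ft /Gp_coords[gR [Ea Eb Em [Eu Ev Em1 Em2]]] hb.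
have hb' : basis_of (val (alg z)) (algbasis (Gmat R (tri z)) (Hmat R (tri z))
   (fu6 w) (fv6 w) (fm26 w) (fp6 w) (fq6 w)) by rewrite /Gmat /Hmat Ea Eb Em.
have [c c0 [hp hq]] := h_minors char0 uR hb'; split.
  apply/chartTP; split=> //; rewrite /hW; move: hp hq; rewrite /fp6 /fq6.
  by case: e => /= hp hq; rewrite ?hp ?hq mulr1.
apply/rowP => i; rewrite mxE.
have -> : w 0 i = c6 i w by rewrite /c6 inord_val.
case: i => -[|[|[|[|[|[|//]]]]]] lti //=.
- by move: Eu Em1; rewrite /fu6 /fm16; case: e.
- by move: Ev Em2; rewrite /fv6 /fm26; case: e.
- rewrite hp hq /fp6 /fq6; case: e; by rewrite mulr1 mulrAC mulfV // mul1r.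
Qed.

Lemma coords6_rep z : chartT R e z -> rep6 (coords6 z) z.
Proof.
case/chartTP=> gR W0; have /= [hok hz] := That_chart char0 uR gR W0.
have cE i (lti : (i < 6)%N) : c6 i (coords6 z) = [:: pa R (x1 (tri z)); pb R (x1 (tri z));
  lm R (l12 (tri z)); (if e then tu R (tri z) else tm1 R (tri z));
  (if e then tv R (tri z) else tm2 R (tri z));
  (if e then minor (hP R) (alg z) / minor (hQ R) (alg z)
   else minor (hQ R) (alg z) / minor (hP R) (alg z))]`_i by rewrite /c6 mxE inordK.
rewrite /rep6 /fu6 /fv6 /fm16 /fm26 /fp6 /fq6 !cE //=; move: hok hz W0.
rewrite /repT_at /ok_at /hW; case: e => -[pq e1 e2] hz W0.
  by move: e1 e2 hz; rewrite divff // !mul1r => <- <-.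
move: e1 e2 hz; rewrite divff // !mul1r; set q := minor _ _ / _ => e1 e2 hz.
have uE : tu R (tri z) = q * (tm1 R (tri z) - tm2 R (tri z)).
  by rewrite mulrBr e1 e2 opprB addrC subrK.
by rewrite -uE e1.
Qed.

End Smooth.

Lemma That_smooth : smooth (That k).
Proof.
move=> z0; have [R [e [uR gR W0]]] := That_cover char0 z0.
(* With no equations the zero locus is the affine space itself and the rank condition is empty. *)
pose f (i : 'I_0) : {mpoly k[6]} := 0.
exists 6, 0%N, f, (chartT R e), (fun _ => True); split.
- exact: chartT_open.
- exact/chartTP.
(* The complement of the whole space is cut out by the constant form 1. *)
- exists (fun g => g = 1); split=> [_ ->|w]; first by exists 0%N; apply: dhomog1.
  split=> [/(_ I)//|/(_ 1 erefl)/eqP]; by rewrite /ev meval1 oner_eq0.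
- by move=> w _; apply/eqP; rewrite -leqn0 rank_leq_row.
have f0 (v : aff k 6) (i : 'I_0) : (f i).@[(v : 'rV[k]_6) 0] = 0 by case: i.
pose Z := sub (fun _ : zeros f => True).
pose to (z : sub (chartT R e)) : Z :=
  exist _ (exist _ (coords6 R e (sval z)) (f0 _)) I.
have ex (w : Z) : exists z : sub (chartT R e), rep6 R e (sval (sval w)) (sval z).
  have [z hz] := rep6_exists e uR (sval (sval w)); have [cz _] := rep6_coords uR hz.
  by exists (exist _ z cz).
pose from (w : Z) : sub (chartT R e) := sval (constructive_indefinite_description _ (ex w)).
have fromP w : rep6 R e (sval (sval w)) (sval (from w)).
  by rewrite /from; case: constructive_indefinite_description.
exists to; split.
  apply: regrel_morphism => z; have [gz Wz] := (chartTP R e (sval z)).1 (svalP z).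
  exists (fun y (w : Z) => sval (sval w) = coords6 R e (sval y)); last by apply: nearW.
  have lt : lpull z (fun y : sub (chartT R e) => tri (sval y)).
    by move=> s ls; apply: (lrat_sub (lpull_tri ls)).
  have la : lpull z (fun y : sub (chartT R e) => alg (sval y)).
    by move=> s ls; apply: (lrat_sub (lpull_alg ls)).
  have [[ra _ _ [rb _ _]] [rm _ _ _]] := reg_flag_coords (lpull_fpull lt) gz.
  have [ru rv rm1 rm2] := reg_tcoords (lpull_fpull lt) gz.
  have rW : reg z (fun y => if e then minor (hP R) (alg (sval y)) / minor (hQ R) (alg (sval y))
     else minor (hQ R) (alg (sval y)) / minor (hP R) (alg (sval y))).
    apply: reg_if => eE.
      have W1 : minor (hQ R) (alg (sval z)) != 0 by have := Wz;
        rewrite (_ : hW R e = hQ R) // /hW eE.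
      exact: (reg_minor_ratio (lpull_pull la) (@hP_scalar _ R) (@hQ_scalar _ R) W1).
    have W1 : minor (hP R) (alg (sval z)) != 0 by have := Wz;
      rewrite (_ : hW R e = hP R) // /hW (negPf eE).
    exact: (reg_minor_ratio (lpull_pull la) (@hQ_scalar _ R) (@hP_scalar _ R) W1).
  have r3 : reg z (fun y => if e then tu R (tri (sval y)) else tm1 R (tri (sval y))).
    by apply: reg_if.
  have r4 : reg z (fun y => if e then tv R (tri (sval y)) else tm2 R (tri (sval y))).
    by apply: reg_if.
  have rc i : reg z (fun y : sub (chartT R e) => coords6 R e (sval y) 0 i).
    by case: i => -[|[|[|[|[|[|//]]]]]] lti;
      [apply: (eq_reg _ ra)|apply: (eq_reg _ rb)|apply: (eq_reg _ rm)
      |apply: (eq_reg _ r3)|apply: (eq_reg _ r4)|apply: (eq_reg _ rW)] => y; rewrite mxE.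
  exact: (regrel_sub _ (regrel_sub _ (regrel_aff rc))).
exists from; split.
- apply: regrel_morphism => w.
  exists (fun y z => rep6 R e (sval (sval y)) (sval z)); last by apply: nearW.
  have rc i : reg w (fun y : Z => c6 i (sval (sval y))).
    exact: (@reg_sub _ _ _ w _ (@reg_sub _ _ _ (sval w) _ (reg_affX (sval (sval w)) (inord i)))).
  have [r0 r1] := (reg_const w 0, reg_const w 1).
  have rG i j : reg w (fun y : Z => Gp R (c6 0 (sval (sval y))) (c6 1 (sval (sval y))) (c6 2
    (sval (sval y))) i j).
    apply: reg_mulmx => {i j} i j; first exact: reg_const.
    exact: (@reg_mx3 _ _ w _ _ _ _ _ _ _ _ _ r1 r0 r0 (rc 0) r1 r0 (rc 1) (rc 2) r1).
  have rH i j : reg w (fun y : Z => Hp R (c6 0 (sval (sval y))) (c6 1 (sval (sval y))) (c6 2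
    (sval (sval y))) i j).
    apply: reg_mulmx => {i j} i j; last exact: reg_const.
    exact: (@reg_mx3 _ _ w _ _ _ _ _ _ _ _ _ r1 r0 r0 (regN (rc 0)) r1 r0
      (regB (regM (rc 2) (rc 0)) (rc 1)) (regN (rc 2)) r1).
  have rp : reg w (fun y : Z => fp6 e (sval (sval y))) by apply: reg_if.
  have rq : reg w (fun y : Z => fq6 e (sval (sval y))) by apply: reg_if.
  have ru : reg w (fun y : Z => fu6 e (sval (sval y))).
    by apply: reg_if => _; [exact: (rc)|exact: (regM (rc 5) (regB (rc 3) (rc 4)))].
  have rv : reg w (fun y : Z => fv6 e (sval (sval y))).
    by apply: reg_if => _; [exact: (rc)|exact: (regM (rc 5) (rc 3))].
  have rm1 : reg w (fun y : Z => fm16 e (sval (sval y))).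
    by apply: reg_if => _; [exact: (regM (rc 5) (rc 4))|exact: (rc)].
  have rm2 : reg w (fun y : Z => fm26 e (sval (sval y))).
    by apply: reg_if => _; [exact: (regM (rc 5) (regB (rc 4) (rc 3)))|exact: (rc)].
  exact: (regrel_sub _ (regrel_sub _ (regrel_prodp (regrel_sub _ (regrel_flagrep rG ru rv rm1 rm2))
    (regrel_sub _ (regrel_algbasis rG rH ru rv rm2 rp rq))))).
- move=> z; apply: sub_inj; apply: repThat_inj (fromP _) _ => /=.
  exact: (coords6_rep uR (svalP z)).
- move=> w; apply: sub_inj; apply: sub_inj => /=.
  by have [_] := rep6_coords uR (fromP w).
Qed.

End Final.

Theorem proposition7p3 (k : closedFieldType) (char0 : [pchar k] =i pred0) :
  exists phi : That k -> TSch k,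
    [/\ isomorphism phi,
        forall p : That k, tauSch (phi p) = tau p,
        smooth (That k) &
        exists E : TSch k -> {vspace sl3 k},
          [/\ subbundle 2 E,
              forall y : TSch k, abelian_subalgebra (E y) &
              forall p : That k, E (phi p) = tautological p]].
Proof.
exists (phi char0); split.
- exact: phi_isomorphism.
- exact: tau_phi.
- exact: That_smooth.
(* As [phi] is bijective, the required compatibility forces the bundle to be the pullback along the
   inverse. *)
exists (fun w => tautological (psi char0 w)); split.
- exact: tautological_subbundle.
- by move=> w; apply: tautological_abelian.
- by move=> z; rewrite phiK.
Qed.
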